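(* Let $\mathrm{k}=\mathbb R$ or $\mathbb C$. Let $V$ be a finite dimensional non-degenerate quadratic space over $\mathrm{k}$, and let the orthogonal group $\mathrm{O}(V)$ act on $V^n$ diagonally, where $n$ is a positive integer. If $n<\dim V$, and if a tempered generalized function $f$ on $V^n$ is $\mathrm{SO}(V)$-invariant, then $f$ is $\mathrm{O}(V)$-invariant.
   Context: $\dim V$ is the dimension over $\mathrm{k}$. A quadratic space is a $\mathrm{k}$-vector space with a symmetric $\mathrm{k}$-bilinear form; $\mathrm{O}(V)$ is its isometry group and $\mathrm{SO}(V)$ is the subgroup of elements of determinant $1$. A tempered generalized function on the real vector space underlying $V^n$ is a continuous linear functional on the space of (complex) Schwartz densities on it, i.e. Schwartz functions times Lebesgue measure. A generalized function $f$ is invariant under a group $G$ acting on the space if $f(gx)=f(x)$ for all $g\in G$, meaning that the pullback of $f$ under the action of $g$ equals $f$; pullback of generalized functions extends the usual pullback of functions. *)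

(* Defs.v *)
From HB Require Import structures.
From mathcomp Require Import all_boot all_order all_algebra.
From mathcomp Require Import sesquilinear.
From mathcomp Require Import all_classical all_reals all_analysis.
From mathcomp Require Import complex.

Set Implicit Arguments.
Unset Strict Implicit.
Unset Printing Implicit Defensive.

Import Order.TTheory GRing.Theory Num.Theory.
Import numFieldNormedType.Exports.
Import Normc passmx.

Local Open Scope classical_set_scope.
Local Open Scope ring_scope.
Local Open Scope complex_scope.

(* The real vector space underlying a complex one: same carrier, with the real
   number a acting as the complex scalar a%:C. *)
Definition realify (R : rcfType) (V : vectType R[i]) : Type := V.

Section RealifyInstances.
Import VectorInternalTheory.
Variables (R : rcfType) (V : vectType R[i]).

HB.instance Definition _ := GRing.Zmodule.on (realify V).

Definition realify_scale (a : R) (v : realify V) : realify V :=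
  (a%:C *: (v : V))%R.

Fact realify_scaleA a b v :
  realify_scale a (realify_scale b v) = realify_scale (a * b) v.
Proof. by rewrite /realify_scale scalerA -rmorphM. Qed.

Fact realify_scale1 : left_id 1 realify_scale.
Proof. by move=> v; rewrite /realify_scale scale1r. Qed.

Fact realify_scaleDr : right_distributive realify_scale +%R.
Proof. by move=> a u v; rewrite /realify_scale scalerDr. Qed.

Fact realify_scaleDl v : {morph realify_scale^~ v : a b / a + b}.
Proof. by move=> a b; rewrite /realify_scale rmorphD scalerDl. Qed.

HB.instance Definition _ := GRing.Zmodule_isLmodule.Build R (realify V)
  realify_scaleA realify_scale1 realify_scaleDr realify_scaleDl.

Fact realify_vect_axiom : Vector.axiom (dim V + dim V) (realify V).
Proof.
pose p (v : realify V) : 'rV[R]_(dim V + dim V) :=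
  row_mx (map_mx (@complex.Re R) (v2r (v : V))) (map_mx (@complex.Im R) (v2r (v : V))).
pose q (r : 'rV[R]_(dim V + dim V)) : realify V :=
  r2v (\row_j (lsubmx r 0 j +i* rsubmx r 0 j)).
exists p.
  move=> a u v; apply/rowP=> j; rewrite /p mxE [in LHS]/GRing.scale /=.
  rewrite /realify_scale linearD linearZ /= !mxE.
  case: (fintype.split j) => l; rewrite !mxE; move: (v2r (u : V) 0 l) (v2r (v : V) 0 l).
    by move=> [b c] [b' c'] /=; rewrite mul0r subr0.
  by move=> [b c] [b' c'] /=; rewrite mul0r addr0.
exists q => [v | r].
  rewrite /q /p row_mxKl row_mxKr; apply: (canLR v2rK).
  by apply/rowP=> j; rewrite !mxE; case: (v2r _ 0 j).
rewrite /p /q r2vK -[RHS]hsubmxK.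
by congr row_mx; apply/rowP=> j; rewrite !mxE.
Qed.

HB.instance Definition _ :=
  Lmodule_hasFinDim.Build R (realify V) realify_vect_axiom.

Definition realify_lfun (g : 'End(V)) : 'End(realify V) :=
  linfun (g : realify V -> realify V).

Lemma realify_lfunE (g : 'End(V)) (v : V) : realify_lfun g v = g v.
Proof.
have gL : linear (g : realify V -> realify V).
  move=> a u w; rewrite [in LHS]/GRing.scale [in RHS]/GRing.scale /=.
  by rewrite /realify_scale linearP.
pose h := GRing.isLinear.Build R (realify V) (realify V) _ _ gL.
pose H : {linear realify V -> realify V} := HB.pack (g : realify V -> realify V) h.
exact: (lfunE H).
Qed.

End RealifyInstances.

Section OrthogonalGroup.
Variables (k : fieldType) (V : vectType k) (B : {symmetric V}).

Definition lfun_det (g : 'End(V)) : k :=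
  \det (mxof (vbasis {:V}) (vbasis {:V}) g).

Definition in_O (g : 'End(V)) : Prop := lker g == 0%VS /\ isometry B B g.

Definition in_SO (g : 'End(V)) : Prop := in_O g /\ lfun_det g = 1.

End OrthogonalGroup.

Section DiagonalAction.
Variables (R : fieldType) (W : vectType R) (n : nat).

Definition diag_lfun (g : 'End(W)) : 'End({ffun 'I_n -> W}) :=
  linfun (fun x : {ffun 'I_n -> W} => [ffun i => g (x i)]).

Lemma diag_lfunE g (x : {ffun 'I_n -> W}) i : diag_lfun g x i = g (x i).
Proof.
pose f (x : {ffun 'I_n -> W}) : {ffun 'I_n -> W} := [ffun i => g (x i)].
have fL : linear f by move=> a u v; apply/ffunP=> j; rewrite !ffunE linearP.
pose h := GRing.isLinear.Build _ _ _ _ _ fL.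
pose F : {linear {ffun 'I_n -> W} -> {ffun 'I_n -> W}} := HB.pack f h.
by rewrite (lfunE F) ffunE.
Qed.

End DiagonalAction.

Section Schwartz.
Variable R : realType.

Section Coordinates.
Variable m : nat.
Implicit Types (phi : 'rV[R]_m -> R[i]) (s : seq 'I_m).

Definition ReF phi : 'rV[R]_m -> R := fun x => complex.Re (phi x).
Definition ImF phi : 'rV[R]_m -> R := fun x => complex.Im (phi x).

Definition partial (i : 'I_m) phi : 'rV[R]_m -> R[i] :=
  fun x => ('D_(delta_mx 0 i) (ReF phi) x) +i* ('D_(delta_mx 0 i) (ImF phi) x).

(* The multi-index is given as the list of variables of differentiation. *)
Definition partials s phi : 'rV[R]_m -> R[i] := foldr partial phi s.

Definition smooth phi : Prop :=
  forall s, [/\ continuous (ReF (partials s phi)),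
                continuous (ImF (partials s phi)) &
    forall i x, derivable (ReF (partials s phi)) x (delta_mx 0 i) /\
                derivable (ImF (partials s phi)) x (delta_mx 0 i)].

(* "p_(k, s) phi <= M" for the seminorm
   p_(k, s) phi = sup_x (1 + |x|)^k |(d^s phi)(x)|. *)
Definition seminorm_le (k : nat) s phi (M : R) : Prop :=
  forall x : 'rV[R]_m, (1 + `|x|) ^+ k * normc (partials s phi x) <= M.

Definition rV_schwartz phi : Prop :=
  smooth phi /\ forall k s, exists M : R, seminorm_le k s phi M.

(* These balls, for k : nat and d > 0, form a basis of neighbourhoods of 0 for
   the topology of the Schwartz space. *)
Definition rV_schwartz_ball (k : nat) (d : R) phi : Prop :=
  forall s, (size s <= k)%N -> seminorm_le k s phi d.

End Coordinates.

Variable W : vectType R.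
Implicit Types (phi psi : W -> R[i]) (T : (W -> R[i]) -> R[i]).

Definition schwartz phi : Prop := rV_schwartz (phi \o vecof (vbasis {:W})).

Definition schwartz_ball (k : nat) (d : R) phi : Prop :=
  rV_schwartz_ball k d (phi \o vecof (vbasis {:W})).

(* Fix the Lebesgue measure dx on W given by the coordinates in vbasis {:W}.
   Schwartz densities are the phi dx with phi Schwartz, and a tempered generalized
   function f is encoded as the functional T phi = <f, phi dx>.  Only the
   values of T on Schwartz functions are meaningful. *)
Definition tempered T : Prop :=
  (forall (a : R[i]) phi psi, schwartz phi -> schwartz psi ->
     T (fun x => a * phi x + psi x) = a * T phi + T psi) /\
  (forall phi, schwartz phi -> forall e : R, 0 < e ->
     exists k : nat, exists2 d : R, 0 < d &
       forall psi, schwartz psi -> schwartz_ball k d (fun x => psi x - phi x) ->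
         normc (T psi - T phi) < e).

(* Pullback along an invertible linear map A.  For f a function,
   \int f(A x) phi(x) dx = \int f(y) phi(A^-1 y) |det A|^-1 dy. *)
Definition pullback (A : 'End(W)) T : (W -> R[i]) -> R[i] :=
  fun phi => T (fun x => (`|lfun_det A|^-1)%:C * phi ((A^-1)%VF x)).

Definition genfun_eq T T' : Prop := forall phi, schwartz phi -> T phi = T' phi.

(* G is a set of automorphisms of V, acting on W through act. *)
Definition invariant_under (k : fieldType) (V : vectType k) (G : 'End(V) -> Prop)
    (act : 'End(V) -> 'End(W)) T : Prop :=
  forall g, G g -> genfun_eq (pullback (act g) T) T.

End Schwartz.

(* Main.v *)
(* Let r be a reflection.  It suffices to show that the odd part T^- phi = T phi - T (phi o r)
   of an SO(V)-invariant tempered T vanishes on real Schwartz functions.  In the coordinates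
   of an orthogonal basis with B (e_a, e_a) = +- 1, consider the moments
   tau (w) = T^- (w exp (- |x|^2 / 2)) over the monomials w.  Differentiating the invariance
   under one-parameter subgroups of SO(V) makes tau invariant under the infinitesimal
   rotations, while for boosts (or rotations by imaginary angles) it gives relations
   whose part of highest degree says that contractions of tau between rows of different types
   vanish.  As tau is odd under each row reflection and n < dim V, elementary
   invariant theory, by induction on the degree, yields tau = 0.  Hence T^- kills P exp (- Q)
   for Q = |x|^2 / 2 and, expanding exponentials, for every sum of squares
   Q = sum_i a_i (x_i - y_i)^2 with a_i > 0.  Gaussians being dense in the Schwartz space,
   T^- = 0.  Finally an element of O(V) of determinant -1 is in SO(V) r. *)

Require Import Defs.
From HB Require Import structures.
From mathcomp Require Import all_boot all_order all_algebra all_fingroup.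
From mathcomp Require Import zify ring lra.

Set Implicit Arguments.
Unset Strict Implicit.
Unset Printing Implicit Defensive.

Import Order.TTheory GRing.Theory Num.Theory.

Local Open Scope ring_scope.

(** * Functions on words *)

(** A word stands for a product of matrix entries, with one row for each basis vector and one column
    for each copy of V (two over the complex numbers). A rotation invariant functional on words that
    is odd in every row vanishes once it vanishes on the determinants in all its rows, so everything
    hinges on these. For an indefinite form, determinants in the rows of one type do exist when this
    type has at most n rows; the two types exceed n only together. What must be killed are products
    of two determinants, and this is a combinatorial fact on functions from rows to columns, proved
    first. Over the complex numbers all rows rotate together, and the real and imaginary columns
    play the part of the types. The Gaussian is fixed by rotations, while a boost changes it to
    first order by a multiple of a contraction, of degree 2: hence an induction on the degree. A
    tempered functional that kills polynomials times one Gaussian must still be shown to vanish. The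
    Gaussian is deformed into others by steps short enough for the exponential series to converge in
    every seminorm. *)

Section Contraction.
Variables (F : numFieldType) (D : finType) (n : nat) (e : D -> bool).
Variable h : {ffun D -> 'I_n} -> F.
Hypothesis h_alt : forall (x y : D) (k : {ffun D -> 'I_n}), x != y -> e x = e y ->
  h [ffun z => k (tperm x y z)] = - h k.
Hypothesis h_contr : forall (x y : D) (k : {ffun D -> 'I_n}), e x != e y ->
  \sum_j h [ffun z => if (z == x) || (z == y) then j else k z] = 0.
Hypothesis ltnD : (n < #|D|)%N.

Let h_noninj (k : {ffun D -> 'I_n}) x y : x != y -> e x = e y -> k x = k y -> h k = 0.
Proof.
move=> nxy exy kxy; have := h_alt k nxy exy.
have -> : [ffun z => k (tperm x y z)] = k.
  by apply/ffunP => z; rewrite ffunE; case: tpermP => // ->.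
by move=> hk; apply/eqP; move/eqP: hk; rewrite -addr_eq0 -mulr2n mulrn_eq0.
Qed.

Section Fixed.
Variable k : {ffun D -> 'I_n}.
Hypothesis k_inj : forall x y, e x = e y -> k x = k y -> x = y.

Let C := [set c | [exists x, exists y, [&& e x != e y, k x == c & k y == c]]].

Let CP c : reflect (exists x y, [/\ ~~ e x, e y, k x = c & k y = c]) (c \in C).
Proof.
rewrite inE; apply: (iffP existsP) => [[x /existsP [y /and3P [exy /eqP kx /eqP ky]]]|].
  case ex: (e x); last by exists x, y; split; rewrite ?ex //; move: exy; rewrite ex; case: (e y).
  by exists y, x; split; rewrite ?ex //; move: exy; rewrite ex; case: (e y).
move=> [x [y [ex ey kx ky]]]; exists x; apply/existsP; exists y.
by rewrite kx ky !eqxx (negPf ex) ey.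
Qed.

Let H (s : {ffun 'I_n -> 'I_n}) := h [ffun z => s (k z)].

Let fam (B : {set 'I_n}) (s : {ffun 'I_n -> 'I_n}) :=
  [forall c, if c \in C then (s c \in C) == (c \in B) else s c == c].

Let Theta B := \sum_(s | fam B s) H s.

(** Since k is injective on each class, a value in C is taken exactly twice, once in each class;
    changing it changes h at one pair of opposite elements. *)
Let hit x y c : ~~ e x -> e y -> k x = c -> k y = c ->
  forall z, (k z == c) = (z == x) || (z == y).
Proof.
move=> ex ey kx ky z; apply/eqP/orP => [kz|[] /eqP -> //].
case ez: (e z); [right|left]; apply/eqP; apply: k_inj.
- by rewrite ez ey.
- by rewrite kz ky.
- by rewrite ez (negPf ex).
- by rewrite kz kx.
Qed.

Let HC c (s : {ffun 'I_n -> 'I_n}) : c \in C ->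
  \sum_j H [ffun z => if z == c then j else s z] = 0.
Proof.
move=> /CP [x [y [ex ey kx ky]]].
rewrite -[RHS](@h_contr x y [ffun z => s (k z)]); last by rewrite (negPf ex) ey.
apply: eq_bigr => j _; congr h; apply/ffunP => z; rewrite !ffunE.
by rewrite (hit ex ey kx ky).
Qed.

(** Letting the value at c run freely is a contraction, so the total is 0; the values in C
    contribute the first sum and those outside C the second. *)
Let ThetaS (B : {set 'I_n}) c : c \in C -> c \notin B -> Theta (c |: B) = - Theta B.
Proof.
move=> cC cB; apply/eqP; rewrite -addr_eq0; apply/eqP.
pose fam' (s : {ffun 'I_n -> 'I_n}) :=
  (s c == c) && [forall d, (d != c) ==> if d \in C then (s d \in C) == (d \in B) else s d == d].
pose u (s : {ffun 'I_n -> 'I_n}) j : {ffun 'I_n -> 'I_n} := [ffun z => if z == c then j else s z].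
rewrite /Theta.
have E : \sum_(s | fam' s) \sum_j H (u s j) = 0 by rewrite big1 // => s _; exact: HC.
rewrite -[RHS]E pair_big_dep /=.
rewrite [RHS](bigID (fun p : {ffun 'I_n -> 'I_n} * 'I_n => p.2 \in C)) /=.
have famu (s : {ffun 'I_n -> 'I_n}) j : fam' s ->
    fam (c |: B) (u s j) = (j \in C) /\ fam B (u s j) = (j \notin C).
  case/andP => _ /forallP Hs.
  have aux (B' : {set 'I_n}) : (forall d, d != c -> (d \in B') = (d \in B)) ->
     fam B' (u s j) = ((j \in C) == (c \in B')).
    move=> BB'; apply/forallP/eqP => [/(_ c)|jC d]; first by rewrite cC ffunE eqxx => /eqP.
    have [->|dc] := eqVneq d c; first by rewrite ffunE eqxx cC jC.
    rewrite ffunE (negPf dc).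
    by have := Hs d; rewrite dc /= BB'.
  split; rewrite aux //; first by rewrite setU11 eqb_id.
    by move=> d dc; rewrite !inE (negPf dc).
  by rewrite (negPf cB) eqbF_neg.
have famfam' (B' : {set 'I_n}) (s : {ffun 'I_n -> 'I_n}) : (forall d, d != c -> (d \in B') = (d \in B)) ->
    fam B' s -> fam' (u s c).
  move=> BB' /forallP fs; apply/andP; split; first by rewrite ffunE eqxx.
  apply/forallP => d; apply/implyP => dc; rewrite ffunE (negPf dc) -BB' //; exact: fs.
have uu (s : {ffun 'I_n -> 'I_n}) : s = u (u s c) (s c).
  by apply/ffunP => z; rewrite !ffunE; case: eqVneq => [->|].
have uu' (s : {ffun 'I_n -> 'I_n}) j : fam' s -> (u (u s j) c, u s j c) = (s, j).
  case/andP => /eqP sc _; congr pair; last by rewrite ffunE eqxx.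
  by apply/ffunP => z; rewrite !ffunE; case: eqVneq => [->|].
congr (_ + _).
- rewrite [RHS](reindex_onto (fun s => (u s c, s c)) (fun p => u p.1 p.2)) /=; last first.
    by move=> [s j] /= /andP[/andP [fs _] _]; exact: uu'.
  apply: eq_big => [s|s _]; last by rewrite -uu.
  rewrite -uu eqxx !andbT.
  apply/idP/andP => [fs|[fs sC]].
    have fs' : fam' (u s c) by apply: famfam' fs => d dc; rewrite !inE (negPf dc).
    by split; [|rewrite -(famu _ (s c) fs').1 -uu].
  by rewrite (uu s) (famu _ _ fs).1.
- rewrite [RHS](reindex_onto (fun s => (u s c, s c)) (fun p => u p.1 p.2)) /=; last first.
    by move=> [s j] /= /andP[/andP [fs _] _]; exact: uu'.
  apply: eq_big => [s|s _]; last by rewrite -uu.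
  rewrite -uu eqxx !andbT.
  apply/idP/andP => [fs|[fs sC]].
    have fs' : fam' (u s c) by apply: famfam' fs.
    by split; [|rewrite -(famu _ (s c) fs').2 -uu].
  by rewrite (uu s) (famu _ _ fs).2.
Qed.

Let H_noninj (s : {ffun 'I_n -> 'I_n}) c c' : c \in C -> c' \in C -> c != c' -> s c = s c' -> H s = 0.
Proof.
move=> /CP [x [_ [ex _ kx _]]] /CP [x' [_ [ex' _ kx' _]]] ncc' scc'.
apply: (@h_noninj _ x x').
- by apply: contra_neq ncc' => xx'; rewrite -kx -kx' xx'.
- by rewrite (negPf ex) (negPf ex').
- by rewrite !ffunE kx kx'.
Qed.

(** A nonzero term would map C injectively, and outside the whole image of k: a value already taken
    by k off C would collide, at one of the two elements over c, with an element of the same class.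
    Hence |C| + |k(D)| <= n, whereas |C| + |k(D)| = |D|. *)
Let Theta0 : Theta set0 = 0.
Proof.
rewrite /Theta big1 // => s /forallP fs.
apply/eqP/negPn/negP => Hs0.
have sinj : {in C &, injective s}.
  move=> c c' cC c'C scc'; apply/eqP/negPn/negP => ncc'.
  by move/eqP: Hs0; apply; exact: H_noninj ncc' scc'.
have sC c : c \in C -> s c \notin k @: D.
  move=> cC; apply/negP => /imsetP [x _ scx].
  have scC : s c \notin C by have := fs c; rewrite cC in_set0 => /eqP ->.
  have kxC : k x \notin C by rewrite -scx.
  have skx : s (k x) = k x by apply/eqP; have := fs (k x); rewrite (negPf kxC).
  have [y [exy kyc]] : exists y, e y = e x /\ k y = c.
    have [x0 [y0 [ex0 ey0 kx0 ky0]]] := CP _ cC.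
    by case: (e x); [exists y0|exists x0; rewrite (negPf ex0)].
  move/eqP: Hs0; apply; apply: (@h_noninj _ x y) => //.
    by apply: contraNneq kxC => ->; rewrite kyc.
  by rewrite !ffunE kyc skx scx.
pose D0 := [set x | ~~ e x]; pose D1 := [set x | e x].
have cardD : #|D| = (#|k @: D0| + #|k @: D1|)%N.
  rewrite !card_in_imset.
  - rewrite -(cardsC D0); congr (_ + _)%N.
    by apply: eq_card => x; rewrite !inE negbK.
  - by move=> x y; rewrite !inE => ex ey; apply: k_inj; rewrite ex ey.
  - by move=> x y; rewrite !inE => ex ey; apply: k_inj; rewrite (negPf ex) (negPf ey).
have imU : k @: D = (k @: D0) :|: (k @: D1).
  rewrite -imsetU (_ : D0 :|: D1 = setT) //; last by apply/setP => x; rewrite !inE orNb.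
  by apply/setP => c; apply/imsetP/imsetP => -[x _ ->]; exists x; rewrite ?inE.
have CI : C = (k @: D0) :&: (k @: D1).
  apply/setP => c; rewrite in_setI; apply/CP/andP.
    move=> [x [y [ex ey kx ky]]].
    by split; apply/imsetP; [exists x|exists y]; rewrite ?inE.
  move=> [/imsetP [x xD ->] /imsetP [y yD kxy]].
  by exists x, y; split=> //; [move: xD|move: yD]; rewrite inE.
have : (#|s @: C| <= #|~: (k @: D)|)%N.
  apply: subset_leq_card; apply/subsetP => _ /imsetP [c cC ->].
  by rewrite inE; exact: sC.
rewrite card_in_imset //; have := cardsC (k @: D); rewrite card_ord imU cardsU -CI.
have : (#|C| <= #|k @: D0|)%N by rewrite CI subset_leq_card // subsetIl.
move: ltnD; rewrite cardD.
have : (#|k @: D0| + #|k @: D1| - #|C| <= n)%N.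
  rewrite CI -cardsU -imU.
  by have := max_card (mem (k @: D)); rewrite card_ord.
lia.
Qed.

(** Exchanging two values in C transposes two arguments in each class, and the two signs cancel. *)
Let H_tperm (s : {ffun 'I_n -> 'I_n}) c c' : c \in C -> c' \in C ->
  H [ffun z => s (tperm c c' z)] = H s.
Proof.
move=> cC c'C; have [->|ncc'] := eqVneq c c'.
  by congr H; apply/ffunP => z; rewrite ffunE tperm1 perm1.
have [x [y [ex ey kx ky]]] := CP _ cC; have [x' [y' [ex' ey' kx' ky']]] := CP _ c'C.
have nxx' : x != x' by apply: contra_neq ncc' => xx'; rewrite -kx -kx' xx'.
have nyy' : y != y' by apply: contra_neq ncc' => yy'; rewrite -ky -ky' yy'.
rewrite /H -[RHS]opprK -(@h_alt x x') //; last by rewrite (negPf ex) (negPf ex').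
rewrite -(@h_alt y y') //; last by rewrite ey ey'.
congr h; apply/ffunP => z; rewrite !ffunE; congr (s _).
have neqe a b : e a != e b -> a != b by apply: contra_neq => ->.
case: (tpermP y y' z) => [->|->|/eqP zy /eqP zy'].
- by rewrite ky tpermL tpermD ?kx ?ky' //; apply: neqe; rewrite ?ey' ?(negPf ex) ?(negPf ex').
- by rewrite ky' tpermR tpermD ?kx ?ky //; apply: neqe; rewrite ?ey ?(negPf ex) ?(negPf ex').
case: (tpermP x x' z) => [->|->|/eqP zx /eqP zx'].
- by rewrite kx kx' tpermL.
- by rewrite kx kx' tpermR.
by rewrite tpermD // eq_sym; [rewrite (hit ex ey kx ky)|rewrite (hit ex' ey' kx' ky')];
  rewrite negb_or; apply/andP.
Qed.

Let H_perm (s : {perm 'I_n}) : perm_on C s -> H [ffun z => s z] = h k.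
Proof.
have [N] := ubnP #|[set z | s z != z]|; elim: N s => // N IH s leN sC.
have [->|] := eqVneq s 1%g.
  by rewrite /H; congr h; apply/ffunP => z; rewrite !ffunE perm1.
have [/forallP s1|] := boolP [forall z, s z == z].
  by case/negP; apply/eqP/permP => z; rewrite perm1; apply/eqP.
rewrite negb_forall => /existsP [c nsc] _.
have cC : c \in C by apply: (subsetP sC).
have dC : (s^-1)%g c \in C.
  by apply: (subsetP sC); rewrite inE permKV; apply: contra_neq nsc => {1}->; rewrite permKV.
rewrite -(H_tperm _ cC dC).
rewrite -(IH (tperm c ((s^-1)%g c) * s)%g).
- by congr H; apply/ffunP => z; rewrite !ffunE permM.
- rewrite -ltnS; apply: leq_trans leN; rewrite ltnS; apply/proper_card/properP; split.
    apply/subsetP => z; rewrite !inE permM; case: tpermP => [->//|->|//].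
    by rewrite permKV => _; apply: contra_neq nsc => {1}->; rewrite permKV.
  by exists c; rewrite !inE ?nsc // permM tpermL permKV eqxx.
- apply: perm_onM => //; apply: subset_trans (tperm_on _ _) _.
  by apply/subsetP => z /set2P[] ->.
Qed.

(** Noninjective maps contribute 0 and each permutation of C contributes h k; the identity is among
    them, so the count is positive. *)
Let ThetaC : exists2 N, (0 < N)%N & Theta C = h k *+ N.
Proof.
rewrite /Theta; exists #|[pred s : {ffun 'I_n -> 'I_n} | fam C s & injectiveb s]|.
  apply/card_gt0P; exists [ffun z => z]; rewrite inE; apply/andP; split.
    by apply/forallP => c; rewrite ffunE; case: ifP => // ->.
  by apply/injectiveP => x y; rewrite !ffunE.
rewrite (bigID (fun s : {ffun 'I_n -> 'I_n} => injectiveb s)) /= [X in _ + X]big1 ?addr0.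
  rewrite -sumr_const; apply: eq_bigr => s /andP[/forallP fs /injectiveP si].
  rewrite -(H_perm (s := perm si)).
    by congr H; apply/ffunP => z; rewrite ffunE permE.
  apply/subsetP => z; rewrite inE permE; apply: contraNT => zC.
  by have := fs z; rewrite (negPf zC).
move=> s /andP[/forallP fs].
move/injectiveP => si; apply/eqP/negPn/negP => Hs.
apply: si => x y sxy; apply/eqP/negPn/negP => nxy.
have := fs x; have := fs y; case: ifP => yC /eqP sy; case: ifP => xC /eqP sx.
- by case/eqP: Hs; exact: H_noninj nxy sxy.
- by move: xC; rewrite -sx sxy sy yC.
- by move: yC; rewrite -sy -sxy sx xC.
- by case/eqP: nxy; rewrite -sx -sy.
Qed.

(* C is the set of the values taken by k on both classes of e, and Theta B sums h over the
   modifications of k on C whose values on C lie in C exactly over B.  The contractions give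
   Theta (c |: B) = - Theta B; since n < #|D| there is no room for Theta set0, whereas Theta C
   is a positive multiple of h k. *)
Lemma contraction_fixed : h k = 0.
Proof.
suff TB (B : {set 'I_n}) : B \subset C -> Theta B = 0.
  have [N N0] := ThetaC; rewrite TB // => /esym/eqP.
  by rewrite mulrn_eq0 (gtn_eqF N0) => /eqP.
have [N] := ubnP #|B|; elim: N B => // N IH B; rewrite ltnS => leN sB.
have [->|[c cB]] := set_0Vmem B; first exact: Theta0.
rewrite -(setD1K cB) ThetaS ?IH ?oppr0 ?(subsetP sB) ?setD11 //.
  by move: leN; rewrite (cardsD1 c B) cB.
by apply: subset_trans sB; exact: subD1set.
Qed.

End Fixed.

Lemma contraction_eq0 k : h k = 0.
Proof.
have [/'forall_'forall_implyP ki|] :=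
  boolP [forall x, forall y, (e x == e y) && (k x == k y) ==> (x == y)].
  apply: contraction_fixed => x y exy kxy; apply/eqP/ki.
  by rewrite exy kxy !eqxx.
rewrite negb_forall => /existsP[x]; rewrite negb_forall => /existsP[y].
by rewrite negb_imply => /andP[/andP[/eqP exy /eqP kxy] nxy]; exact: h_noninj exy kxy.
Qed.
End Contraction.

(** * Tensors with the Casimir relation and vanishing minors *)

Section Tensor.
Variables (F : numFieldType) (T : finType) (N : nat).
Implicit Types (t : {ffun 'I_N -> T} -> F) (a : {ffun 'I_N -> T}).

Definition pact (s : {perm 'I_N}) a : {ffun 'I_N -> T} := [ffun l => a (s l)].

Definition substp (s : T -> 'I_N) (r : {perm T}) a : {ffun 'I_N -> T} :=
  [ffun l => if [pick x | s x == l] is Some x then r x else a l].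

(* The relation satisfied by the rotation invariant tensors whose traces all vanish. *)
Definition casimir t :=
  forall j a, (#|T|%:R - 1) * t a + \sum_(i | i != j) t (pact (tperm i j) a) = 0.

(** Antisymmetrization over #|T| positions filled with the distinct elements of T: the tensor form
    of a vanishing maximal minor. *)
Definition minor_free t :=
  forall s a, injective s -> \sum_(r : {perm T}) (-1) ^+ r * t (substp s r a) = 0.

Lemma pactM s s' a : pact s (pact s' a) = pact (s * s') a.
Proof. by apply/ffunP => l; rewrite !ffunE permM. Qed.

(** Conjugation by a transposition of positions carries the relation at j to the relation at its
    image. *)
Lemma casimir_act t i0 j0 : casimir t -> casimir (fun a => t (pact (tperm i0 j0) a)).
Proof.
move=> ht j a; set th := tperm i0 j0; rewrite -[RHS](ht (th j) (pact th a)).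
congr (_ + _); rewrite [RHS](reindex_inj (@perm_inj _ th)) /=.
apply: eq_big => [i|i _]; first by rewrite (inj_eq perm_inj).
congr t; rewrite !pactM; congr pact.
by rewrite -tpermJ conjgE tpermV -!mulgA tperm2 mulg1.
Qed.

Lemma minor_free_act t i0 j0 : minor_free t -> minor_free (fun a => t (pact (tperm i0 j0) a)).
Proof.
move=> ht s a si; set th := tperm i0 j0.
rewrite -[RHS](ht (th \o s) (pact th a)); last by move=> x y /= /perm_inj /si.
apply: eq_bigr => r _; congr (_ * t _); apply/ffunP => l; rewrite !ffunE.
have -> : [pick x | s x == th l] = [pick x | (th \o s) x == l].
  by apply: eq_pick => x /=; rewrite -(inj_eq (@perm_inj _ th)) tpermK.
by case: pickP.
Qed.

Definition alt_on (S : {set 'I_N}) t :=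
  forall i j a, i \in S -> j \in S -> i != j -> t (pact (tperm i j) a) = - t a.

(** A repeated value on S gives 0 by alternation. Otherwise a is a bijection from S to T, and by
    alternation all the terms of the minor relation are equal to t a. *)
Lemma alt_full (S : {set 'I_N}) t : #|S| = #|T| -> minor_free t -> alt_on S t ->
  forall a, t a = 0.
Proof.
move=> cS ht alt a.
have [/'forall_'forall_implyP ai|] :=
    boolP [forall i, forall j, [&& i \in S, j \in S & a i == a j] ==> (i == j)]; last first.
  rewrite negb_forall => /existsP[i]; rewrite negb_forall => /existsP[j].
  rewrite negb_imply => /andP[/and3P[iS jS /eqP aij] nij].
  have := alt i j a iS jS nij.
  have -> : pact (tperm i j) a = a by apply/ffunP => l; rewrite ffunE; case: tpermP => // ->.
  by move=> hk; apply/eqP; move/eqP: hk; rewrite -addr_eq0 -mulr2n mulrn_eq0.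
have aS : a @: S = setT.
  apply/eqP; rewrite eqEcard subsetT /= cardsT card_in_imset ?cS //.
  by move=> i j iS jS aij; apply/eqP/ai; rewrite iS jS aij eqxx.
have exs x : exists i, (i \in S) && (a i == x).
  have /imsetP[i iS ->] : x \in a @: S by rewrite aS inE.
  by exists i; rewrite iS eqxx.
pose s x := xchoose (exs x).
have sS x : s x \in S by have /andP[] := xchooseP (exs x).
have as_ x : a (s x) = x by have /andP[_ /eqP] := xchooseP (exs x).
have si : injective s by move=> x y sxy; rewrite -(as_ x) sxy as_.
have pk r x : substp s r a (s x) = r x.
  rewrite ffunE; case: pickP => [y /eqP /si -> //|/(_ x)]; by rewrite eqxx.
have npk r l : (forall x, s x != l) -> substp s r a l = a l.
  by move=> sl; rewrite ffunE; case: pickP => // x /eqP sx; have := sl x; rewrite sx eqxx.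
have subE r : t (substp s r a) = (-1) ^+ r * t a.
  have [ts -> dts] := prod_tpermP r.
  elim: ts dts => [_|[x y] ts IH /andP[/= nxy dts]].
    rewrite big_nil odd_perm1 mul1r; congr t; apply/ffunP => l.
    case: (pickP (fun x => s x == l)) => [x /eqP <-|sl]; first by rewrite pk perm1 as_.
    by rewrite npk // => x; rewrite sl.
  rewrite big_cons odd_mul_tperm nxy addTb signrN mulNr -IH //.
  rewrite -(alt (s x) (s y)) ?(inj_eq si) //; congr t; apply/ffunP => l; rewrite [RHS]ffunE.
  case: (pickP (fun x => s x == l)) => [z /eqP <-|sl].
    by rewrite -(inj_tperm _ _ _ si) !pk permM.
  have sl' z : s z != l by rewrite sl.
  by rewrite tpermD // !npk.
have := ht s a si.
under eq_bigr => r _ do rewrite subE mulrA -signr_addb addbb mul1r.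
rewrite sumr_const => /eqP; rewrite mulrn_eq0 => /orP[|/eqP //].
by rewrite (cardD1 1%g).
Qed.

(** The identity and the transpositions of j with the elements of S represent the cosets of Sym S in
    Sym (j |: S), so their signed sum completes the antisymmetrization. *)
Lemma alt_extend (S : {set 'I_N}) t j : j \notin S -> alt_on S t ->
  alt_on (j |: S) (fun a => t a - \sum_(i in S) t (pact (tperm i j) a)).
Proof.
move=> jS alt.
have altj i a : i \in S -> t (pact (tperm i j) a) - \sum_(l in S) t (pact (tperm l j) (pact (tperm i j) a)) =
    - (t a - \sum_(l in S) t (pact (tperm l j) a)).
  move=> iS; rewrite !(bigD1 i iS) /= pactM tperm2 (_ : pact 1 a = a); last first.
    by apply/ffunP => l; rewrite ffunE perm1.
  rewrite (_ : \sum_(l in S | l != i) _ = - \sum_(l in S | l != i) t (pact (tperm l j) a)).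
    by ring.
  rewrite -sumrN; apply: eq_bigr => l /andP[lS nli]; rewrite -(alt l i) // !pactM.
  have nij : i != j by apply: contraNneq jS => <-.
  congr (t (pact _ a)); apply: (mulIg (tperm l j)); rewrite -[RHS]mulgA tperm2 mulg1.
  rewrite -{1}(tpermV l j) -mulgA -conjgE tpermJ tpermR.
  by have -> : tperm l j i = i; [rewrite tpermD // eq_sym|exact: tpermC].
move=> i i' a; rewrite !in_setU1 => /orP[/eqP ->|iS] /orP[/eqP ->|i'S]; rewrite ?eqxx // => nii'.
- by rewrite tpermC; exact: altj.
- exact: altj.
rewrite alt // opprD opprK addrC -sumrN addrC; congr (_ + _).
rewrite (reindex_inj (@perm_inj _ (tperm i i'))) /=; apply: eq_big => l.
  by case: tpermP => [->|->|//]; rewrite iS i'S.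
move=> lS; apply: (canLR (@opprK _)); rewrite -[RHS](alt i i') // !pactM; congr (t (pact _ a)).
have jE : tperm i i' j = j by rewrite tpermD //; apply: contraNneq jS => <-.
apply: (mulgI (tperm i i')).
rewrite !mulgA tperm2 mul1g -{1}(tpermV i i') -{1}jE -tpermJ conjgE.
by rewrite tpermV -!mulgA tperm2 mulg1 !mulgA tperm2 mul1g.
Qed.

Lemma casimir_extend t j (S : {set 'I_N}) : casimir t ->
  casimir (fun a => t a - \sum_(i in S) t (pact (tperm i j) a)).
Proof.
move=> ht j' a; rewrite sumrB mulrBr addrACA ht add0r -opprD.
rewrite exchange_big mulr_sumr -big_split /= big1 ?oppr0 // => l _.
exact: (casimir_act l j ht).
Qed.

Lemma minor_free_extend t j (S : {set 'I_N}) : minor_free t ->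
  minor_free (fun a => t a - \sum_(i in S) t (pact (tperm i j) a)).
Proof.
move=> ht s a si; under eq_bigr do rewrite mulrBr mulr_sumr.
rewrite sumrB ht // exchange_big big1 ?subrr // => l _.
exact: (minor_free_act l j ht).
Qed.

(* Descending induction on #|S|.  Antisymmetrizing t over one more index j yields a tensor
   alternating on j |: S, hence 0; summing the Casimir relations over S then leaves a positive
   multiple of t. *)
Lemma alt_eq0 (S : {set 'I_N}) t : (0 < #|S|)%N -> (#|S| <= #|T|)%N ->
  casimir t -> minor_free t -> alt_on S t -> forall a, t a = 0.
Proof.
have [m] := ubnP (#|T| - #|S|); elim: m S t => // m IH S t leS S0 ST ht mt alt.
have [cST|nST] := eqVneq #|S| #|T|; first exact: alt_full cST mt alt.
have ltST : (#|S| < #|T|)%N by rewrite ltn_neqAle nST.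
have step j a : j \notin S -> \sum_(i in S) t (pact (tperm i j) a) = t a.
  move=> jS; apply/esym/eqP; rewrite -subr_eq0; apply/eqP.
  apply: (IH (j |: S) (fun a => t a - \sum_(i in S) t (pact (tperm i j) a))).
  - by rewrite cardsU1 jS; lia.
  - by rewrite cardsU1 jS.
  - by rewrite cardsU1 jS.
  - exact: casimir_extend.
  - exact: minor_free_extend.
  - exact: alt_extend.
move=> a.
have row i : i \in S ->
    (#|T| - #|S|)%:R * t a + \sum_(j in ~: S) t (pact (tperm i j) a) = 0.
  move=> iS; rewrite -[RHS](ht i a) [in RHS](bigID (mem S)) /= addrA; congr (_ + _).
    rewrite [X in _ = _ + X](eq_bigr (fun=> - t a)); last first.
      by move=> l /andP[nli lS]; rewrite alt.
    rewrite sumr_const mulNrn (natrB _ ST).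
    have -> : #|[pred l | l != i & l \in S]| = #|S|.-1.
      by rewrite (cardD1 i S) iS; apply: eq_card => l; rewrite !inE.
    by rewrite -[in LHS](prednK S0) -(addn1 #|S|.-1) natrD -[X in _ = _ - X]mulr_natl; ring.
  apply: eq_big => l; last by rewrite tpermC.
  by rewrite !inE andb_idl //; apply: contraNneq => ->.
have : \sum_(i in S) ((#|T| - #|S|)%:R * t a + \sum_(j in ~: S) t (pact (tperm i j) a)) = 0.
  by rewrite big1.
rewrite big_split /= sumr_const exchange_big /=.
rewrite (eq_bigr (fun=> t a)); last by move=> j; rewrite inE; exact: step.
rewrite sumr_const mulr_natl -mulrnA -mulrnDr => /eqP.
by rewrite mulrn_eq0 addn_eq0 muln_eq0 subn_eq0 leqNgt ltST (gtn_eqF S0) => /eqP.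
Qed.

Lemma casimir_eq0 t : (0 < #|T|)%N -> (0 < N)%N -> casimir t -> minor_free t -> forall a, t a = 0.
Proof.
(* Alternation on a singleton is vacuous, which starts the induction. *)
move=> T0 N0 ht mt; apply: (@alt_eq0 [set Ordinal N0]); rewrite ?cards1 //.
by move=> i j a /set1P -> /set1P ->; rewrite eqxx.
Qed.

End Tensor.

(** * Derivations and symmetric functionals on words *)

Section Derivation.
Variables (F : numFieldType).

(* The derivation of the algebra of words which sends the letter x to
   \sum_(p <- d x) p.1 * p.2, seen through the linear form f. *)
Fixpoint der (L : Type) (d : L -> seq (F * L)) (f : seq L -> F) (w : seq L) : F :=
  if w is x :: w' then
    \sum_(p <- d x) p.1 * f (p.2 :: w') + der d (fun v => f (x :: v)) w'
  else 0.

Lemma eq_der L (d : L -> seq (F * L)) f g w : f =1 g -> der d f w = der d g w.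
Proof.
elim: w f g => //= x w IH f g fg; congr (_ + _); last exact: IH.
by apply: eq_bigr => p _; rewrite fg.
Qed.

Lemma der_lin L (d : L -> seq (F * L)) (I : Type) (r : seq I) (c : I -> F) (f : I -> seq L -> F) w :
  der d (fun v => \sum_(i <- r) c i * f i v) w = \sum_(i <- r) c i * der d (f i) w.
Proof.
elim: w f => /= [|x w IH] f; first by rewrite big1 // => i _; rewrite mulr0.
rewrite IH (eq_bigr _ (fun p _ => mulr_sumr _ _ _ _)) exchange_big -big_split /=.
apply: eq_bigr => i _; rewrite mulrDr mulr_sumr; congr (_ + _).
by apply: eq_bigr => p _; rewrite mulrCA.
Qed.

Lemma der_cat L (d : L -> seq (F * L)) f w r :
  der d f (w ++ r) = der d (fun v => f (v ++ r)) w + der d (fun v => f (w ++ v)) r.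
Proof.
elim: w f => /= [|x w IH] f; first by rewrite add0r.
by rewrite IH addrA.
Qed.

Lemma der_nil L (d : L -> seq (F * L)) f w : all (fun x => nilp (d x)) w -> der d f w = 0.
Proof.
elim: w f => //= x w IH f /andP[/nilP -> dw]; rewrite big_nil IH ?addr0 //.
Qed.

Lemma der_map L (d : L -> seq (F * L)) (I : eqType) (s : seq I) (g : I -> L) f : uniq s ->
  der d f (map g s) = \sum_(i <- s) \sum_(p <- d (g i)) p.1 * f [seq if j == i then p.2 else g j | j <- s].
Proof.
elim: s f => /= [|x s IH] f; first by rewrite big_nil.
case/andP => xs us; rewrite big_cons eqxx; congr (_ + _).
  apply: eq_bigr => p _; congr (_ * f (_ :: _)); apply/eq_in_map => j js.
  by case: eqP => // jx; rewrite -jx js in xs.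
rewrite IH //; apply: eq_big_seq => i iS; apply: eq_bigr => p _.
by case: eqP => // xi; rewrite xi iS in xs.
Qed.

End Derivation.

Section Words.
Variables (F : numFieldType) (T : finType) (K : eqType).
Implicit Types (f : seq (T * K) -> F) (b c : T).

(* A letter (t, k) stands for the coordinate of index t of the k-th vector. *)
Definition rotd b c (x : T * K) : seq (F * (T * K)) :=
  (if x.1 == b then [:: (1, (c, x.2))] else [::]) ++
  (if x.1 == c then [:: (-1, (b, x.2))] else [::]).

Lemma sum_rotd b c x (g : T * K -> F) : \sum_(p <- rotd b c x) p.1 * g p.2 =
  (x.1 == b)%:R * g (c, x.2) - (x.1 == c)%:R * g (b, x.2).
Proof.
rewrite /rotd big_cat /=.
by case: eqP => _; case: eqP => _; rewrite ?big_seq1 ?big_nil ?mulN1r ?mul1r ?mul0r ?subr0 ?add0r ?addr0.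
Qed.

Definition wsym f := forall w w', perm_eq w w' -> f w = f w'.
Definition wrot f := forall b c w, der (rotd b c) f w = 0.
(** What oddness under the reflection of each row becomes on monomials. *)
Definition wodd f := forall t w, ~~ odd (count (fun x => x.1 == t) w) -> f w = 0.
Definition wminor_free f := forall (k : T -> K) w,
  \sum_(r : {perm T}) (-1) ^+ r * f ([seq (r t, k t) | t <- enum T] ++ w) = 0.

Definition wtrace f k k' w := \sum_t f ((t, k) :: (t, k') :: w).

Lemma wsym_trace f k k' : wsym f -> wsym (wtrace f k k').
Proof. by move=> fs w w' ww'; apply: eq_bigr => t _; apply: fs; rewrite !perm_cons. Qed.

Lemma wodd_trace f k k' : wodd f -> wodd (wtrace f k k').
Proof.
move=> fo t w ow; rewrite /wtrace big1 // => t' _; apply: (fo t) => /=.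
by rewrite !oddD addbA addbb.
Qed.

Lemma wminor_free_trace f k k' : wsym f -> wminor_free f -> wminor_free (wtrace f k k').
Proof.
move=> fs fm g w; under eq_bigr do rewrite mulr_sumr.
rewrite exchange_big big1 // => t _ /=.
rewrite -[RHS](fm g ((t, k) :: (t, k') :: w)); apply: eq_bigr => r _; congr (_ * _).
by apply: fs; rewrite perm_sym -[_ :: _ :: w](cat1s) perm_catCA perm_cons -cat1s perm_catCA.
Qed.

(** The contracted pair of letters is itself invariant: the terms where the derivation hits it
    cancel after summation over t. *)
Lemma wrot_trace f k k' : wrot f -> wrot (wtrace f k k').
Proof.
move=> fr b c w.
have := eq_der (rotd b c) w (f := wtrace f k k') (g := fun v => \sum_(t : T) 1 * f ((t, k) :: (t, k') :: v)).
move=> -> ; last by move=> v; apply: eq_bigr => t _; rewrite mul1r.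
rewrite der_lin; under eq_bigr do rewrite mul1r.
have E t : der (rotd b c) (fun v => f ((t, k) :: (t, k') :: v)) w =
   (t == c)%:R * f ((b, k) :: (t, k') :: w) - (t == b)%:R * f ((c, k) :: (t, k') :: w)
   + ((t == c)%:R * f ((t, k) :: (b, k') :: w) - (t == b)%:R * f ((t, k) :: (c, k') :: w)).
  have := fr b c ((t, k) :: (t, k') :: w) => /=.
  rewrite (sum_rotd b c (t, k) (fun y => f (y :: (t, k') :: w))).
  rewrite (sum_rotd b c (t, k') (fun y => f ((t, k) :: y :: w))) /= addrA => /eqP.
  by rewrite addrC addr_eq0 => /eqP ->; ring.
rewrite (eq_bigr _ (fun t _ => E t)) big_split /= !sumrB.
have S1 d (g : T -> F) : \sum_t (t == d)%:R * g t = g d.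
  rewrite (bigD1 d) //= eqxx mul1r big1 ?addr0 // => t /negPf ->.
  by rewrite mul0r.
by rewrite !S1; ring.
Qed.

(** By induction on the length all traces vanish, and the tensor obtained by fixing the columns of
    the letters then satisfies the Casimir relation. Oddness kills the empty word, on which
    invariance says nothing; if there are no rows, the minor relation does it. *)
Lemma words_eq0 f : wsym f -> wrot f -> wodd f -> wminor_free f -> forall w, f w = 0.
Proof.
move=> fs fr fo fm w; have [N] := ubnP (size w).
elim: N f fs fr fo fm w => // N IH f fs fr fo fm w; rewrite ltnS leq_eqVlt.
case/orP => [/eqP sw|]; last exact: IH.
have [w0|w_gt0] := posnP (size w).
  rewrite (size0nil w0); case: (pickP (fun _ : T => true)) => [t _|T0]; first exact: (fo t).
  have k : T -> K by move=> t; have := T0 t.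
  have := fm k [::]; rewrite (bigD1 1%g) //= big1 ?addr0 => [|r /eqP[]]; last first.
    by apply/permP => t; have := T0 t.
  rewrite (_ : enum T = [::]) ?odd_perm1 ?mul1r //.
  by apply/eqP; rewrite -size_eq0 -cardE; apply/eqP/eq_card0.
have tr0 k k' v : (size v).+2 = size w -> wtrace f k k' v = 0.
  move=> sv; apply: IH; [exact: wsym_trace|exact: wrot_trace|exact: wodd_trace| |lia].
  exact: wminor_free_trace.
pose M := size w.
have [x0 _] : {x0 | x0 \in w} by case: (w) w_gt0 => // x v _; exists x; rewrite mem_head.
pose k (i : 'I_M) := (nth x0 w i).2.
pose word (a : {ffun 'I_M -> T}) := [seq (a i, k i) | i <- enum 'I_M].
pose t a := f (word a).
have -> : w = word [ffun i : 'I_M => (nth x0 w i).1].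
  apply: (@eq_from_nth _ x0); first by rewrite size_map size_enum_ord.
  move=> i iw; rewrite (nth_map (Ordinal iw)) ?size_enum_ord // ffunE.
  by rewrite /k nth_enum_ord //; case: nth.
pose upd (a : {ffun 'I_M -> T}) j b := [ffun l => if l == j then b else a l].
have rot_t (a : {ffun 'I_M -> T}) b c :
    \sum_i ((a i == b)%:R * t (upd a i c) - (a i == c)%:R * t (upd a i b)) = 0.
  rewrite -[RHS](fr b c (word a)) der_map ?enum_uniq // big_enum /=.
  apply: eq_bigr => i _.
  rewrite (sum_rotd b c (a i, k i) (fun p => f [seq if j == i then p else (a j, k j) | j <- enum 'I_M])) /=.
  by congr (_ * f _ - _ * f _); apply: eq_map => l; rewrite ffunE; case: eqP => // ->.
have trace_t (a : {ffun 'I_M -> T}) i j : i != j -> \sum_b t (upd (upd a j b) i b) = 0.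
  move=> nij; pose v := [seq (a l, k l) | l <- rem j (rem i (enum 'I_M))].
  have jr : j \in rem i (enum 'I_M) by rewrite mem_rem_uniq ?enum_uniq // !inE eq_sym nij mem_enum.
  rewrite -[RHS](tr0 (k i) (k j) v); last first.
    rewrite size_map size_rem // size_rem ?mem_enum // size_enum_ord.
    have := ltn_ord i; have := ltn_ord j; move: nij; rewrite -val_eqE /= -/M; lia.
  apply: eq_bigr => b _; apply: fs.
  apply: perm_trans (_ : perm_eq _ [seq (upd (upd a j b) i b l, k l) | l <- i :: j :: rem j (rem i (enum 'I_M))]) _.
    apply: perm_map; apply: perm_trans (perm_to_rem (mem_enum 'I_M i)) _.
    by rewrite perm_cons; exact: perm_to_rem.
  rewrite /= !ffunE !eqxx (eq_sym j) (negPf nij) !perm_cons /v.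
  suff -> : [seq (upd (upd a j b) i b l, k l) | l <- rem j (rem i (enum 'I_M))] =
            [seq (a l, k l) | l <- rem j (rem i (enum 'I_M))] by [].
  apply/eq_in_map => l; rewrite mem_rem_uniq ?rem_uniq ?enum_uniq // inE /= => /andP[nlj].
  rewrite mem_rem_uniq ?enum_uniq // inE /= => /andP[nli _].
  by rewrite !ffunE (negPf nli) (negPf nlj).
apply: (@casimir_eq0 F T M t) => //.
- by apply/card_gt0P; exists x0.1.
(* Casimir relation at j: put b at position j, rotate in the plane of b and a j, and sum over b.
   Position j gives (#|T| - 1) t a; any other position gives the transposed term, minus a multiple
   of a trace, which is 0. *)
- move=> j a; have : \sum_b \sum_i ((upd a j b i == b)%:R * t (upd (upd a j b) i (a j)) -
    (upd a j b i == a j)%:R * t (upd (upd a j b) i b)) = 0 by rewrite big1.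
  have updj b : upd (upd a j b) j (a j) = a.
    by apply/ffunP => l; rewrite !ffunE; case: eqP => // ->.
  rewrite exchange_big (bigD1 j) //= => E; rewrite -[RHS]E; congr (_ + _).
    rewrite sumrB mulrDl mulN1r; congr (_ - _).
      rewrite (eq_bigr (fun=> t a)) => [|b _]; first by rewrite sumr_const mulr_natl.
      by rewrite updj ffunE eqxx eqxx mul1r.
    rewrite (bigD1 (a j)) //= big1 => [|b /negPf nb]; last by rewrite ffunE eqxx nb mul0r.
    by rewrite updj ffunE !eqxx mul1r addr0.
  apply: eq_bigr => i nij; rewrite sumrB [X in _ = _ - X](_ : _ = 0) ?subr0; last first.
    rewrite (eq_bigr (fun b => (a i == a j)%:R * t (upd (upd a j b) i b))) => [|b _].
      by rewrite -mulr_sumr trace_t // mulr0.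
    by rewrite ffunE (negPf nij).
  rewrite (bigD1 (a i)) //= big1 => [|b]; last first.
    by rewrite ffunE (negPf nij) eq_sym => /negPf ->; rewrite mul0r.
  rewrite ffunE (negPf nij) eqxx mul1r addr0; congr t; apply/ffunP => l; rewrite !ffunE.
  case: tpermP => [->|->|/eqP nli /eqP nlj]; rewrite ?eqxx //.
    by rewrite eq_sym (negPf nij).
  by rewrite (negPf nli) (negPf nlj).
- move=> s a si; pose v := [seq (a l, k l) | l <- enum 'I_M & l \notin [seq s x | x <- enum T]].
  rewrite -[RHS](fm (k \o s) v); apply: eq_bigr => r _; congr (_ * _); apply: fs.
  set b := substp s r a.
  have -> : [seq (r x, (k \o s) x) | x <- enum T] ++ v =
      [seq (b l, k l) | l <- [seq s x | x <- enum T] ++ [seq l <- enum 'I_M | l \notin [seq s x | x <- enum T]]].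
    rewrite map_cat -[in RHS]map_comp; congr (_ ++ _).
      apply: eq_map => x /=; congr pair; rewrite ffunE.
      by case: pickP => [y /eqP /si -> //|/(_ x)]; rewrite eqxx.
    apply/eq_in_map => l; rewrite mem_filter => /andP[/mapP ls _]; congr pair.
    rewrite ffunE; case: pickP => // x /eqP sx; case: ls; exists x; rewrite ?mem_enum //.
  apply: perm_map; apply: uniq_perm; rewrite ?enum_uniq //.
    rewrite cat_uniq map_inj_uniq ?enum_uniq // filter_uniq ?enum_uniq // andbT /=.
    by apply/hasPn => l; rewrite mem_filter => /andP[].
  by move=> l; rewrite mem_cat [X in _ || X]mem_filter !mem_enum andbT orbN.
Qed.
End Words.
Arguments rotd {F T K} b c x.

Section DerMore.
Variable F : numFieldType.

Lemma eq_der_size (L : Type) (d : L -> seq (F * L)) f g w :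
  (forall v, size v = size w -> f v = g v) -> der d f w = der d g w.
Proof.
elim: w f g => //= x w IH f g fg; congr (_ + _).
  by apply: eq_bigr => p _; rewrite fg.
by apply: IH => v sv; rewrite fg //= sv.
Qed.

Lemma der0 (L : Type) (d : L -> seq (F * L)) w : der d (fun=> 0) w = 0.
Proof.
by elim: w => //= x w ->; rewrite addr0 big1 // => p _; rewrite mulr0.
Qed.

Lemma der_morph (L L' : Type) (d : L -> seq (F * L)) (d' : L' -> seq (F * L')) (g : L -> L') f w :
  (forall x, d' (g x) = [seq (p.1, g p.2) | p <- d x]) ->
  der d' f (map g w) = der d (fun v => f (map g v)) w.
Proof.
move=> dg; elim: w f => //= x w IH f; congr (_ + _); last exact: IH.
by rewrite dg big_map.
Qed.

End DerMore.

Lemma rotd_inj (F : numFieldType) (T T' : finType) (K : eqType) (g : T -> T') b c (x : T * K) :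
  injective g ->
  rotd (g b) (g c) (g x.1, x.2) = [seq (p.1, (g p.2.1, p.2.2)) | p <- rotd b c x] :> seq (F * _).
Proof.
by move=> gi; rewrite /rotd /= !(inj_eq gi); case: (x.1 == b); case: (x.1 == c).
Qed.

Lemma perm_enum2 (D : finType) (L : eqType) (g : D -> L) x y : x != y ->
  perm_eq [seq g t | t <- enum D] (g x :: g y :: [seq g t | t <- rem y (rem x (enum D))]).
Proof.
move=> nxy; rewrite -!map_cons; apply: perm_map.
apply: perm_trans (perm_to_rem (mem_enum D x)) _; rewrite perm_cons.
by apply: perm_to_rem; rewrite mem_rem_uniq ?enum_uniq // !inE eq_sym nxy mem_enum.
Qed.

Lemma mem_rem2 (D : finType) (x y t : D) :
  t \in rem y (rem x (enum D)) -> t != x /\ t != y.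
Proof.
rewrite mem_rem_uniq ?rem_uniq ?enum_uniq // inE => /andP[/= nty].
by rewrite mem_rem_uniq ?enum_uniq // inE => /andP[/= ntx _].
Qed.

Lemma perm_enum_map (I : finType) (s : {perm I}) : perm_eq (enum I) (map s (enum I)).
Proof.
apply: uniq_perm; [exact: enum_uniq|by rewrite map_inj_uniq ?enum_uniq //; exact: perm_inj|].
by move=> t; rewrite mem_enum; apply/esym/mapP; exists (s^-1 t)%g; rewrite ?mem_enum ?permKV.
Qed.

(** * Words with vanishing contractions between types *)

Section ComplexWords.
Variables (F : numFieldType) (T : finType) (n : nat).
Variable f : seq (T * ('I_n * bool)) -> F.
Hypotheses (fs : wsym f) (fr : wrot f) (fo : wodd f).
Hypothesis f_contr : forall a b w, \sum_k (f ((a, (k, false)) :: (b, (k, true)) :: w)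
  - f ((a, (k, true)) :: (b, (k, false)) :: w)) = 0.
Hypothesis ltnT : (n < #|T|)%N.

(** The full minors are what remains to be killed. As a function of the columns, a minor alternates
    among the rows placed in real columns and among those placed in imaginary ones, and its
    contractions between the two kinds vanish. *)
Lemma complex_words_eq0 w : f w = 0.
Proof.
apply: words_eq0 => // {w} k w.
pose e t := (k t).2.
pose g (r : {perm T}) (c : {ffun T -> 'I_n}) t := (r t, (c t, e t)).
pose h c := \sum_(r : {perm T}) (-1) ^+ r * f ([seq g r c t | t <- enum T] ++ w).
have hg r c x y : x != y -> f ([seq g r c t | t <- enum T] ++ w) =
    f (g r c x :: g r c y :: [seq g r c t | t <- rem y (rem x (enum T))] ++ w).
  by move=> nxy; apply: fs; rewrite -!cat_cons perm_cat2r perm_enum2.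
have -> : \sum_(r : {perm T}) (-1) ^+ r * f ([seq (r t, k t) | t <- enum T] ++ w) = h [ffun t => (k t).1].
  apply: eq_bigr => r _; congr (_ * f (_ ++ _)); apply: eq_map => t.
  by rewrite /g ffunE /e; case: (k t).
apply: (contraction_eq0 (e := e)) => // [x y c nxy exy|x y c].
  rewrite /h (reindex_inj (mulgI (tperm x y))) -sumrN /=; apply: eq_bigr => r _.
  rewrite odd_mul_tperm nxy signrN mulNr; congr (- (_ * _)); apply: fs.
  rewrite perm_cat2r (_ : map _ _ = map (g r c) (map (tperm x y) (enum T))).
    by rewrite perm_sym; apply: perm_map; exact: perm_enum_map.
  rewrite -map_comp; apply: eq_map => t; rewrite /g /= permM ffunE.
  by congr (_, (_, _)); case: tpermP => // ->.
wlog ex : x y / e x = false.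
  move=> wl; case ex: (e x); last by rewrite -ex; exact: wl.
  case ey: (e y) => // _; have := wl y x ey; rewrite ex ey => /(_ isT) E.
  by rewrite -[RHS]E; apply: eq_bigr => j _; congr h; apply/ffunP => z; rewrite !ffunE orbC.
rewrite ex; case ey: (e y) => // _.
have nxy : x != y by apply: contraFneq ex => ->; rewrite ey.
have nyx : y != x by rewrite eq_sym.
pose v r := [seq g r c t | t <- rem y (rem x (enum T))] ++ w.
pose s (r : {perm T}) := \sum_j f ((r x, (j, false)) :: (r y, (j, true)) :: v r).
have -> : \sum_j h [ffun z => if (z == x) || (z == y) then j else c z] =
    \sum_(r : {perm T}) (-1) ^+ r * s r.
  under [RHS]eq_bigr do rewrite mulr_sumr.
  rewrite exchange_big; apply: eq_bigr => j _; apply: eq_bigr => r _; congr (_ * _).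
  rewrite (hg _ _ _ _ nxy) {1 2}/g !ffunE !eqxx orbT ex ey; congr (f (_ :: _ :: _ ++ _)).
  apply/eq_in_map => t /mem_rem2[/negPf ntx /negPf nty].
  by rewrite /g ffunE ntx nty.
(* The contraction hypothesis is a difference with the two kinds exchanged, so S is paired with its
   own reindexing by the transposition of x and y. *)
set S := \sum_r _; suff : S + S = 0.
  by move/eqP; rewrite -mulr2n mulrn_eq0 => /eqP.
rewrite {2}/S (reindex_inj (mulgI (tperm x y))) -big_split /= big1 // => r _.
rewrite odd_mul_tperm nxy signrN mulNr -mulrBr; apply/eqP; rewrite mulf_eq0; apply/orP; right.
rewrite -[X in _ == X](f_contr (r x) (r y) (v r)) sumrB; apply/eqP; congr (_ - _); apply: eq_bigr => j _.
rewrite !permM tpermL tpermR; apply: fs.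
rewrite (_ : v _ = v r); first exact/permPl/(perm_catCA [:: _] [:: _] _).
congr (_ ++ _); apply/eq_in_map => t /mem_rem2[ntx nty].
by rewrite /g permM tpermD // eq_sym.
Qed.

End ComplexWords.

Lemma inj_inl (A B : Type) : injective (@inl A B). Proof. by move=> ? ? []. Qed.

Lemma inj_inr (A B : Type) : injective (@inr A B). Proof. by move=> ? ? []. Qed.

Section RealWords.
Variables (F : numFieldType) (T0 T1 : finType) (n : nat).
Local Notation row := (T0 + T1)%type.
Variable f : seq (row * 'I_n) -> F.
Hypotheses (fs : wsym f) (fo : wodd f).
Hypothesis fr0 : forall b c w, der (rotd (inl b) (inl c)) f w = 0.
Hypothesis fr1 : forall b c w, der (rotd (inr b) (inr c)) f w = 0.
Hypothesis f_contr : forall a b w, \sum_k f ((inl a, k) :: (inr b, k) :: w) = 0.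
Hypothesis ltnT : (n < #|T0| + #|T1|)%N.

Let l0 (x : T0 * 'I_n) : row * 'I_n := (inl x.1, x.2).
Let l1 (x : T1 * 'I_n) : row * 'I_n := (inr x.1, x.2).

(** The signed double sum is a minor in the rows of T0 times one in the rows of T1. The
    combinatorial lemma applies to the pair, with the two types as classes, so that only #|T0| +
    #|T1| has to exceed n. *)
Let minors_eq0 (k0 : T0 -> 'I_n) (k1 : T1 -> 'I_n) w :
  \sum_(r : {perm T0}) \sum_(s : {perm T1}) (-1) ^+ r * ((-1) ^+ s *
    f ([seq l0 (r t, k0 t) | t <- enum T0] ++ [seq l1 (s t, k1 t) | t <- enum T1] ++ w)) = 0.
Proof.
pose e (t : row) := if t is inl _ then false else true.
pose h (c : {ffun row -> 'I_n}) := \sum_(r : {perm T0}) \sum_(s : {perm T1}) (-1) ^+ r * ((-1) ^+ s *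
    f ([seq l0 (r t, c (inl t)) | t <- enum T0] ++ [seq l1 (s t, c (inr t)) | t <- enum T1] ++ w)).
have := @contraction_eq0 F row n e h.
move=> /(_ _ _ _ [ffun t => match t with inl t => k0 t | inr t => k1 t end]) H.
rewrite -[RHS]H; last by rewrite card_sum.
- apply: eq_bigr => r _; apply: eq_bigr => s _; congr (_ * (_ * f (_ ++ _ ++ _)));
  by apply: eq_map => t; rewrite ffunE.
- move=> [x|x] [y|y] // c nxy _.
    have {}nxy : x != y by apply: contra_neq nxy => ->.
    rewrite /h (reindex_inj (mulgI (tperm x y))) -sumrN /=; apply: eq_bigr => r _.
    rewrite -sumrN; apply: eq_bigr => s _.
    rewrite odd_mul_tperm nxy signrN mulNr; congr (- (_ * (_ * _))); apply: fs.
    rewrite (_ : [seq l1 _ | t <- _] = [seq l1 (s t, c (inr t)) | t <- enum T1]); last first.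
      by apply: eq_map => t; rewrite ffunE tpermD.
    rewrite perm_cat2r (_ : map _ _ = map (fun t => l0 (r t, c (inl t))) (map (tperm x y) (enum T0))).
      by rewrite perm_sym; apply: perm_map; exact: perm_enum_map.
    rewrite -map_comp; apply: eq_map => t; rewrite /= permM ffunE; congr (l0 (_, c _)).
    by rewrite (inj_tperm _ _ _ (@inj_inl T0 T1)).
  have {}nxy : x != y by apply: contra_neq nxy => ->.
  rewrite /h -sumrN /=; apply: eq_bigr => r _.
  rewrite (reindex_inj (mulgI (tperm x y))) -sumrN; apply: eq_bigr => s _.
  rewrite odd_mul_tperm nxy signrN mulNr mulrN; congr (- (_ * (_ * _))); apply: fs.
  rewrite (_ : [seq l0 _ | t <- _] = [seq l0 (r t, c (inl t)) | t <- enum T0]); last first.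
    by apply: eq_map => t; rewrite ffunE tpermD.
  rewrite perm_cat2l perm_cat2r.
  rewrite (_ : map _ _ = map (fun t => l1 (s t, c (inr t))) (map (tperm x y) (enum T1))).
    by rewrite perm_sym; apply: perm_map; exact: perm_enum_map.
  rewrite -map_comp; apply: eq_map => t; rewrite /= permM ffunE; congr (l1 (_, c _)).
  by rewrite (inj_tperm _ _ _ (@inj_inr T0 T1)).
- have contr x y (c : {ffun row -> 'I_n}) : \sum_j h [ffun z => if (z == inl x) || (z == inr y) then j else c z] = 0.
    rewrite exchange_big big1 // => r _; rewrite exchange_big big1 // => s _.
    rewrite -!mulr_sumr; apply/eqP; rewrite !mulf_eq0; apply/orP; right; apply/orP; right.
    pose w0 := [seq l0 (r t, c (inl t)) | t <- rem x (enum T0)].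
    pose w1 := [seq l1 (s t, c (inr t)) | t <- rem y (enum T1)].
    rewrite -[X in _ == X](f_contr (r x) (s y) (w0 ++ w1 ++ w)); apply/eqP; apply: eq_bigr => j _; apply: fs.
    set c' := finfun _.
    have P0 : perm_eq [seq l0 (r t, c' (inl t)) | t <- enum T0] ((inl (r x), j) :: w0).
      apply: perm_trans (perm_map _ (perm_to_rem (mem_enum T0 x))) _.
      rewrite /= /l0 /= ffunE eqxx perm_cons.
      suff -> : w0 = [seq l0 (r t, c' (inl t)) | t <- rem x (enum T0)] by [].
      apply/eq_in_map => t; rewrite mem_rem_uniq ?enum_uniq // inE => /andP[/= nt _].
      rewrite /c' ffunE orbF; case: eqP => // -[tx]; by rewrite tx eqxx in nt.
    have P1 : perm_eq [seq l1 (s t, c' (inr t)) | t <- enum T1] ((inr (s y), j) :: w1).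
      apply: perm_trans (perm_map _ (perm_to_rem (mem_enum T1 y))) _.
      rewrite /= /l1 /= ffunE eqxx orbT perm_cons.
      suff -> : w1 = [seq l1 (s t, c' (inr t)) | t <- rem y (enum T1)] by [].
      apply/eq_in_map => t; rewrite mem_rem_uniq ?enum_uniq // inE => /andP[/= nt _].
      rewrite /c' ffunE /=; case: eqP => // -[tx]; by rewrite tx eqxx in nt.
    apply: perm_trans (perm_cat P0 (perm_cat P1 (perm_refl w))) _.
    by rewrite /= perm_cons -cat1s perm_catCA.
  move=> [x|x] [y|y] c // _.
  rewrite -[RHS](contr y x c); apply: eq_bigr => j _; congr h; apply/ffunP => z.
  by rewrite !ffunE orbC.
Qed.

(** With a minor of T1 kept as a tail, the rotations of T0 act on the words in T0 alone, and only
    the minors of T0 remain to be treated. *)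
Let tail_eq0 (k1 : T1 -> 'I_n) w0 w1 :
  \sum_(s : {perm T1}) (-1) ^+ s *
    f (map l0 w0 ++ [seq l1 (s t, k1 t) | t <- enum T1] ++ map l1 w1) = 0.
Proof.
pose g w := \sum_(s : {perm T1}) (-1) ^+ s *
    f (map l0 w ++ [seq l1 (s t, k1 t) | t <- enum T1] ++ map l1 w1).
apply: (words_eq0 (f := g)) => {w0} [w w' ww'|b c w|t w ow|k w].
- by apply: eq_bigr => s _; congr (_ * _); apply: fs; rewrite perm_cat2r perm_map.
- rewrite der_lin big1 // => s _; apply/eqP; rewrite mulf_eq0; apply/orP; right; apply/eqP.
  have := fr0 b c (map l0 w ++ [seq l1 (s t, k1 t) | t <- enum T1] ++ map l1 w1).
  rewrite der_cat [X in _ + X]der_nil ?addr0.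
    by rewrite (der_morph (d := rotd b c)) // => x; apply: rotd_inj; exact: inj_inl.
  by rewrite all_cat !all_map; apply/andP; split; apply/allP.
- rewrite /g big1 // => s _; rewrite (fo (t := inl t)) ?mulr0 //.
  rewrite !count_cat !count_map [X in (_ + (X + _))%N](@eq_count _ _ pred0) //.
  rewrite [X in (_ + (_ + X))%N](@eq_count _ _ pred0) // !count_pred0 !addn0.
  by rewrite (@eq_count _ _ (fun x => x.1 == t)).
- rewrite -[RHS](minors_eq0 k k1 (map l0 w ++ map l1 w1)); apply: eq_bigr => r _.
  rewrite /g mulr_sumr; apply: eq_bigr => s _; congr (_ * (_ * _)); apply: fs.
  by rewrite map_cat -map_comp -catA perm_cat2l perm_catCA.
Qed.

(** The same reduction for the rows of T1, whose minors are covered by [tail_eq0]; symmetry sorts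
    any word into its letters from T0 and from T1. *)
Lemma real_words_eq0 w : f w = 0.
Proof.
have E w0 w1 : f (map l0 w0 ++ map l1 w1) = 0.
  pose g v := f (map l0 w0 ++ map l1 v).
  apply: (words_eq0 (f := g)) => {w1} [v v' vv'|b c v|t v ov|k v].
  - by apply: fs; rewrite perm_cat2l perm_map.
  - have := fr1 b c (map l0 w0 ++ map l1 v).
    rewrite der_cat [X in X + _]der_nil ?add0r.
      by rewrite (der_morph (d := rotd b c)) // => x; apply: rotd_inj; exact: inj_inr.
    by rewrite all_map; apply/allP.
  - rewrite /g (fo (t := inr t)) // count_cat !count_map [X in (X + _)%N](@eq_count _ _ pred0) //.
    by rewrite count_pred0 add0n (@eq_count _ _ (fun x => x.1 == t)).
  - rewrite -[RHS](tail_eq0 k w0 v); apply: eq_bigr => s _; congr (_ * f (_ ++ _)).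
    by rewrite map_cat -map_comp.
pose w0 := pmap (fun x : row * 'I_n => if x.1 is inl t then Some (t, x.2) else None) w.
pose w1 := pmap (fun x : row * 'I_n => if x.1 is inr t then Some (t, x.2) else None) w.
rewrite -(E w0 w1); apply: fs; rewrite {}/w0 {}/w1 {E}.
elim: w => //= -[[t|t] k] w IH /=; first by rewrite perm_cons.
rewrite perm_sym; apply: perm_trans (permEl (perm_catCA _ [:: _] _)) _.
by rewrite perm_cons perm_sym.
Qed.

End RealWords.

Section Homogeneous.
Variables (F : numFieldType) (L : eqType) (f : seq L -> F) (N : nat).

(** Derivations preserve the length of words, so the part of degree N inherits the rotation
    relations, while the boost relation mixes degrees. *)
Definition hpart (w : seq L) : F := if size w == N then f w else 0.

Lemma der_hpart (d : L -> seq (F * L)) w : (forall v, der d f v = 0) -> der d hpart w = 0.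
Proof.
move=> fd; rewrite (@eq_der_size _ _ d _ (if size w == N then f else fun=> 0)).
  by case: ifP => _; rewrite ?fd ?der0.
by move=> v sv; rewrite /hpart sv; case: ifP.
Qed.

Lemma der_small (d : L -> seq (F * L)) w : (forall v, (size v < N)%N -> f v = 0) ->
  (size w < N)%N -> der d f w = 0.
Proof. by move=> fN wN; rewrite -(der0 d w); apply: eq_der_size => v sv; rewrite fN // sv. Qed.

End Homogeneous.

Lemma wsym_hpart (F : numFieldType) (T : finType) (K : eqType) (f : seq (T * K) -> F) N :
  wsym f -> wsym (hpart f N).
Proof. by move=> fs w w' ww'; rewrite /hpart (perm_size ww') (fs _ _ ww'). Qed.

Lemma wodd_hpart (F : numFieldType) (T : finType) (K : eqType) (f : seq (T * K) -> F) N :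
  wodd f -> wodd (hpart f N).
Proof. by move=> fo t w ow; rewrite /hpart (fo t w ow) if_same. Qed.

(* The boost in the plane of the rows b and c, of opposite signs. *)
Definition boostd (F : numFieldType) (T K : eqType) (b c : T) (x : T * K) : seq (F * (T * K)) :=
  (if x.1 == b then [:: (1, (c, x.2))] else [::]) ++
  (if x.1 == c then [:: (1, (b, x.2))] else [::]).

(* The rotation in the plane of the complex coordinates b and c, by an imaginary angle;
   (k, false) and (k, true) are the columns of real and imaginary parts. *)
Definition cboostd (F : numFieldType) (T K : eqType) (b c : T) (x : T * (K * bool)) :
    seq (F * (T * (K * bool))) :=
  (if x.1 == b then [:: ((-1) ^+ (~~ x.2.2), (c, (x.2.1, ~~ x.2.2)))] else [::]) ++
  (if x.1 == c then [:: ((-1) ^+ x.2.2, (b, (x.2.1, ~~ x.2.2)))] else [::]).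

Arguments boostd {F T K} b c x.
Arguments cboostd {F T K} b c x.

(** The boost relation links a word to words two letters longer. At a word of length N - 2 its left
    side vanishes by induction, which leaves the vanishing of the contractions in degree N. *)
Lemma real_functional_eq0 (F : numFieldType) (T0 T1 : finType) n
    (f : seq ((T0 + T1) * 'I_n) -> F) :
  wsym f -> wodd f ->
  (forall b c w, der (rotd (inl b) (inl c)) f w = 0) ->
  (forall b c w, der (rotd (inr b) (inr c)) f w = 0) ->
  (forall a b w, der (boostd (inl a) (inr b)) f w =
     2 * \sum_k f ((inl a, k) :: (inr b, k) :: w)) ->
  (n < #|T0| + #|T1|)%N -> forall w, f w = 0.
Proof.
move=> fs fo f0 f1 fb ltn w; have [N] := ubnP (size w); elim: N w => // N IH w wN.
have H : hpart f N w = 0.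
  apply: real_words_eq0; [exact: wsym_hpart|exact: wodd_hpart|..|by []].
  - by move=> b c v; exact: der_hpart.
  - by move=> b c v; exact: der_hpart.
  move=> a b v; rewrite /hpart /=; case: eqP => [sv|_]; last by rewrite big1.
  have := fb a b v; rewrite (@der_small _ _ _ N) //; last by rewrite -sv.
  by move/esym/eqP; rewrite mulf_eq0 pnatr_eq0 /= => /eqP.
move: H wN; rewrite /hpart ltnS leq_eqVlt; case: eqP => //= _ _; exact: IH.
Qed.

Lemma complex_functional_eq0 (F : numFieldType) (T : finType) n
    (f : seq (T * ('I_n * bool)) -> F) :
  wsym f -> wodd f -> wrot f ->
  (forall a b w, a != b -> der (cboostd a b) f w =
     2 * \sum_k (f ((a, (k, true)) :: (b, (k, false)) :: w)
               - f ((a, (k, false)) :: (b, (k, true)) :: w))) ->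
  (n < #|T|)%N -> forall w, f w = 0.
Proof.
move=> fs fo fr fb ltn w; have [N] := ubnP (size w); elim: N w => // N IH w wN.
have H : hpart f N w = 0.
  apply: complex_words_eq0; [exact: wsym_hpart|..|by []].
  - by move=> b c v; exact: der_hpart.
  - exact: wodd_hpart.
  move=> a b v; rewrite /hpart /=; case: eqP => [sv|_]; last by rewrite big1 // => k _; rewrite subr0.
  (* For equal rows the two words are permutations of each other. *)
  have [->|nab] := eqVneq a b.
    rewrite big1 // => k _; apply/eqP; rewrite subr_eq0; apply/eqP/fs.
    exact/permPl/(perm_catCA [:: _] [:: _] _).
  have := fb a b v nab; rewrite (@der_small _ _ _ N) //; last by rewrite -sv.
  move/esym/eqP; rewrite mulf_eq0 pnatr_eq0 /= => /eqP E.
  apply/eqP; rewrite -oppr_eq0 -sumrN -[X in _ == X]E; apply/eqP/eq_bigr => k _.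
  by rewrite opprB.
move: H wN; rewrite /hpart ltnS leq_eqVlt; case: eqP => //= _ _; exact: IH.
Qed.

(** * Schwartz functions and tempered functionals *)

From mathcomp Require Import sesquilinear.
From mathcomp Require Import all_classical all_reals all_analysis.
From mathcomp Require Import complex.

Import Order.TTheory GRing.Theory Num.Theory.
Import numFieldNormedType.Exports.

Local Open Scope classical_set_scope.
Local Open Scope ring_scope.

Section Lines.
Variables (R : realType) (V : normedModType R).
Implicit Types (f : V -> R) (x v : V).

Lemma is_derive_line f x v (t d : R) :
  is_derive (x + t *: v) v f d -> is_derive t 1 (fun s => f (x + s *: v)) d.
Proof.
have E : (fun h : R => h^-1 *: (((fun s : R => f (x + s *: v)) \o shift t) (h *: (1:R)) - f (x + t *: v))) =
    (fun h => h^-1 *: ((f \o shift (x + t *: v)) (h *: v) - f (x + t *: v))).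
  by apply/funext => h /=; rewrite [h *: 1]mulr1 scalerDl addrCA.
by move=> [fd dfd]; split; rewrite /derivable /derive E.
Qed.

Lemma is_derive_line0 f x v (d : R) :
  is_derive (0 : R) 1 (fun s => f (x + s *: v)) d <-> is_derive x v f d.
Proof.
have E : (fun h : R => h^-1 *: (((fun s : R => f (x + s *: v)) \o shift 0) (h *: (1:R)) - f (x + 0 *: v))) =
    (fun h => h^-1 *: ((f \o shift x) (h *: v) - f x)).
  by apply/funext => h /=; rewrite [h *: 1]mulr1 addr0 scale0r addr0 [x + _]addrC.
by split=> -[fd dfd]; split; move: fd dfd; rewrite /derivable /derive E.
Qed.

Lemma is_derive_chain f x v (d : R) (g : R -> R) (dg : R) :
  is_derive x v f d -> is_derive (f x) 1 g dg -> is_derive x v (fun y => g (f y)) (dg * d).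
Proof.
move=> fd gd; apply/is_derive_line0.
apply: (@is_derive1_comp R g (fun s => f (x + s *: v)) 0 dg d).
  by rewrite scale0r addr0.
by apply/is_derive_line0.
Qed.

Lemma is_deriveM_fun f g x v (df dg : R) : is_derive x v f df -> is_derive x v g dg ->
  is_derive x v (fun y => f y * g y) (f x * dg + g x * df).
Proof. by move=> fd gd; exact: is_deriveM. Qed.

Lemma is_derive_cvg f x v (d : R) : is_derive x v f d <->
  h^-1 * (f (x + h *: v) - f x) @[h --> 0^'] --> d.
Proof.
have E : (fun h : R => h^-1 * (f (x + h *: v) - f x)) =
    (fun h => h^-1 *: ((f \o shift x) (h *: v) - f x)).
  by apply/funext => h /=; rewrite [x + _]addrC.
rewrite E; split => [[fd <-]|H]; first exact: fd.
by split; [exact: cvgP H|exact: cvg_lim H].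
Qed.

End Lines.

Section OneVariable.
Variable R : realType.
Implicit Types (f df : R -> R) (a b : R).

Lemma mean_value f df : (forall x : R, is_derive x 1 f (df x)) -> forall a b : R,
  exists2 c, Num.min a b <= c <= Num.max a b & f b - f a = df c * (b - a).
Proof.
move=> fd.
have fc (a b : R) : {within `[a, b], continuous f}.
  apply: continuous_subspaceT => x.
  by apply: differentiable_continuous; apply/derivable1_diffP; have [] := fd x.
have main a b : a <= b -> exists2 c, a <= c <= b & f b - f a = df c * (b - a).
  move=> ab; have [c cab E] := MVT_segment ab (fun x _ => fd x) (fc a b).
  by exists c; [rewrite in_itv /= in cab|].
move=> a b; case: (leP a b) => ab; first exact: main.
have [c cab E] := main _ _ (ltW ab); exists c => //.
by rewrite -(opprB (f a)) E -mulrN opprB.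
Qed.

Lemma mean_value_le f df M : (forall x : R, is_derive x 1 f (df x)) -> forall a b : R,
  (forall c, Num.min a b <= c <= Num.max a b -> `|df c| <= M) ->
  `|f b - f a| <= M * `|b - a|.
Proof.
move=> fd a b fM; have [c cab ->] := mean_value fd a b.
by rewrite normrM ler_wpM2r // fM.
Qed.

Lemma taylor2_le f df ddf M : (forall x : R, is_derive x 1 f (df x)) ->
  (forall x : R, is_derive x 1 df (ddf x)) -> forall a b : R,
  (forall c, Num.min a b <= c <= Num.max a b -> `|ddf c| <= M) ->
  `|f b - f a - df a * (b - a)| <= M * (b - a) ^+ 2.
Proof.
move=> fd dfd a b fM; have [c cab ->] := mean_value fd a b.
rewrite -mulrBl normrM -(real_normK (num_real (b - a))) expr2 mulrA ler_wpM2r //.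
have M0 : 0 <= M by apply: le_trans (fM _ cab).
have sub d : Num.min a c <= d <= Num.max a c -> Num.min a b <= d <= Num.max a b.
  move: cab; rewrite !ge_min !le_max.
  by case/andP => /orP[]h1 /orP[]h2 /andP[/orP[]h3 /orP[]h4]; apply/andP; split; apply/orP; lra.
apply: (le_trans (mean_value_le dfd (fun d dac => fM d (sub d dac)))).
rewrite ler_wpM2l //; move: cab; rewrite ge_min le_max => /andP[/orP h1 /orP h2].
rewrite ler_norml; have := ler_norm (b - a); have := ler_norm (a - b); rewrite -normrN opprB.
by case: h1 => h1; case: h2 => h2 h3 h4; lra.
Qed.

End OneVariable.

Section Continuity.
Variables (R : realType) (T : topologicalType).
Implicit Types f g : T -> R.

Lemma contD f g : continuous f -> continuous g -> continuous (fun x => f x + g x).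
Proof. by move=> fc gc x; exact: (@continuousD _ _ _ f g x (fc x) (gc x)). Qed.

Lemma contM f g : continuous f -> continuous g -> continuous (fun x => f x * g x).
Proof. by move=> fc gc x; exact: (@continuousM _ _ f g x (fc x) (gc x)). Qed.

Lemma cont_cst (a : R) : continuous (fun _ : T => a).
Proof. exact: cst_continuous. Qed.

Lemma cont_comp f (h : R -> R) : continuous f -> continuous h -> continuous (fun x => h (f x)).
Proof. by move=> fc hc x; exact: (continuous_comp (fc x) (hc (f x))). Qed.

End Continuity.

Section RowNorm.
Variables (R : realType) (m : nat).
Implicit Types x y : 'rV[R]_m.

Lemma coord_le_norm x i : `|x 0 i| <= `|x|.
Proof.
rewrite [leRHS]/Num.norm /= mx_normrE; apply/bigmax_geP; right => /=.
by exists (0, i).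
Qed.

Lemma norm_le_coord x M : 0 <= M -> (forall i, `|x 0 i| <= M) -> `|x| <= M.
Proof.
move=> M0 xM; rewrite [leLHS]/Num.norm /= mx_normrE; apply/bigmax_leP; split => //= -[i j] _ /=.
by rewrite ord1.
Qed.

Lemma norm_delta_le (i : 'I_m) : `|delta_mx 0 i : 'rV[R]_m| <= 1.
Proof.
apply: norm_le_coord => // j; rewrite mxE eqxx /=.
by case: (j == i); rewrite ?normr1 ?normr0.
Qed.

Lemma continuous_near (f : 'rV[R]_m -> R) x e : continuous f -> 0 < e ->
  exists2 d, 0 < d & forall y, `|y - x| < d -> `|f y - f x| < e.
Proof.
move=> fc e0; have /(@cvgrPdist_lt _ _ _ _ _) /(_ e e0) := fc x.
move=> /nbhs_normP [d /= d0 H]; exists d => // y yx.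
by rewrite distrC; apply: H; rewrite /= distrC.
Qed.

End RowNorm.

Section RealSchwartz.
Variables (R : realType) (m : nat).
Implicit Types (psi phi : 'rV[R]_m -> R) (s : seq 'I_m).
Local Notation e_ i := (delta_mx 0 i : 'rV[R]_m).

(* [pd], [pds], [sm], [bd], [sz] and [szball] are the real-valued counterparts of [partial],
   [partials], [smooth], [seminorm_le], [rV_schwartz] and [rV_schwartz_ball]. *)
Definition pd (i : 'I_m) psi : 'rV[R]_m -> R := fun x => 'D_(e_ i) psi x.
Definition pds s psi : 'rV[R]_m -> R := foldr pd psi s.

Definition sm psi : Prop := forall s, continuous (pds s psi) /\
  forall i x, derivable (pds s psi) x (e_ i).

Definition bd (k : nat) s psi (M : R) : Prop :=
  forall x, (1 + `|x|) ^+ k * `|pds s psi x| <= M.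

Definition sz psi : Prop := sm psi /\ forall k s, exists M, bd k s psi M.

Definition szball (k : nat) (d : R) psi : Prop :=
  forall s, (size s <= k)%N -> bd k s psi d.

Lemma pds_cat s s' psi : pds (s ++ s') psi = pds s (pds s' psi).
Proof. by rewrite /pds foldr_cat. Qed.

Lemma sm_pds s psi : sm psi -> sm (pds s psi).
Proof. by move=> h s'; rewrite -pds_cat. Qed.

Lemma sm_cont psi : sm psi -> continuous psi.
Proof. by move=> h; have [] := h [::]. Qed.

Lemma sm_is_derive psi i x : sm psi -> is_derive x (e_ i) psi (pd i psi x).
Proof. by move=> h; have [_ d] := h [::]; split; first exact: d. Qed.

Lemma pd_val psi phi i : (forall x, is_derive x (e_ i) psi (phi x)) -> pd i psi = phi.
Proof. by move=> h; apply/funext => x; rewrite /pd; have [_ ->] := h x. Qed.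

(** Gives smoothness without computing iterated derivatives: it is enough to exhibit a class stable
    under differentiation, such as the polynomial multiples of a Gaussian. *)
Lemma sm_class (C : ('rV[R]_m -> R) -> Prop) :
  (forall psi, C psi -> continuous psi /\ forall i, exists2 phi, C phi &
      forall x, is_derive x (e_ i) psi (phi x)) ->
  forall psi, C psi -> sm psi /\ forall s, C (pds s psi).
Proof.
move=> HC psi Cpsi.
have Cs s : C (pds s psi).
  elim: s => //= i s IH; have [_ /(_ i) [phi Cphi hphi]] := HC _ IH.
  by rewrite (pd_val hphi).
split=> // s; split; first by have [] := HC _ (Cs s).
by move=> i x; have [_ /(_ i) [phi _ /(_ x) []]] := HC _ (Cs s).
Qed.

Lemma sz_class (C : ('rV[R]_m -> R) -> Prop) :
  (forall psi, C psi -> continuous psi /\ forall i, exists2 phi, C phi &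
      forall x, is_derive x (e_ i) psi (phi x)) ->
  (forall psi, C psi -> forall k, exists M, forall x, (1 + `|x|) ^+ k * `|psi x| <= M) ->
  forall psi, C psi -> sz psi.
Proof.
move=> HC HM psi Cpsi; have [h Cs] := sm_class HC Cpsi; split=> // k s.
exact: HM (Cs s) k.
Qed.

Lemma pds_lin s (a : R) psi phi : sm psi -> sm phi ->
  pds s (fun x => a * psi x + phi x) = (fun x => a * pds s psi x + pds s phi x).
Proof.
move=> h1 h2; elim: s => //= i s ->; apply: pd_val => x.
apply: is_deriveD; last exact: (sm_is_derive i x (sm_pds s h2)).
exact: (is_deriveZ _ (sm_is_derive i x (sm_pds s h1))).
Qed.

Lemma sm_lin (a : R) psi phi : sm psi -> sm phi -> sm (fun x => a * psi x + phi x).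
Proof.
move=> h1 h2 s; rewrite pds_lin //; split.
  by apply: contD; [apply: contM; [exact: cont_cst|exact: (h1 s).1]|exact: (h2 s).1].
move=> i x; apply: derivableD; last exact: (h2 s).2.
by apply: (@derivableZ _ _ _ (pds s psi) a); exact: (h1 s).2.
Qed.

Lemma sz_lin (a : R) psi phi : sz psi -> sz phi -> sz (fun x => a * psi x + phi x).
Proof.
move=> [h1 H1] [h2 H2]; split; first exact: sm_lin.
move=> k s; have [M1 hM1] := H1 k s; have [M2 hM2] := H2 k s.
exists (`|a| * M1 + M2) => x; rewrite pds_lin //.
apply: le_trans (_ : (1 + `|x|) ^+ k * (`|a| * `|pds s psi x| + `|pds s phi x|) <= _).
  by rewrite ler_wpM2l ?exprn_ge0 // -normrM ler_normD.
by rewrite mulrDr lerD // mulrCA ler_wpM2l.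
Qed.

Lemma sz0 : sz (fun=> 0).
Proof.
apply: (@sz_class (fun psi => psi = fun=> 0)) => // psi ->; last first.
  by move=> k; exists 0 => x; rewrite normr0 mulr0.
split; first exact: cst_continuous.
by move=> i; exists (fun=> 0) => // x; exact: is_derive_cst.
Qed.

Lemma szZ (a : R) psi : sz psi -> sz (fun x => a * psi x).
Proof.
by move=> h; have := sz_lin a h sz0; under eq_fun do rewrite addr0.
Qed.

Lemma szD psi phi : sz psi -> sz phi -> sz (fun x => psi x + phi x).
Proof. by move=> h1 h2; have := sz_lin 1 h1 h2; under eq_fun do rewrite mul1r. Qed.

Lemma szB psi phi : sz psi -> sz phi -> sz (fun x => psi x - phi x).
Proof. by move=> h1 h2; have := sz_lin (-1) h2 h1; under eq_fun do rewrite mulN1r addrC. Qed.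

Lemma sz_sum (I : Type) (r : seq I) (a : I -> R) (psi : I -> 'rV[R]_m -> R) :
  (forall i, sz (psi i)) -> sz (fun x => \sum_(i <- r) a i * psi i x).
Proof.
move=> h; elim: r => [|i r IH]; first by under eq_fun do rewrite big_nil; exact: sz0.
by under eq_fun do rewrite big_cons; exact: sz_lin.
Qed.

Lemma bdW k k' s psi M : (k <= k')%N -> bd k' s psi M -> bd k s psi M.
Proof.
move=> kk' h x; apply: le_trans (h x); rewrite ler_wpM2r // ler_weXn2l //.
by rewrite lerDl.
Qed.

Lemma szball_ge0 k d psi : szball k d psi -> 0 <= d.
Proof.
move=> /(_ [::] isT 0); apply: le_trans; rewrite mulr_ge0 // exprn_ge0 // addr_ge0 //.
Qed.

(** Only finitely many lists have length at most k; they are enumerated as dependent pairs of a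
    length and a tuple, and their bounds are added. *)
Lemma exists_szball k psi : sz psi -> exists d, szball k d psi.
Proof.
move=> [h H].
suff [d hd] : exists d, forall s, (size s <= k)%N -> forall x, (1 + `|x|) ^+ k * `|pds s psi x| <= d.
  by exists d.
pose T := {j : 'I_k.+1 & j.-tuple 'I_m}.
have ch (t : T) : {M | bd k (tagged t) psi M} by apply: cid; exact: H.
exists (\sum_(t : T) `|sval (ch t)|) => s sk x.
pose t : T := @Tagged _ (inord (size s)) (fun j : 'I_k.+1 => j.-tuple 'I_m)
   (tcast (esym (inordK sk)) (in_tuple s)).
have ts : (tagged t : seq 'I_m) = s by rewrite /= val_tcast.
rewrite (bigD1 t) //=; apply: le_trans (_ : sval (ch t) <= _).
  by have := svalP (ch t) x; move: (sval _) => M; rewrite ts.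
by rewrite (le_trans (ler_norm _)) // lerDl sumr_ge0.
Qed.

(* Continuity is stated as an estimate: u is bounded by a multiple of the radius of one
   of the balls [szball k]. *)
Definition tempR (u : ('rV[R]_m -> R) -> R) : Prop :=
  (forall a psi phi, sz psi -> sz phi -> u (fun x => a * psi x + phi x) = a * u psi + u phi) /\
  exists k C, forall psi M, sz psi -> szball k M psi -> `|u psi| <= C * M.

Section Functional.
Variables (u : ('rV[R]_m -> R) -> R).
Hypothesis hu : tempR u.

Lemma tempR0 : u (fun=> 0) = 0.
Proof.
have := hu.1 (-1) _ _ sz0 sz0; under [X in u X]eq_fun do rewrite mulr0 addr0.
by rewrite mulN1r addNr.
Qed.

Lemma tempRZ a psi : sz psi -> u (fun x => a * psi x) = a * u psi.
Proof.
by move=> h; have := hu.1 a _ _ h sz0; under [X in u X]eq_fun do rewrite addr0;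
  rewrite tempR0 addr0.
Qed.

Lemma tempRD psi phi : sz psi -> sz phi -> u (fun x => psi x + phi x) = u psi + u phi.
Proof.
by move=> h1 h2; have := hu.1 1 _ _ h1 h2; under [X in u X]eq_fun do rewrite mul1r;
  rewrite mul1r.
Qed.

Lemma tempRB psi phi : sz psi -> sz phi -> u (fun x => psi x - phi x) = u psi - u phi.
Proof.
by move=> h1 h2; have := hu.1 (-1) _ _ h2 h1; under [X in u X]eq_fun do rewrite mulN1r addrC;
  rewrite mulN1r addrC.
Qed.

Lemma tempR_sum (I : Type) (r : seq I) (a : I -> R) (psi : I -> 'rV[R]_m -> R) :
  (forall i, sz (psi i)) ->
  u (fun x => \sum_(i <- r) a i * psi i x) = \sum_(i <- r) a i * u (psi i).
Proof.
move=> h; elim: r => [|i r IH].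
  by under eq_fun do rewrite big_nil; rewrite tempR0 big_nil.
by under eq_fun do rewrite big_cons; rewrite hu.1 // ?IH ?big_cons //; exact: sz_sum.
Qed.

Lemma tempR_eq0 psi : sz psi ->
  (forall k e, 0 < e -> exists phi, [/\ sz phi, u phi = 0 & szball k e (fun x => psi x - phi x)]) ->
  u psi = 0.
Proof.
move=> h H; have [_ [k [C hC]]] := hu.
apply/eqP; rewrite -normr_le0; apply/ler_addgt0Pl => e e0; rewrite addr0.
have C1 : 0 < `|C| + 1 by rewrite ltr_wpDl.
have [phi [hphi u0 bphi]] := H k (e / (`|C| + 1)) (divr_gt0 e0 C1).
have := hC _ _ (szB h hphi) bphi; rewrite tempRB // u0 subr0 => /le_trans; apply.
apply: le_trans (_ : (`|C| + 1) * (e / (`|C| + 1)) <= _); last by rewrite mulrC divfK ?gt_eqF.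
rewrite ler_wpM2r ?divr_ge0 ?(ltW e0) ?(ltW C1) // (le_trans (ler_norm _)) // lerDl //.
Qed.

End Functional.

End RealSchwartz.

(** * Directional derivatives and linear substitutions *)

Section Directional.
Variables (R : realType) (m : nat).
Implicit Types (psi phi : 'rV[R]_m -> R) (x u : 'rV[R]_m).
Local Notation e_ i := (delta_mx 0 i : 'rV[R]_m).

(** The increment along the added direction is, by the mean value theorem, a partial derivative at a
    nearby point, and continuity brings it back to x. *)
Lemma is_derive_add psi phi i (c : R) x u d : continuous phi ->
  (forall y, is_derive y (e_ i) psi (phi y)) ->
  is_derive x u psi d -> is_derive x (u + c *: e_ i) psi (d + c * phi x).
Proof.
move=> phic hd /is_derive_cvg hu; apply/is_derive_cvg.
rewrite (_ : (fun h => _) = (fun h : R => h^-1 * (psi (x + h *: u) - psi x)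
    + h^-1 * (psi (x + h *: u + (h * c) *: e_ i) - psi (x + h *: u)))); last first.
  apply/funext => h; rewrite -mulrDr; congr (_ * _).
  by rewrite scalerDr scalerA addrA [RHS]addrC addrA subrK.
apply: (@cvgD _ _ _ _ _ _ _ _ _ hu).
apply/cvgrPdist_le => e e0.
have c0 : 0 < `|c| + 1 by rewrite ltr_wpDl.
have [r r0 hr] := continuous_near x phic (divr_gt0 e0 c0).
have k0 : 0 < `|u| + `|c| + 1 by rewrite ltr_wpDl // addr_ge0.
near=> h.
have h0 : h != 0 by near: h; exact: nbhs_dnbhs_neq.
have hh : `|h| * (`|u| + `|c| + 1) < r.
  rewrite -ltr_pdivlMr //; near: h.
  by apply: dnbhs0_lt; exact: divr_gt0.
have [t tb] := mean_value (fun t => is_derive_line (hd (x + h *: u + t *: e_ i))) 0 (h * c).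
rewrite scale0r addr0 subr0 => ->.
have {tb} tb : `|t| <= `|h * c|.
  move: tb; rewrite ge_min le_max ler_norml => /andP[/orP h1 /orP h2].
  have := ler_norm (h * c); have := ler_norm (- (h * c)); rewrite normrN.
  by case: h1 => h1; case: h2 => h2 h3 h4; lra.
set p := x + h *: u + t *: e_ i.
rewrite (_ : _ - _ = - (c * (phi p - phi x))); last by field.
have px : `|p - x| < r.
  apply: le_lt_trans hh; rewrite /p -(addrA x) (addrC x) addrK (le_trans (ler_normD _ _)) //.
  rewrite !normrZ mulrDr mulrDr; apply: le_trans (_ : `|h| * `|u| + `|h| * `|c| <= _).
    rewrite lerD // -normrM (le_trans _ tb) // ler_piMr //; exact: norm_delta_le.
  by rewrite lerDl mulr1.
rewrite normrN normrM; apply: le_trans (_ : (`|c| + 1) * (e / (`|c| + 1)) <= _).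
  by apply: ler_pM => //; [rewrite lerDl|exact: ltW (hr _ px)].
by rewrite mulrC divfK // gt_eqF.
Unshelve. all: by end_near.
Qed.

Lemma is_derive_dir psi u x : sm psi ->
  is_derive x u psi (\sum_i u 0 i * pd i psi x).
Proof.
move=> h.
suff H s : is_derive x (\sum_(i <- s) u 0 i *: e_ i) psi (\sum_(i <- s) u 0 i * pd i psi x).
  by rewrite [X in is_derive x X](row_sum_delta u); exact: H.
elim: s => [|i s IH]; first by rewrite !big_nil; exact: is_derive0.
rewrite !big_cons addrC [X in is_derive _ _ _ X]addrC.
apply: is_derive_add IH; first exact: (sm_cont (sm_pds [:: i] h)).
by move=> y; exact: sm_is_derive.
Qed.

(** Schwarz's theorem: the second difference over the parallelogram with sides h e_i and h e_j is
    h^2 times either mixed derivative at a point close to x. *)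
Lemma pdC psi i j : sm psi -> pd i (pd j psi) = pd j (pd i psi).
Proof.
move=> hpsi; apply/funext => x.
pose D (h : R) := psi (x + h *: e_ i + h *: e_ j) - psi (x + h *: e_ i) - (psi (x + h *: e_ j) - psi x).
have key a b (h : R) : exists2 y, `|y - x| <= `|h| *+ 2 &
    psi (x + h *: e_ a + h *: e_ b) - psi (x + h *: e_ a) - (psi (x + h *: e_ b) - psi x)
    = pd b (pd a psi) y * h ^+ 2.
  have hg (t : R) : is_derive t 1 (fun t => psi (x + h *: e_ b + t *: e_ a) - psi (x + t *: e_ a))
      (pd a psi (x + h *: e_ b + t *: e_ a) - pd a psi (x + t *: e_ a)).
    by apply: is_deriveB; apply: is_derive_line; exact: sm_is_derive.
  have [t tb] := mean_value hg 0 h.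
  rewrite scale0r !addr0 subr0 => E1.
  have hg2 (r : R) : is_derive r 1 (fun r => pd a psi (x + t *: e_ a + r *: e_ b))
      (pd b (pd a psi) (x + t *: e_ a + r *: e_ b)).
    by apply: is_derive_line; apply: sm_is_derive; exact: (sm_pds [:: a] hpsi).
  have [r rb] := mean_value hg2 0 h; rewrite scale0r addr0 subr0 => E2.
  exists (x + t *: e_ a + r *: e_ b).
    rewrite -(addrA x) (addrC x) addrK (le_trans (ler_normD _ _)) // !normrZ mulr2n.
    have bnd (z : R) k : Num.min 0 h <= z <= Num.max 0 h -> `|z| * `|e_ k| <= `|h|.
      move=> zb; apply: le_trans (_ : `|z| <= _); first by rewrite ler_piMr // norm_delta_le.
      move: zb; rewrite ge_min le_max ler_norml => /andP[/orP h1 /orP h2].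
      have := ler_norm h; have := ler_norm (- h); rewrite normrN.
      by case: h1 => h1; case: h2 => h2 h3 h4; lra.
    by rewrite lerD // bnd.
  rewrite (addrAC x (h *: e_ a)) -[X in _ - X]addrC.
  rewrite expr2 mulrA -E2 (addrAC x (t *: e_ a)) -E1; ring.
have keyE (h : R) : h != 0 -> exists y z, [/\ `|y - x| <= `|h| *+ 2, `|z - x| <= `|h| *+ 2 &
    pd j (pd i psi) y = pd i (pd j psi) z].
  move=> h0; have [y yx Ey] := key i j h; have [z zx Ez] := key j i h.
  exists y, z; split; [exact: yx|exact: zx|apply: (mulIf (expf_neq0 2 h0))]; rewrite -Ey -Ez.
  by rewrite (addrAC x (h *: e_ j)); ring.
apply/eqP; rewrite -subr_eq0 -normr_le0; apply/ler_addgt0Pl => e e0; rewrite addr0.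
have e20 : 0 < e / 2 by rewrite divr_gt0.
have [r1 r10 h1] := continuous_near x (sm_cont (sm_pds [:: i; j] hpsi)) e20.
have [r2 r20 h2] := continuous_near x (sm_cont (sm_pds [:: j; i] hpsi)) e20.
pose h := Num.min r1 r2 / 4.
have m0 : 0 < Num.min r1 r2 by rewrite lt_min r10.
have h0 : 0 < h by rewrite divr_gt0.
have hr : `|h| *+ 2 < Num.min r1 r2.
  by rewrite gtr0_norm // mulr2n /h; lra.
have [y [z [yx zx E]]] := keyE h (lt0r_neq0 h0).
have minl : Num.min r1 r2 <= r1 by rewrite ge_min lexx.
have minr : Num.min r1 r2 <= r2 by rewrite ge_min lexx orbT.
have := h1 z (lt_le_trans (le_lt_trans zx hr) minl).
have := h2 y (lt_le_trans (le_lt_trans yx hr) minr).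
rewrite -[pd j (pd i psi)]/(pds [:: j; i] psi) -[pd i (pd j psi)]/(pds [:: i; j] psi) in E *.
rewrite E; move: (pds [:: i; j] psi z) (pds [:: i; j] psi x) (pds [:: j; i] psi x).
move=> a b c /ltW Hc /ltW Hb.
rewrite (_ : b - c = (a - c) - (a - b)); last by ring.
by apply: (le_trans (ler_normB _ _)); lra.
Qed.

Lemma pds_sum (I : Type) (r : seq I) (a : I -> R) (psi : I -> 'rV[R]_m -> R) s :
  (forall i, sm (psi i)) -> sm (fun x => \sum_(i <- r) a i * psi i x) /\
  pds s (fun x => \sum_(i <- r) a i * psi i x) = fun x => \sum_(i <- r) a i * pds s (psi i) x.
Proof.
move=> h.
have hs : sm (fun x => \sum_(i <- r) a i * psi i x).
  elim: r => [|i r IH]; first by under eq_fun do rewrite big_nil; exact: (sz0 _ _).1.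
  by under eq_fun do rewrite big_cons; exact: sm_lin.
split=> //; elim: s {hs} => //= i s ->.
apply: pd_val => x; elim: r => [|j r IH].
  by rewrite big_nil; under eq_fun do rewrite big_nil; exact: is_derive_cst.
rewrite big_cons; under eq_fun do rewrite big_cons.
apply: is_deriveD => //; apply: (is_deriveZ _ (sm_is_derive i x (sm_pds s (h j)))).
Qed.

Lemma pds_perm s s' psi : sm psi -> perm_eq s s' -> pds s psi = pds s' psi.
Proof.
move=> h; elim: s s' => [|i s IH] s'; first by rewrite perm_sym => /perm_nilP ->.
move=> ps; have is' : i \in s' by rewrite -(perm_mem ps) mem_head.
have [s1 [s2 Es]] : exists s1 s2, s' = s1 ++ i :: s2.
  by case/splitPr: is' => s1 s2; exists s1, s2.
rewrite {s' is'}Es in ps *; have ps' : perm_eq s (s1 ++ s2).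
  by rewrite -(perm_cons i); apply: (perm_trans ps); exact: (permEl (perm_catCA s1 [:: i] s2)).
rewrite /= (IH _ ps') {IH ps ps'}; elim: s1 => //= j s1 <-.
by rewrite pdC // pds_cat; do 2!apply: sm_pds.
Qed.

End Directional.

Section Substitution.
Variables (R : realType) (m m' : nat) (A : 'M[R]_(m', m)).
Local Notation e_ i := (delta_mx 0 i : 'rV[R]__).

Lemma sub_is_derive psi i (x : 'rV[R]_m') : sm psi ->
  is_derive x (delta_mx 0 i) (fun x => psi (x *m A)) (\sum_j A i j * pd j psi (x *m A)).
Proof.
move=> h; apply/is_derive_line0.
rewrite (_ : (fun s => _) = (fun s : R => psi (x *m A + s *: row i A))); last first.
  by apply/funext => s; rewrite mulmxDl -scalemxAl -rowE.
apply/is_derive_line0; rewrite (_ : \sum_j _ = \sum_j row i A 0 j * pd j psi (x *m A)).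
  exact: is_derive_dir.
by apply: eq_bigr => j _; rewrite mxE.
Qed.

Let N := \sum_i \sum_j `|A i j|.

Let N_ge0 : 0 <= N.
Proof. by apply: sumr_ge0 => *; apply: sumr_ge0. Qed.

Lemma norm_mulmx_le (x : 'rV[R]_m') : `|x *m A| <= N * `|x|.
Proof.
apply: norm_le_coord => [|j]; first by rewrite mulr_ge0.
rewrite mxE mulr_suml (le_trans (ler_norm_sum _ _ _)) // ler_sum // => i _.
rewrite normrM mulrC ler_pM // ?coord_le_norm //.
by rewrite (bigD1 j) //= lerDl sumr_ge0.
Qed.

Lemma continuous_sub (psi : 'rV[R]_m -> R) : continuous psi -> continuous (fun x : 'rV[R]_m' => psi (x *m A)).
Proof.
move=> pc x; apply/(@cvgrPdist_lt _ _ _ (nbhs x) _) => e e0; rewrite near_simpl.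
have [d d0 hd] := continuous_near (x *m A) pc e0; apply/nbhs_normP.
have N1 : 0 < N + 1 by rewrite ltr_wpDl.
exists (d / (N + 1)) => [|y /= xy]; first by rewrite /= divr_gt0.
rewrite distrC; apply: hd; rewrite -mulmxBl (le_lt_trans (norm_mulmx_le _)) //.
apply: le_lt_trans (_ : (N + 1) * `|x - y| < _); first by rewrite distrC ler_wpM2r // lerDl.
by rewrite mulrC -ltr_pdivlMr.
Qed.

Lemma sm_sub psi : sm psi -> sm (fun x => psi (x *m A)).
Proof.
move=> h.
pose C (f : 'rV[R]_m' -> R) := exists l : seq (R * seq 'I_m),
  f = fun x => \sum_(p <- l) p.1 * pds p.2 psi (x *m A).
apply: (@sm_class _ _ C _ _ _).1; last first.
  by exists [:: (1, [::])]; apply/funext => x; rewrite big_seq1 mul1r.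
move=> f [l ->]; split.
  elim: l => [|p l IH]; first by under eq_fun do rewrite big_nil; exact: cont_cst.
  under eq_fun do rewrite big_cons; apply: contD => //; apply: contM; first exact: cont_cst.
  exact: continuous_sub (h p.2).1.
move=> i; exists (fun x => \sum_(p <- flatten [seq [seq (p.1 * A i j, j :: p.2) | j <- enum 'I_m] | p <- l])
    p.1 * pds p.2 psi (x *m A)); first by eexists.
move=> x; elim: l => [|p l IH].
  by rewrite big_nil; under eq_fun do rewrite big_nil; exact: is_derive_cst.
rewrite /= big_cat; under eq_fun do rewrite big_cons; apply: is_deriveD => //.
rewrite big_map big_enum /=; under eq_bigr do rewrite -mulrA; rewrite -mulr_sumr.
exact: (is_deriveZ _ (sub_is_derive i x (sm_pds p.2 h))).
Qed.

Lemma pd_sub psi i : sm psi ->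
  pd i (fun x => psi (x *m A)) = fun x => \sum_j A i j * pd j psi (x *m A).
Proof. by move=> h; apply: pd_val => x; exact: sub_is_derive. Qed.

(** The induction peels off the innermost derivative: the chain rule turns it into a combination of
    first derivatives of psi, to which the statement applies again, at the cost of a factor N. *)
Lemma sub_bound k M s psi : 0 <= M -> sm psi ->
  (forall t, size t = size s -> bd k t psi M) ->
  forall x, (1 + `|x *m A|) ^+ k * `|pds s (fun x => psi (x *m A)) x| <= N ^+ size s * M.
Proof.
move=> M0; elim/last_ind: s psi => [|s i IH] psi h H x; first by rewrite mul1r; exact: (H [::]).
rewrite -cats1 pds_cat /= pd_sub //.
have hj j : sm (fun x => pd j psi (x *m A)) by apply: sm_sub; exact: (sm_pds [:: j] h).
have [_ ->] := pds_sum (index_enum 'I_m) (fun j => A i j) s hj.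
have N0 := N_ge0.
apply: le_trans (_ : \sum_j `|A i j| * (N ^+ size s * M) <= _).
  apply: le_trans (ler_wpM2l (exprn_ge0 _ _) (ler_norm_sum _ _ _)) _; first by rewrite addr_ge0.
  rewrite mulr_sumr ler_sum // => j _; rewrite normrM mulrCA ler_wpM2l //.
  apply: IH; first exact: (sm_pds [:: j] h).
  move=> t ts y; have := H (rcons t j); rewrite !size_rcons ts => /(_ erefl y).
  by rewrite -cats1 pds_cat.
rewrite -mulr_suml size_cat addn1 exprS -!mulrA ler_wpM2r ?mulr_ge0 ?exprn_ge0 //.
by rewrite /N (bigD1 i) //= lerDl; apply: sumr_ge0 => *; apply: sumr_ge0.
Qed.

Variable K : R.
(** Quantitative injectivity of A: decay in x *m A has to control decay in x. *)
Hypothesis AK : forall x : 'rV[R]_m', `|x| <= K * `|x *m A|.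

Lemma sub_weight k (x : 'rV[R]_m') : (1 + `|x|) ^+ k <= (1 + `|K|) ^+ k * (1 + `|x *m A|) ^+ k.
Proof.
rewrite -exprMn; apply: lerXn2r; rewrite ?nnegrE ?mulr_ge0 ?addr_ge0 //.
have := AK x; have := ler_norm K; have := normr_ge0 (x *m A); have := normr_ge0 K.
set a := `|x *m A| => h1 h2 h3 h4.
have : K * a <= `|K| * a by rewrite ler_wpM2r.
by rewrite mulrDl mul1r mulrDr mulr1 => ?; lra.
Qed.

Lemma szball_sub k : exists C, forall psi M, sm psi -> szball k M psi ->
  szball k (C * M) (fun x => psi (x *m A)).
Proof.
have N0 := N_ge0.
exists ((1 + `|K|) ^+ k * (1 + N) ^+ k) => psi M h H s sk x.
have M0 := szball_ge0 H.
apply: le_trans (ler_wpM2r (normr_ge0 _) (sub_weight k x)) _.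
rewrite -!mulrA ler_wpM2l ?exprn_ge0 ?addr_ge0 //.
apply: le_trans (sub_bound M0 h _ x) _; first by move=> t ts; apply: H; rewrite ts.
rewrite ler_wpM2r //; apply: le_trans (_ : (1 + N) ^+ size s <= _).
  by apply: lerXn2r; rewrite ?nnegrE ?addr_ge0 // lerDr.
by apply: ler_weXn2l => //; rewrite lerDl.
Qed.

Lemma sz_sub psi : sz psi -> sz (fun x => psi (x *m A)).
Proof.
move=> h; split; first exact: sm_sub h.1.
move=> k s; have [C HC] := szball_sub (maxn k (size s)).
have [d hd] := exists_szball (maxn k (size s)) h.
exists (C * d); apply: bdW (leq_maxl k (size s)) _; apply: (HC _ _ h.1 hd).
exact: leq_maxr.
Qed.

End Substitution.

(** * Gaussians with polynomial coefficients *)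

(** Polynomials as syntax, compared only through their values: derivations and substitutions are
    then structural recursions. *)
Inductive pexp (R I : Type) : Type :=
| PC of R | PX of I | PA of pexp R I & pexp R I | PM of pexp R I & pexp R I.
Arguments PC {R I} c : rename.
Arguments PX {R I} i : rename.

Section Polynomials.
Variables (R : realType) (I : Type).
Implicit Types (p q : pexp R I) (r : I -> R) (d : I -> pexp R I).

Fixpoint ev r p : R :=
  match p with
  | PC c => c | PX i => r i | PA p q => ev r p + ev r q | PM p q => ev r p * ev r q
  end.

Fixpoint pder d p : pexp R I :=
  match p with
  | PC _ => PC 0 | PX i => d i
  | PA p q => PA (pder d p) (pder d q)
  | PM p q => PA (PM p (pder d q)) (PM q (pder d p))
  end.

Lemma ev_is_derive (V : normedModType R) (r : V -> I -> R) (x v : V) d p :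
  (forall i, is_derive x v (fun y => r y i) (ev (r x) (d i))) ->
  is_derive x v (fun y => ev (r y) p) (ev (r x) (pder d p)).
Proof.
move=> h; elim: p => /= [c|i|p IHp q IHq|p IHp q IHq]; first exact: is_derive_cst.
- exact: h.
- exact: is_deriveD.
- exact: is_deriveM_fun.
Qed.

(** [pder d p] evaluates at r to the derivative of the values of p along the line through r with
    direction d, so it depends on these values only. *)
Lemma pder_ext d p q : (forall r, ev r p = ev r q) ->
  forall r, ev r (pder d p) = ev r (pder d q).
Proof.
move=> pq r.
pose g (t : R) i := r i + t * ev r (d i).
have gd i : is_derive (0 : R) 1 (fun t => g t i) (ev (g 0) (d i)).
  rewrite (_ : g 0 = r); last by apply/funext => j; rewrite /g mul0r addr0.
  rewrite [X in is_derive _ _ _ X](_ : _ = 0 + (0 * 0 + ev r (d i) * 1)); last by ring.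
  apply: is_deriveD; apply: is_deriveM_fun; exact: is_derive_cst.
have [_ Hp] := ev_is_derive p gd; have [_ Hq] := ev_is_derive q gd.
have g0 : g 0 = r by apply/funext => j; rewrite /g mul0r addr0.
rewrite g0 in Hp Hq; rewrite -Hp -Hq.
suff -> : (fun y : R => ev (g y) p) = (fun y : R => ev (g y) q) by [].
by apply/funext => t; exact: pq.
Qed.

Lemma pderC d d' p : (forall i r, ev r (pder d (d' i)) = ev r (pder d' (d i))) ->
  forall r, ev r (pder d (pder d' p)) = ev r (pder d' (pder d p)).
Proof.
move=> h r; elim: p => //= [p -> q ->//|p IHp q IHq].
by rewrite IHp IHq; ring.
Qed.

(* [pop d q p] is the polynomial factor of the derivative of p * exp (- q). *)
Definition pop d q p : pexp R I := PA (pder d p) (PM (PC (-1)) (PM p (pder d q))).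

Lemma pop_ext d q p p' : (forall r, ev r p = ev r p') ->
  forall r, ev r (pop d q p) = ev r (pop d q p').
Proof. by move=> h r /=; rewrite (pder_ext d h) h. Qed.

Lemma popC d d' q p : (forall i r, ev r (pder d (d' i)) = ev r (pder d' (d i))) ->
  forall r, ev r (pop d q (pop d' q p)) = ev r (pop d' q (pop d q p)).
Proof.
move=> h r /=; rewrite (pderC p h) (pderC q h).
by ring.
Qed.

End Polynomials.

Lemma seq_bound (R : realType) (m : nat) k (P : seq 'I_m -> R -> Prop) :
  (forall s M M', M <= M' -> P s M -> P s M') -> (forall s, exists M, P s M) ->
  exists2 M, 0 <= M & forall s, (size s <= k)%N -> P s M.
Proof.
move=> Pm; elim: k P Pm => [|k IH] P Pm HP; have [M0 hM0] := HP [::].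
  exists `|M0| => // s; rewrite leqn0 size_eq0 => /eqP ->; exact: Pm (ler_norm _) hM0.
have ch i : {M | 0 <= M /\ forall s, (size s <= k)%N -> P (i :: s) M}.
  apply: cid; have [||M M1 hM] := IH (fun s => P (i :: s)); last by exists M.
    by move=> s; exact: Pm.
  by move=> s; exact: HP.
exists (`|M0| + \sum_i sval (ch i)).
  by rewrite addr_ge0 // sumr_ge0 // => i _; have [] := svalP (ch i).
case=> [|i s] /= sk.
  apply: Pm hM0; rewrite (le_trans (ler_norm _)) // lerDl sumr_ge0 // => i _.
  by have [] := svalP (ch i).
have [h0 /(_ s sk)] := svalP (ch i); apply: Pm.
rewrite (bigD1 i) //= addrCA lerDl addr_ge0 // sumr_ge0 // => j _.
by have [] := svalP (ch j).
Qed.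

Lemma gauss_decay (R : realType) (n : nat) (c : R) : 0 < c ->
  exists2 M, 0 <= M & forall y : R, 0 <= y -> (1 + y) ^+ n * expR (- (c * y ^+ 2)) <= M.
Proof.
(* Since (1 + y)^n <= exp (n y), the bound is the exponential of the maximum of n y - c y^2, namely
   n^2 / (4 c). *)
move=> c0; exists (expR (n%:R ^+ 2 / (4 * c))) => [|y y0]; first exact: expR_ge0.
apply: le_trans (_ : expR y ^+ n * expR (- (c * y ^+ 2)) <= _).
  rewrite ler_wpM2r ?expR_ge0 //; apply: lerXn2r; rewrite ?nnegrE ?expR_ge0 ?addr_ge0 //.
  exact: expR_ge1Dx.
rewrite -expRM_natl -expRD ler_expR -subr_ge0.
rewrite (_ : _ - _ = c * (y - n%:R / (2 * c)) ^+ 2).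
  by rewrite mulr_ge0 ?sqr_ge0 // ltW.
by field; apply: lt0r_neq0.
Qed.

Lemma poly_growthP (R : realType) (y : R) : 0 <= y -> forall d d', (d <= d')%N ->
  (1 + y) ^+ d <= (1 + y) ^+ d'.
Proof. by move=> y0 d d' dd'; rewrite ler_weXn2l // lerDl. Qed.

Section GaussClass.
Variables (R : realType) (m : nat).
(* The variables [inr b] stand for two functions [par b] of a real parameter. *)
Local Notation var := ('I_m + bool)%type.
Local Notation poly := (pexp R var).
Local Notation e_ i := (delta_mx 0 i : 'rV[R]_m).
Variables (par : bool -> R -> R) (dpar : bool -> poly).
Hypothesis par_derive : forall b (s : R) r, (forall b', r (inr b') = par b' s) ->
  is_derive s 1 (par b) (ev r (dpar b)).
Variable Kpar : R.
Hypothesis par_bound : forall b s, `|s| <= 1 -> `|par b s| <= Kpar.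

Definition env (s : R) (x : 'rV[R]_m) (v : var) : R :=
  match v with inl i => x 0 i | inr b => par b s end.

Definition dx (i : 'I_m) (v : var) : poly :=
  match v with inl j => PC (i == j)%:R | inr _ => PC 0 end.
Definition ds (v : var) : poly :=
  match v with inl _ => PC 0 | inr b => dpar b end.

Hypothesis dpar_x : forall i b r, ev r (pder (dx i) (dpar b)) = 0.

Definition gauss (P Q : poly) (s : R) (x : 'rV[R]_m) : R :=
  ev (env s x) P * expR (- ev (env s x) Q).

Lemma env_dx s i x P : is_derive x (e_ i) (fun x => ev (env s x) P) (ev (env s x) (pder (dx i) P)).
Proof.
apply: ev_is_derive => -[j|b] /=; last exact: is_derive_cst.
apply/is_derive_line0.
rewrite (_ : (fun t => _) = fun t : R => x 0 j + t * (i == j)%:R).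
  rewrite [X in is_derive _ _ _ X](_ : _ = 0 + (0 * 0 + (i == j)%:R * 1)); last by ring.
  by apply: is_deriveD; apply: is_deriveM_fun; exact: is_derive_cst.
by apply/funext => t; rewrite !mxE eqxx /= eq_sym.
Qed.

Lemma env_ds (s : R) x P : is_derive s 1 (fun s => ev (env s x) P) (ev (env s x) (pder ds P)).
Proof.
by apply: ev_is_derive => -[j|b] /=; [exact: is_derive_cst|exact: par_derive].
Qed.

Lemma exp_is_derive (V : normedModType R) (x v : V) (f : V -> R) d :
  is_derive x v f d -> is_derive x v (fun y => expR (- f y)) (- (d * expR (- f x))).
Proof.
move=> fd; rewrite [X in is_derive _ _ _ X](_ : _ = expR (- f x) * (- d)); last by ring.
apply: (@is_derive_chain R V (fun y => - f y) x v (- d) expR (expR (- f x))).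
Qed.

Lemma gauss_dx P Q s i x : is_derive x (e_ i) (gauss P Q s) (gauss (pop (dx i) Q P) Q s x).
Proof.
rewrite /gauss [X in is_derive _ _ _ X](_ : _ = ev (env s x) P * - (ev (env s x) (pder (dx i) Q) *
   expR (- ev (env s x) Q)) + expR (- ev (env s x) Q) * ev (env s x) (pder (dx i) P)).
  by apply: is_deriveM_fun; [exact: env_dx|apply: exp_is_derive; exact: env_dx].
by rewrite /=; ring.
Qed.

Lemma gauss_ds P Q (s : R) x : is_derive s 1 (fun s => gauss P Q s x) (gauss (pop ds Q P) Q s x).
Proof.
rewrite /gauss [X in is_derive _ _ _ X](_ : _ = ev (env s x) P * - (ev (env s x) (pder ds Q) *
   expR (- ev (env s x) Q)) + expR (- ev (env s x) Q) * ev (env s x) (pder ds P)).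
  by apply: is_deriveM_fun; [exact: env_ds|apply: exp_is_derive; exact: env_ds].
by rewrite /=; ring.
Qed.

Lemma env_cont s P : continuous (fun x => ev (env s x) P).
Proof.
elim: P => /= [c|[j|b]|p IHp q IHq|p IHp q IHq]; try exact: cont_cst.
- exact: coord_continuous.
- exact: contD.
- exact: contM.
Qed.

Lemma gauss_cont P Q s : continuous (gauss P Q s).
Proof.
apply: contM; first exact: env_cont.
apply: (@cont_comp _ _ (fun x => - ev (env s x) Q) expR); last exact: continuous_expR.
rewrite (_ : (fun x => _) = fun x => ev (env s x) (PM (PC (-1)) Q)); first exact: env_cont.
by apply/funext => x /=; rewrite mulN1r.
Qed.

Lemma env_growth P : exists d C, 0 <= C /\ forall s x, `|s| <= 1 ->
  `|ev (env s x) P| <= C * (1 + `|x|) ^+ d.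
Proof.
have K0 : 0 <= Kpar by apply: le_trans (par_bound true (s := 0) _); rewrite ?normr0.
elim: P => [c|[j|b]|p [dp [Cp [Cp0 Hp]]] q [dq [Cq [Cq0 Hq]]]|p [dp [Cp [Cp0 Hp]]] q [dq [Cq [Cq0 Hq]]]].
- by exists 0%N, `|c|; split => // s x _; rewrite expr0 mulr1.
- exists 1%N, 1; split => // s x _; rewrite expr1 mul1r /=.
  by rewrite (le_trans (coord_le_norm _ _)) // lerDr.
- by exists 0%N, Kpar; split => // s x hs; rewrite expr0 mulr1 /= par_bound.
- exists (maxn dp dq), (Cp + Cq); split=> [|s x hs /=]; first exact: addr_ge0.
  rewrite (le_trans (ler_normD _ _)) // mulrDl lerD //.
    by rewrite (le_trans (Hp s x hs)) // ler_wpM2l // poly_growthP // leq_maxl.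
  by rewrite (le_trans (Hq s x hs)) // ler_wpM2l // poly_growthP // leq_maxr.
- exists (dp + dq)%N, (Cp * Cq); split=> [|s x hs /=]; first exact: mulr_ge0.
  by rewrite normrM exprD mulrACA ler_pM ?Hp ?Hq.
Qed.

(** Uniform in the parameter, so that one bound serves the whole family over |s| <= 1. *)
Definition coercive (Q : poly) : Prop :=
  exists c C, 0 < c /\ forall s x, `|s| <= 1 -> c * `|x| ^+ 2 - C <= ev (env s x) Q.

Lemma coercive_bound P Q k : coercive Q -> exists2 M, 0 <= M & forall s x, `|s| <= 1 ->
  (1 + `|x|) ^+ k * (`|ev (env s x) P| * expR (- ev (env s x) Q)) <= M.
Proof.
move=> [c [C [c0 HQ]]]; have [d [K [K0 HP]]] := env_growth P.
have [M M0 HM] := gauss_decay (k + d) c0.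
exists (K * expR C * M) => [|s x hs]; first by rewrite !mulr_ge0 ?expR_ge0.
apply: le_trans (_ : (1 + `|x|) ^+ k * (K * (1 + `|x|) ^+ d * (expR C * expR (- (c * `|x| ^+ 2)))) <= _).
  rewrite ler_wpM2l ?exprn_ge0 ?addr_ge0 // ler_pM ?expR_ge0 ?HP //.
  by rewrite -expRD ler_expR; have := HQ s x hs; lra.
apply: le_trans (_ : K * expR C * ((1 + `|x|) ^+ (k + d) * expR (- (c * `|x| ^+ 2))) <= _).
  by rewrite exprD le_eqVlt; apply/orP; left; apply/eqP; ring.
by rewrite ler_wpM2l ?mulr_ge0 ?expR_ge0 // HM.
Qed.

Lemma gauss_bound P Q k : coercive Q -> exists2 M, 0 <= M & forall s x, `|s| <= 1 ->
  (1 + `|x|) ^+ k * `|gauss P Q s x| <= M.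
Proof.
move=> cQ; have [M M0 HM] := coercive_bound P k cQ; exists M => // s x hs.
by rewrite normrM (ger0_norm (expR_ge0 _)) HM.
Qed.

Lemma pds_gauss w P Q s : pds w (gauss P Q s) = gauss (foldr (fun i => pop (dx i) Q) P w) Q s.
Proof. by elim: w => //= i w ->; apply: pd_val => x; exact: gauss_dx. Qed.

Lemma sz_gauss P Q s : coercive Q -> `|s| <= 1 -> sz (gauss P Q s).
Proof.
move=> cQ hs; apply: (@sz_class _ _ (fun psi => exists P, psi = gauss P Q s)); last by exists P.
- move=> _ [P' ->]; split; first exact: gauss_cont.
  by move=> i; exists (gauss (pop (dx i) Q P') Q s) => [|x]; [eexists|exact: gauss_dx].
- move=> _ [P' ->] k; have [M _ HM] := gauss_bound P' k cQ; exists M => x; exact: HM.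
Qed.

(** The derivative in s commutes with those in x because, by [dpar_x], the derivatives of the
    parameters do not involve x. *)
Lemma pop_foldC w Q P r :
  ev r (foldr (fun i => pop (dx i) Q) (pop ds Q P) w) =
  ev r (pop ds Q (foldr (fun i => pop (dx i) Q) P w)).
Proof.
elim: w r => [//|i w IH r]; apply: (etrans (pop_ext (dx i) Q IH r)).
by apply: popC => -[j|b] r' //; rewrite dpar_x.
Qed.

(* Differentiation under u: the second order Taylor remainder of s |-> gauss P Q s is
   O(s ^ 2) for every seminorm. *)
Lemma gauss_lie u P Q : tempR u -> coercive Q ->
  (forall s, `|s| <= 1 -> u (gauss P Q s) = u (gauss P Q 0)) -> u (gauss (pop ds Q P) Q 0) = 0.
Proof.
move=> hu cQ uc; have [_ [k [C hC]]] := hu.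
have n0 : `|0 : R| <= 1 by rewrite normr0.
pose rem s x := gauss P Q s x - gauss P Q 0 x - s * gauss (pop ds Q P) Q 0 x.
have szG s : `|s| <= 1 -> sz (gauss P Q s) by move=> hs; exact: sz_gauss.
have szG' : sz (gauss (pop ds Q P) Q 0) by exact: sz_gauss.
have [M M0 HM] : exists2 M, 0 <= M & forall w, (size w <= k)%N ->
    forall s, `|s| <= 1 -> bd k w (rem s) (M * s ^+ 2).
  apply: (@seq_bound R m k (fun w M => forall s, `|s| <= 1 -> bd k w (rem s) (M * s ^+ 2))).
    by move=> w M M' MM' H s hs x; rewrite (le_trans (H s hs x)) // ler_wpM2r // sqr_ge0.
  move=> w; set Pw := foldr (fun i => pop (dx i) Q) P w.
  have [M M0 HM] := gauss_bound (pop ds Q (pop ds Q Pw)) k cQ; exists M => s hs x.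
  have -> : pds w (rem s) x = gauss Pw Q s x - gauss Pw Q 0 x - gauss (pop ds Q Pw) Q 0 x * (s - 0).
    have -> : rem s = (fun x => (- s) * gauss (pop ds Q P) Q 0 x + (-1 * gauss P Q 0 x + gauss P Q s x)).
      by apply/funext => y; rewrite /rem; ring.
    rewrite pds_lin //; [|exact: szG'.1|exact: (sz_lin _ (szG 0 n0) (szG s hs)).1].
    rewrite pds_lin //; [|exact: (szG 0 n0).1|exact: (szG s hs).1].
    rewrite !pds_gauss -/Pw /gauss pop_foldC -/Pw subr0; ring.
  have w0 : 0 < (1 + `|x|) ^+ k by rewrite exprn_gt0 // ltr_pwDl.
  have H := @taylor2_le R (fun s => gauss Pw Q s x) _ _ (M / (1 + `|x|) ^+ k)
     (fun s => gauss_ds Pw Q s x) (fun s => gauss_ds (pop ds Q Pw) Q s x) 0 s.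
  have {H} := H _; rewrite subr0 => H.
  apply: le_trans (ler_wpM2l (ltW w0) (H _)) _; last first.
    by rewrite mulrA [_ * (M / _)]mulrC divfK ?gt_eqF.
  move=> c cs; rewrite ler_pdivlMr // mulrC HM //; apply: le_trans hs.
  move: cs; rewrite ge_min le_max ler_norml => /andP[/orP h1 /orP h2].
  have := ler_norm s; have := ler_norm (- s); rewrite normrN.
  by case: h1 => h1; case: h2 => h2 h3 h4; lra.
set v := u _.
have key s : 0 < s -> s <= 1 -> `|v| <= `|C| * M * s.
  move=> s0 s1; have hs : `|s| <= 1 by rewrite gtr0_norm.
  have sr : sz (rem s) by apply: szB; [apply: szB; exact: szG|exact: szZ].
  have b : szball k (M * s ^+ 2) (rem s) by move=> w wk; exact: HM.
  have := hC _ _ sr b; rewrite tempRB //; [|apply: szB; exact: szG|exact: szZ].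
  rewrite tempRB ?tempRZ ?uc ?subrr ?sub0r ?normrN ?normrM // -/v; try exact: szG.
  rewrite (gtr0_norm s0) => H; rewrite -(ler_pM2l s0) (le_trans H) //.
  apply: le_trans (_ : `|C| * (M * s ^+ 2) <= _).
    by apply: ler_wpM2r; [rewrite mulr_ge0 // sqr_ge0|exact: ler_norm].
  by rewrite le_eqVlt; apply/orP; left; apply/eqP; ring.
apply/eqP; rewrite -normr_le0; apply/ler_addgt0Pl => e e0; rewrite addr0.
have CM0 : 0 < `|C| * M + 1 by rewrite ltr_wpDl // mulr_ge0.
pose s := Num.min 1 (e / (`|C| * M + 1)).
have s0 : 0 < s by rewrite lt_min ltr01 divr_gt0.
apply: le_trans (key s s0 _) _; first by rewrite ge_min lexx.
apply: le_trans (_ : (`|C| * M + 1) * (e / (`|C| * M + 1)) <= _).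
  by rewrite ler_pM ?mulr_ge0 ?(ltW s0) ?lerDl // ge_min lexx orbT.
by rewrite mulrC divfK // gt_eqF.
Qed.

End GaussClass.
Arguments dx {R m} i v.

Lemma is_deriveZ_fun (R : realType) (V : normedModType R) (c : R) (f : V -> R) x v (d : R) :
  is_derive x v f d -> is_derive x v (fun y => c * f y) (c * d).
Proof. by move=> fd; exact: is_deriveZ. Qed.

(** * Taylor tails of the exponential *)

Section ExpTail.
Variable R : realType.
Implicit Types r t : R.

Definition tail (N : nat) r : R := expR r - \sum_(j < N) r ^+ j / (j`!)%:R.

Lemma tailS N r : tail N.+1 r = tail N r - r ^+ N / (N`!)%:R.
Proof. by rewrite /tail big_ord_recr /= opprD addrA. Qed.

Lemma tail_derive N r : is_derive r 1 (tail N) (tail N.-1 r).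
Proof.
elim: N => [|N IH].
  rewrite (_ : tail 0 = expR); first exact: is_derive_expR.
  by apply/funext => t; rewrite /tail big_ord0 subr0.
rewrite (_ : tail N.+1 = fun t => tail N t - (N`!)%:R^-1 * t ^+ N); last first.
  by apply/funext => t; rewrite tailS [_ / _]mulrC.
have H : is_derive r 1 (fun t : R => (N`!)%:R^-1 * t ^+ N) ((N`!)%:R^-1 * (N%:R * r ^+ N.-1)).
  apply: is_deriveZ_fun; split; first exact: exprn_derivable.
  by rewrite exp_derive -[_ *: 1]/(_ * 1) mulr1.
have E : tail N.-1 r - ((N`!)%:R^-1 * (N%:R * r ^+ N.-1)) = tail N r.
  case: N {IH H} => [|N] /=; first by rewrite mul0r !mulr0 subr0.
  rewrite tailS; congr (_ - _); rewrite factS natrM invfM.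
  have N0 : N.+1%:R != 0 :> R by rewrite pnatr_eq0.
  by rewrite mulrACA mulVf // mul1r mulrC.
by rewrite /= -E; exact: is_deriveB.
Qed.

(** Comparison of derivatives: exp (2 t) / 2^(N+1) has derivative exp (2 t) / 2^N, which by
    induction dominates that of the tail with either sign, and it is positive at 0, where the tail
    vanishes. Doubling the exponent is the price of the geometric factor. *)
Lemma tail_bound N r : `|tail N r| <= expR (2 * `|r|) / 2 ^+ N.
Proof.
elim: N r => [|N IH] r.
  rewrite /tail big_ord0 subr0 expr0 divr1 ger0_norm ?expR_ge0 // ler_expR.
  by have := ler_norm r; have := normr_ge0 r; lra.
pose sg : R := if 0 <= r then 1 else -1.
have sgE : sg = 1 \/ sg = -1 by rewrite /sg; case: ifP; [left|right].
have rE : r = sg * `|r|.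
  by rewrite /sg; case: ifP => [/ger0_norm ->|]; [ring|rewrite leNgt => /negbFE/ltr0_norm ->; ring].
have tail0 : tail N.+1 0 = 0.
  rewrite /tail expR0 big_ord_recl /= expr0 fact0 divr1 big1 ?addr0 ?subrr // => j _.
  by rewrite expr0n /= mul0r.
have main (e : R) : e = 1 \/ e = -1 -> 0 <= expR (2 * `|r|) / 2 ^+ N.+1 - e * tail N.+1 r.
  move=> eE.
  pose b t := expR (2 * t) / 2 ^+ N.+1 - e * tail N.+1 (sg * t).
  have db t : is_derive t 1 b (expR (2 * t) / 2 ^+ N - e * (sg * tail N (sg * t))).
    have hl (c : R) : is_derive t 1 (fun t => c * t) c.
      by have := is_deriveZ_fun c (is_derive_id t 1); rewrite mulr1.
    rewrite [X in is_derive _ _ _ X](_ : _ = (2 ^+ N.+1)^-1 * (expR (2 * t) * 2) - e * (tail N (sg * t) * sg)).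
      rewrite (_ : b = fun t => (2 ^+ N.+1)^-1 * expR (2 * t) - e * tail N.+1 (sg * t)).
        apply: is_deriveB; apply: is_deriveZ_fun; apply: is_derive_chain (hl _) _.
        exact: (tail_derive N.+1).
      by apply/funext => y; rewrite /b mulrC.
    rewrite exprS invfM; congr (_ - _); last by ring.
    by field; rewrite expf_neq0 // pnatr_eq0.
  have [c /andP[]] := mean_value db 0 `|r|.
  rewrite min_l // max_r // => c0 _; rewrite subr0 /b !mulr0 tail0 mulr0 subr0 expR0 -rE.
  move=> /(canRL (subrK _)) ->; rewrite addr_ge0 ?div1r ?invr_ge0 ?exprn_ge0 //.
  rewrite mulr_ge0 // subr_ge0.
  have := IH (sg * c); rewrite ler_norml.
  have -> : `|sg * c| = c.
    by rewrite normrM (ger0_norm c0); case: sgE => ->; rewrite ?normrN normr1 mul1r.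
  move=> /andP[h1 h2]; case: eE => ->; case: sgE h1 h2 => ->; lra.
have h1 := main 1 (or_introl erefl); have h2 := main (-1) (or_intror erefl).
by rewrite ler_norml; apply/andP; split; lra.
Qed.
End ExpTail.

Section GaussTail.
Variables (R : realType) (m : nat).
Local Notation poly := (pexp R ('I_m + bool)).
Local Notation e_ i := (delta_mx 0 i : 'rV[R]_m).
Implicit Types P Q S : poly.

Definition par0 (b : bool) (s : R) : R := 0.
Local Notation env0 := (env par0 0).
Local Notation gauss0 P Q := (gauss par0 P Q 0).

Fact par0_bound b (s : R) : `|s| <= 1 -> `|par0 b s| <= 0.
Proof. by rewrite normr0. Qed.

Definition coercive0 Q : Prop :=
  exists c C, 0 < c /\ forall x, c * `|x| ^+ 2 - C <= ev (env0 x) Q.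

Lemma coercive0P Q : coercive0 Q -> coercive par0 Q.
Proof. by move=> [c [C [c0 H]]]; exists c, C. Qed.

Lemma sz_gauss0 P Q : coercive0 Q -> sz (gauss0 P Q).
Proof. by move=> cQ; apply: (sz_gauss par0_bound) (coercive0P cQ) _; rewrite normr0. Qed.

Definition psub P Q : poly := PA P (PM (PC (-1)) Q).
Definition ppow P (j : nat) : poly := iter j (PM P) (PC 1).

Lemma ev_ppow r P j : ev r (ppow P j) = ev r P ^+ j.
Proof. by elim: j => //= j ->; rewrite exprS. Qed.

(** The error made when exp S is replaced by its Taylor polynomial in P exp (- (Q - S)), written as
    a product that is easy to differentiate. *)
Definition gtail (N : nat) P Q S (x : 'rV[R]_m) : R := gauss0 P Q x * tail N (ev (env0 x) S).

Lemma gtailE N P Q S : gtail N P Q S =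
  fun x => gauss0 P (psub Q S) x + \sum_(j < N) (- (j`!)%:R^-1) * gauss0 (PM P (ppow S j)) Q x.
Proof.
apply/funext => x; rewrite /gtail /tail mulrBr; congr (_ + _).
  by rewrite /gauss /= mulN1r opprB expRD mulrA mulrAC.
rewrite mulr_sumr -sumrN; apply: eq_bigr => j _.
by rewrite /gauss /= ev_ppow; ring.
Qed.

Lemma gtail_dx N P Q S i x : is_derive x (e_ i) (gtail N P Q S)
  (gtail N (pop (dx i) Q P) Q S x + gtail N.-1 (PM P (pder (dx i) S)) Q S x).
Proof.
rewrite [X in is_derive _ _ _ X](_ : _ = gauss0 P Q x * (tail N.-1 (ev (env0 x) S) * ev (env0 x) (pder (dx i) S))
   + tail N (ev (env0 x) S) * gauss0 (pop (dx i) Q P) Q x); last by rewrite /gtail /gauss /=; ring.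
apply: (@is_deriveM_fun _ _ (gauss0 P Q) (fun x => tail N (ev (env0 x) S))); first exact: gauss_dx.
apply: (@is_derive_chain _ _ (fun x => ev (env0 x) S) _ _ _ (tail N)); [exact: env_dx|exact: tail_derive].
Qed.

Lemma sz_gtail N P Q S : coercive0 Q -> coercive0 (psub Q S) -> sz (gtail N P Q S).
Proof.
move=> cQ cQS; rewrite gtailE; apply: szD; first exact: sz_gauss0.
by apply: sz_sum => j; exact: sz_gauss0.
Qed.

Section Bound.
Variables (Q S : poly).
(** The factor 2 is that of exp (2 |r|) in [tail_bound]. *)
Hypothesis QS : exists c C, 0 < c /\ forall x, c * `|x| ^+ 2 - C <= ev (env0 x) Q - 2 * `|ev (env0 x) S|.

Lemma QS_coercive : coercive0 Q.
Proof.
have [c [C [c0 H]]] := QS; exists c, C; split=> // x; have := H x.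
by have := normr_ge0 (ev (env0 x) S); lra.
Qed.

Lemma QS_coercive_sub : coercive0 (psub Q S).
Proof.
have [c [C [c0 H]]] := QS; exists c, C; split=> // x; have := H x => /=.
by have := normr_ge0 (ev (env0 x) S); have := ler_norm (ev (env0 x) S); lra.
Qed.

Lemma gtail_bound w P k : exists2 M, 0 <= M & forall N x,
  (1 + `|x|) ^+ k * `|pds w (gtail N P Q S) x| <= M / 2 ^+ N.
Proof.
elim/last_ind: w P => [|w i IH] P.
  have [c [C [c0 HQ]]] := QS; have [d [K [K0 HP]]] := env_growth par0_bound P.
  have [M M0 HM] := gauss_decay (k + d) c0.
  exists (K * expR C * M) => [|N x]; first by rewrite !mulr_ge0 ?expR_ge0.
  have -> : `|pds [::] (gtail N P Q S) x| =
      `|ev (env0 x) P| * expR (- ev (env0 x) Q) * `|tail N (ev (env0 x) S)|.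
    by rewrite /gtail /gauss !normrM (ger0_norm (expR_ge0 _)).
  apply: le_trans (_ : (1 + `|x|) ^+ k * (K * (1 + `|x|) ^+ d * (expR C * expR (- (c * `|x| ^+ 2)) / 2 ^+ N)) <= _).
    rewrite ler_wpM2l ?exprn_ge0 ?addr_ge0 // -mulrA.
    apply: ler_pM; rewrite ?mulr_ge0 ?expR_ge0 ?HP ?normr0 //.
    apply: le_trans (ler_wpM2l (expR_ge0 _) (tail_bound N _)) _.
    rewrite mulrA ler_wpM2r ?invr_ge0 ?exprn_ge0 // -!expRD ler_expR.
    by have := HQ x; lra.
  rewrite [leLHS](_ : _ = K * expR C * ((1 + `|x|) ^+ (k + d) * expR (- (c * `|x| ^+ 2))) / 2 ^+ N).
    rewrite ler_wpM2r ?invr_ge0 ?exprn_ge0 //.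
    by rewrite ler_wpM2l ?mulr_ge0 ?expR_ge0 // HM.
  by rewrite exprD; ring.
have [M1 M10 H1] := IH (pop (dx i) Q P); have [M2 M20 H2] := IH (PM P (pder (dx i) S)).
exists (M1 + 2 * M2) => [|N x]; first by rewrite addr_ge0 // mulr_ge0.
rewrite -cats1 pds_cat.
have -> : pds [:: i] (gtail N P Q S) =
    (fun x => 1 * gtail N (pop (dx i) Q P) Q S x + gtail N.-1 (PM P (pder (dx i) S)) Q S x).
  by apply: pd_val => y; rewrite mul1r; exact: gtail_dx.
have sg N' P' : sz (gtail N' P' Q S) by apply: sz_gtail; [exact: QS_coercive|exact: QS_coercive_sub].
rewrite pds_lin ?mul1r; [|exact: (sg _ _).1|exact: (sg _ _).1].
apply: le_trans (_ : M1 / 2 ^+ N + M2 / 2 ^+ N.-1 <= _).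
  apply: le_trans (ler_wpM2l (exprn_ge0 _ (addr_ge0 ler01 (normr_ge0 _))) (ler_normD _ _)) _.
  by rewrite mulrDr lerD.
(* Passing from N - 1 to N costs the factor 2 in M1 + 2 M2. At N = 0 the predecessor is 0 again,
   rightly so: [tail 0] is exp, its own derivative. *)
rewrite mulrDl lerD // mulrAC; case: N => [|N] /=.
  by rewrite expr0 !invr1 !mulr1 ler_peMl // ler1n.
by rewrite exprS invfM mulrA mulfV ?pnatr_eq0 // mul1r mulrC.
Qed.

(* Multiplying exp (- Q) by the Taylor polynomials of exp S stays in the kernel of u, so only
   the Taylor tails matter, and these tend to 0. *)
Lemma tail_kill u : tempR u -> (forall P, u (gauss0 P Q) = 0) -> forall P, u (gauss0 P (psub Q S)) = 0.
Proof.
move=> hu u0 P; have [_ [k [C hC]]] := hu.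
have cQ := QS_coercive; have cQS := QS_coercive_sub.
have [M M0 HM] : exists2 M, 0 <= M & forall w, (size w <= k)%N ->
    forall N, bd k w (gtail N P Q S) (M / 2 ^+ N).
  apply: (@seq_bound R m k (fun w M => forall N, bd k w (gtail N P Q S) (M / 2 ^+ N))).
    move=> w M M' MM' H N x; rewrite (le_trans (H N x)) // ler_wpM2r // invr_ge0 exprn_ge0.
  by move=> w; have [M _ H] := gtail_bound w P k; exists M.
have uT N : u (gtail N P Q S) = u (gauss0 P (psub Q S)).
  rewrite gtailE tempRD //; [|exact: sz_gauss0|by apply: sz_sum => j; exact: sz_gauss0].
  by rewrite tempR_sum // ?big1 ?addr0 // => j; [rewrite u0 mulr0|exact: sz_gauss0].
set v := u _.
have key N : `|v| <= `|C| * M / 2 ^+ N.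
  rewrite /v -(uT N) -mulrA; apply: le_trans (hC _ (M / 2 ^+ N) (sz_gtail _ _ cQ cQS) _) _.
    by move=> w wk; exact: HM.
  by apply: ler_wpM2r; [rewrite divr_ge0 ?exprn_ge0|exact: ler_norm].
apply/eqP; rewrite -normr_le0; apply/ler_addgt0Pl => e e0; rewrite addr0.
have := upper_nthrootP (leqnn (Num.bound (`|C| * M / e))); set N := Num.bound _ => hN.
apply: le_trans (key N) _; rewrite ler_pdivrMr ?exprn_gt0 // [e * _]mulrC -ler_pdivrMr //.
exact: ltW.
Qed.

End Bound.

Lemma gauss0_ext P P' Q Q' : (forall x, ev (env0 x) P = ev (env0 x) P') ->
  (forall x, ev (env0 x) Q = ev (env0 x) Q') -> gauss0 P Q = gauss0 P' Q'.
Proof. by move=> hP hQ; apply/funext => x; rewrite /gauss hP hQ. Qed.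

(* Q is moved to Q' by steps small enough for [tail_kill]. *)
Lemma path_kill u Q Q' c C B : tempR u -> 0 < c ->
  (forall x, c * `|x| ^+ 2 - C <= ev (env0 x) Q) ->
  (forall x, c * `|x| ^+ 2 - C <= ev (env0 x) Q') ->
  (forall x, `|ev (env0 x) Q - ev (env0 x) Q'| <= B * (1 + `|x| ^+ 2)) ->
  (forall P, u (gauss0 P Q) = 0) -> forall P, u (gauss0 P Q') = 0.
Proof.
move=> hu c0 hQ hQ' hB u0.
have B0 : 0 <= B by have := hB 0; rewrite normr0 expr0n addr0 mulr1; exact: le_trans.
(* Each of the n steps changes Q by at most B (1 + |x|^2) / n, and twice the quadratic part of this
   must be absorbed by half of the coercivity c |x|^2. *)
pose n := (Num.bound (2 * B / (c / 2))).+1.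
have n0 : 0 < n%:R :> R by rewrite ltr0n.
have hn : 2 * B / n%:R <= c / 2.
  rewrite ler_pdivrMr // [_ * n%:R]mulrC -ler_pdivrMr ?divr_gt0 //.
  have h0 : 0 <= 2 * B / (c / 2) by rewrite !mulr_ge0 // invr_ge0 divr_ge0 // ltW.
  by apply: ltW; apply: (lt_trans (archi_boundP h0)); rewrite ltr_nat.
pose Qt (t : R) : poly := PA (PM (PC (1 - t)) Q) (PM (PC t) Q').
have hQt t x : 0 <= t <= 1 -> c * `|x| ^+ 2 - C <= ev (env0 x) (Qt t).
  move=> /andP[t0 t1] /=; have := hQ x; have := hQ' x.
  move: (ev _ Q) (ev _ Q') (_ - C) => q q' z h' h.
  rewrite (_ : z = (1 - t) * z + t * z); last by ring.
  by apply: lerD; apply: ler_wpM2l; lra.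
have step j : (j < n)%N -> (forall P, u (gauss0 P (Qt (j%:R / n%:R))) = 0) ->
    forall P, u (gauss0 P (Qt (j.+1%:R / n%:R))) = 0.
  move=> jn h P; pose S : poly := PM (PC (n%:R^-1)) (psub Q Q').
  rewrite (@gauss0_ext P P _ (psub (Qt (j%:R / n%:R)) S)) //; last first.
    by move=> x /=; rewrite -natr1; field; rewrite pnatr_eq0.
  apply: tail_kill => //; exists (c / 2), (C + 2 * B / n%:R); split; first by rewrite divr_gt0.
  move=> x; have jt : 0 <= (j%:R / n%:R : R) <= 1.
    by rewrite divr_ge0 //= ler_pdivrMr // mul1r ler_nat ltnW.
  have h1 := hQt _ x jt; move: (ev _ (Qt _)) h1 => q h1.
  have h2 : 2 * `|ev (env0 x) S| <= 2 * B / n%:R * (1 + `|x| ^+ 2).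
    rewrite /= normrM mulN1r gtr0_norm ?invr_gt0 // mulrCA mulrAC -[leRHS]mulrA.
    rewrite [leRHS](_ : _ = n%:R^-1 * (2 * (B * (1 + `|x| ^+ 2)))); last by ring.
    by rewrite ler_wpM2l ?invr_ge0 // ler_wpM2l.
  have h3 : 2 * B / n%:R * `|x| ^+ 2 <= c / 2 * `|x| ^+ 2 by rewrite ler_wpM2r ?sqr_ge0.
  by move: h2; rewrite mulrDr mulr1 => h2; lra.
have all_j j : (j <= n)%N -> forall P, u (gauss0 P (Qt (j%:R / n%:R))) = 0.
  elim: j => [_ P|j IH jn]; last by apply: step => //; apply: IH; exact: ltnW.
  by rewrite (@gauss0_ext P P _ Q) // => x /=; ring.
move=> P; rewrite -(all_j n (leqnn n) P); congr u; apply: gauss0_ext => // x /=.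
by rewrite divff ?gt_eqF //; ring.
Qed.

Definition psum (I : Type) (r : seq I) (p : I -> poly) : poly :=
  foldr (fun i q => PA (p i) q) (PC 0) r.

Lemma ev_psum (I : Type) (s : seq I) (p : I -> poly) r :
  ev r (psum s p) = \sum_(i <- s) ev r (p i).
Proof. by elim: s => [|i s IH] /=; rewrite ?big_nil ?big_cons ?IH. Qed.

End GaussTail.

(** * Density of Gaussians *)

Section RiemannSums.
Variable R : realType.
Implicit Types (x y s h b : R).

(** A left Riemann sum of dp, compared with the increment of p cell by cell through the Taylor
    bound. *)
Lemma telescope_le (p dp ddp : R -> R) B h b n :
  (forall s : R, is_derive s 1 p (dp s)) -> (forall s : R, is_derive s 1 dp (ddp s)) ->
  (forall s, `|ddp s| <= B) ->
  `|\sum_(j < n) h * dp (b + j%:R * h) - (p (b + n%:R * h) - p b)| <= n%:R * (B * h ^+ 2).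
Proof.
move=> hp hdp hB; elim: n => [|n IH].
  by rewrite big_ord0 !mul0r addr0 !subrr normr0.
rewrite big_ord_recr /= -natr1 mulrDl mul1r addrA.
have H := taylor2_le hp hdp (a := b + n%:R * h) (b := b + n%:R * h + h) (fun c _ => hB c).
rewrite (_ : b + n%:R * h + h - (b + n%:R * h) = h) in H; last by ring.
set P0 := p b in IH *; set P1 := p (b + n%:R * h) in IH H *; set P2 := p _ in H *.
rewrite (_ : _ - _ = (\sum_(i < n) h * dp (b + i%:R * h) - (P1 - P0)) - (P2 - P1 - dp (b + n%:R * h) * h)).
  apply: (le_trans (ler_normB _ _)); rewrite [leRHS]mulrDl mul1r; exact: lerD.
by ring.
Qed.

(** Up to scaling, the arctangent is a primitive of the summand. As h q <= 1, the value of 1 / (1 +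
    z^2) at a node is at most 3 times its value anywhere in the cell, and the arctangents telescope
    to at most pi. *)
Lemma sum_atan_le (q : R) h b x n : 0 < q -> 0 < h -> h * q <= 1 ->
  \sum_(j < n) h / (1 + (q * (x - (b + j%:R * h))) ^+ 2) <= 3 * pi / q.
Proof.
move=> q0 h0 hq.
pose z (j : nat) : R := q * (b + j%:R * h - x).
have step j : h / (1 + (q * (x - (b + j%:R * h))) ^+ 2) <= 3 / q * (atan (z j.+1) - atan (z j)).
  have [c] := mean_value (fun s => is_derive1_atan s) (z j) (z j.+1).
  have zS : z j.+1 - z j = h * q by rewrite /z -natr1; ring.
  have hq0 : 0 < h * q by rewrite mulr_gt0.
  rewrite min_l ?max_r; try by rewrite -subr_ge0 zS ltW.
  move=> /andP[c1 c2] ->; rewrite zS -(opprB _ x) mulrN sqrrN -/(z j).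
  rewrite (_ : 3 / q * _ = h * (3 * (1 + c ^+ 2)^-1)); last first.
    by move: (1 + _)^-1 => D; field; rewrite gt_eqF.
  rewrite ler_wpM2l ?(ltW h0) //.
  have p1 : 0 < 1 + z j ^+ 2 by rewrite ltr_pwDl // sqr_ge0.
  have p2 : 0 < 1 + c ^+ 2 by rewrite ltr_pwDl // sqr_ge0.
  rewrite ler_pdivlMr // mulrC ler_pdivrMr //.
  have cz : c - z j <= 1 by lra.
  suff : c ^+ 2 <= 2 * z j ^+ 2 + 2 by have := sqr_ge0 (z j) => ? ?; lra.
  have -> : c = z j + (c - z j) by ring.
  set d := c - z j in cz *; have d0 : 0 <= d by rewrite /d; lra.
  have h1 : d ^+ 2 <= 1 by rewrite expr_le1.
  have h2 : 0 <= (z j - d) ^+ 2 by rewrite sqr_ge0.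
  by rewrite (_ : (_ + _) ^+ 2 = 2 * z j ^+ 2 + 2 * d ^+ 2 - (z j - d) ^+ 2); [lra|ring].
apply: le_trans (_ : \sum_(j < n) 3 / q * (atan (z j.+1) - atan (z j)) <= _).
  by apply: ler_sum => j _.
rewrite -mulr_sumr -(big_mkord xpredT (fun j => atan (z j.+1) - atan (z j))) telescope_sumr //.
have := atan_ltpi2 (z n); have := atan_gtNpi2 (z 0%N); rewrite [leRHS]mulrAC => h1 h2.
by apply: ler_wpM2l; [rewrite divr_ge0 // ltW|lra].
Qed.

End RiemannSums.

Section Kernel.
Variable R : realType.
Implicit Types (a y : R).

(** Hermite polynomials up to normalization: [kern a l] is the l-th derivative of exp (- a y^2). *)
Definition kpoly a (l : nat) : pexp R unit :=
  iter l (pop (fun=> PC 1) (PM (PC a) (PM (PX tt) (PX tt)))) (PC 1).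
Definition kern a l y : R := ev (fun=> y) (kpoly a l) * expR (- (a * y ^+ 2)).

Lemma kern0 a y : kern a 0 y = expR (- (a * y ^+ 2)).
Proof. by rewrite /kern mul1r. Qed.

Lemma kern_derive a l y : is_derive y 1 (kern a l) (kern a l.+1 y).
Proof.
have hd (p : pexp R unit) : is_derive y 1 (fun y => ev (fun=> y) p) (ev (fun=> y) (pder (fun=> PC 1) p)).
  by apply: ev_is_derive => _; exact: is_derive_id.
rewrite (_ : kern a l = fun y => ev (fun=> y) (kpoly a l) *
    expR (- ev (fun=> y) (PM (PC a) (PM (PX tt) (PX tt))))); last first.
  by apply/funext => z; rewrite /kern /= expr2.
rewrite [X in is_derive _ _ _ X](_ : _ = ev (fun=> y) (kpoly a l) *
    - (ev (fun=> y) (pder (fun=> PC 1) (PM (PC a) (PM (PX tt) (PX tt)))) *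
    expR (- ev (fun=> y) (PM (PC a) (PM (PX tt) (PX tt)))))
    + expR (- ev (fun=> y) (PM (PC a) (PM (PX tt) (PX tt)))) * ev (fun=> y) (pder (fun=> PC 1) (kpoly a l))).
  by apply: is_deriveM_fun; try exact: hd; apply: exp_is_derive; exact: hd.
by rewrite /kern /= expr2; ring.
Qed.

Lemma kern_decay a l n : 0 < a -> exists2 C, 0 <= C & forall y, (1 + `|y|) ^+ n * `|kern a l y| <= C.
Proof.
move=> a0.
have [d [K [K0 HK]]] : exists d K, 0 <= K /\ forall y, `|ev (fun=> y) (kpoly a l)| <= K * (1 + `|y|) ^+ d.
  elim: (kpoly a l) => [c|[]|p [dp [Cp [Cp0 Hp]]] q [dq [Cq [Cq0 Hq]]]|p [dp [Cp [Cp0 Hp]]] q [dq [Cq [Cq0 Hq]]]].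
  - by exists 0%N, `|c|; split => // y; rewrite expr0 mulr1.
  - by exists 1%N, 1; split => // y; rewrite expr1 mul1r /= lerDr.
  - exists (maxn dp dq), (Cp + Cq); split=> [|y /=]; first exact: addr_ge0.
    rewrite (le_trans (ler_normD _ _)) // mulrDl lerD //.
      by rewrite (le_trans (Hp y)) // ler_wpM2l // poly_growthP // leq_maxl.
    by rewrite (le_trans (Hq y)) // ler_wpM2l // poly_growthP // leq_maxr.
  - exists (dp + dq)%N, (Cp * Cq); split=> [|y /=]; first exact: mulr_ge0.
    by rewrite normrM exprD mulrACA ler_pM ?Hp ?Hq.
have [M M0 HM] := gauss_decay (n + d) a0.
exists (K * M) => [|y]; first exact: mulr_ge0.
rewrite normrM (ger0_norm (expR_ge0 _)).
apply: le_trans (_ : (1 + `|y|) ^+ n * (K * (1 + `|y|) ^+ d * expR (- (a * y ^+ 2))) <= _).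
  by rewrite ler_wpM2l ?exprn_ge0 ?addr_ge0 // ler_wpM2r ?expR_ge0.
rewrite [leLHS](_ : _ = K * ((1 + `|y|) ^+ (n + d) * expR (- (a * `|y| ^+ 2)))).
  by rewrite ler_wpM2l // HM.
by rewrite exprD real_normK ?num_real //; ring.
Qed.

Lemma kern_decay_upto a L n : 0 < a -> exists2 C, 0 <= C & forall l, (l <= L)%N ->
  forall y, (1 + `|y|) ^+ n * `|kern a l y| <= C.
Proof.
move=> a0; elim: L => [|L [C C0 H]].
  by have [C C0 H] := kern_decay 0 n a0; exists C => // l; rewrite leqn0 => /eqP ->.
have [C' C'0 H'] := kern_decay L.+1 n a0.
exists (C + C') => [|l]; first exact: addr_ge0.
rewrite leq_eqVlt => /orP[/eqP -> y|lL y]; first by rewrite (le_trans (H' y)) // lerDr.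
by rewrite (le_trans (H l lL y)) // lerDl.
Qed.

End Kernel.

Section Weights.
Variable R : realType.
Implicit Types (x y s : R).

Definition wt y : R := 1 + `|y|.

Lemma wt_ge1 y : 1 <= wt y. Proof. by rewrite /wt lerDl. Qed.
Lemma wt_gt0 y : 0 < wt y. Proof. exact: lt_le_trans ltr01 (wt_ge1 y). Qed.
Lemma wtX_gt0 y n : 0 < wt y ^+ n. Proof. by rewrite exprn_gt0 // wt_gt0. Qed.
Lemma wtX_ge0 y n : 0 <= wt y ^+ n. Proof. exact: ltW (wtX_gt0 y n). Qed.
Lemma wtX_ge1 y n : 1 <= wt y ^+ n. Proof. by rewrite exprn_ege1 // wt_ge1. Qed.

(** Peetre's inequality, which transfers decay in s and in x - s to decay in x. *)
Lemma wt_mul x s n : wt x ^+ n <= wt s ^+ n * wt (x - s) ^+ n.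
Proof.
rewrite -exprMn; apply: lerXn2r; rewrite ?nnegrE ?mulr_ge0 ?(ltW (wt_gt0 _)) //.
rewrite /wt; have h : `|x| <= `|s| + `|x - s|.
  by rewrite -{1}(subrK s x) addrC ler_normD.
by have := mulr_ge0 (normr_ge0 s) (normr_ge0 (x - s)) => h'; nra.
Qed.

Lemma wtXW y n n' : (n <= n')%N -> wt y ^+ n <= wt y ^+ n'.
Proof. by move=> nn; rewrite ler_weXn2l // wt_ge1. Qed.

End Weights.

Section OneDimension.
Variable R : realType.
Variables (k L : nat) (a C M : R) (g : nat -> R -> R).
Hypothesis kern_le : forall l, (l <= L.+2)%N -> forall y, wt y ^+ k.+2 * `|kern a l y| <= C.
Hypothesis g_derive : forall r (y : R), is_derive y 1 (g r) (g r.+1 y).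
Hypothesis g_le : forall r, (r <= L.+2)%N -> forall y, wt y ^+ k.+2 * `|g r y| <= M.

Let C_ge0 : 0 <= C.
Proof. by apply: le_trans (kern_le (leq0n _) 0); rewrite mulr_ge0 // ltW // wtX_gt0. Qed.

Let M_ge0 : 0 <= M.
Proof. by apply: le_trans (g_le (leq0n _) 0); rewrite mulr_ge0 // ltW // wtX_gt0. Qed.

(** Of the k + 2 available powers, k pass to x by Peetre's inequality and 2 remain on the node s,
    where they make the ends of the grid negligible. *)
Lemma prod_le r l x s : (r <= L.+2)%N -> (l <= L.+2)%N ->
  wt x ^+ k * `|g r s * kern a l (x - s)| <= M * C / wt s ^+ 2.
Proof.
move=> rL lL; rewrite ler_pdivlMr ?wtX_gt0 // normrM.
apply: le_trans (_ : (wt s ^+ k.+2 * `|g r s|) * (wt (x - s) ^+ k.+2 * `|kern a l (x - s)|) <= _).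
  rewrite [leLHS](_ : _ = wt x ^+ k * (wt s ^+ 2 * `|g r s| * `|kern a l (x - s)|)); last by ring.
  rewrite [leRHS](_ : _ = (wt s ^+ k * wt (x - s) ^+ k.+2) * (wt s ^+ 2 * `|g r s| * `|kern a l (x - s)|)).
    apply: ler_wpM2r; first by rewrite mulr_ge0 // mulr_ge0 // wtX_ge0.
    apply: le_trans (wt_mul x s k) _; apply: ler_wpM2l; first exact: wtX_ge0.
    by apply: wtXW; rewrite ltnW.
  by rewrite -addn2 !exprD; ring.
by apply: ler_pM; [| |exact: g_le|exact: kern_le]; rewrite mulr_ge0 ?wtX_ge0.
Qed.

Section Sums.
Variables (h : R) (J : nat).
Hypotheses (h_gt0 : 0 < h).
Let n := (2 * J).+1.
Let b := - (J%:R * h).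
Let node j : R := b + j%:R * h.
Hypothesis T_gt0 : 0 < J%:R * h.

Definition rsum r l x := \sum_(j < n) h * (g r (node j) * kern a l (x - node j)).

Let gk r l x s := g r s * kern a l (x - s).

Let gk_derive r l x (s : R) : is_derive s 1 (gk r l x) (gk r.+1 l x s - gk r l.+1 x s).
Proof.
have hk : is_derive s 1 (fun s => kern a l (x - s)) (kern a l.+1 (x - s) * (0 - 1)).
  apply: (@is_derive_chain _ _ (fun s : R => x - s) _ _ _ (kern a l)); last exact: kern_derive.
rewrite [X in is_derive _ _ _ X](_ : _ = g r s * (kern a l.+1 (x - s) * (0 - 1))
   + kern a l (x - s) * g r.+1 s); last by rewrite /gk; ring.
exact: is_deriveM_fun.
Qed.

(** The difference is a Riemann sum of the derivative in s of g^(r)(s) kern^(l)(x - s). It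
    telescopes, up to a second derivative made of four products and two boundary terms at distance
    at least J h from 0. *)
Lemma rsum_swap r l x : (r <= L)%N -> (l <= L)%N ->
  wt x ^+ k * `|rsum r l.+1 x - rsum r.+1 l x| <=
  M * C * (4 * n%:R * h ^+ 2 + 2 / (J%:R * h) ^+ 2).
Proof.
move=> rL lL; set W := wt x ^+ k; have W0 : 0 < W by exact: wtX_gt0.
have gkW r' l' s : (r' <= L.+2)%N -> (l' <= L.+2)%N -> `|gk r' l' x s| <= M * C / W.
  move=> r'L l'L; rewrite ler_pdivlMr // mulrC; apply: le_trans (prod_le x s r'L l'L) _.
  by rewrite ler_pdivrMr ?wtX_gt0 // ler_peMr ?mulr_ge0 // wtX_ge1.
have bnd s T : 0 < T -> T <= `|s| -> `|gk r l x s| <= M * C / W / T ^+ 2.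
  move=> T0 sT; rewrite -mulrA (mulrC _^-1) mulrA ler_pdivlMr // mulrC.
  apply: le_trans (prod_le x s _ _) _; rewrite ?(leq_trans rL) ?(leq_trans lL) ?leqW //.
  rewrite ler_wpM2l ?mulr_ge0 // lef_pV2 ?posrE ?exprn_gt0 ?wt_gt0 //.
  by apply: lerXn2r; rewrite ?nnegrE ?(ltW T0) ?(ltW (wt_gt0 _)) // /wt; lra.
have H := @telescope_le R (gk r l x) (fun s => gk r.+1 l x s - gk r l.+1 x s)
  (fun s => (gk r.+2 l x s - gk r.+1 l.+1 x s) - (gk r.+1 l.+1 x s - gk r l.+2 x s))
  (4 * (M * C / W)) h b n (gk_derive r l x).
have {H}H : `|(rsum r.+1 l x - rsum r l.+1 x) - (gk r l x (b + n%:R * h) - gk r l x b)|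
     <= n%:R * (4 * (M * C / W) * h ^+ 2).
  rewrite /rsum -sumrB; under eq_bigr do rewrite -mulrBr; apply: H.
    by move=> s; apply: is_deriveB; exact: gk_derive.
  have [r0 r1 r2] : [/\ (r <= L.+2)%N, (r.+1 <= L.+2)%N & (r.+2 <= L.+2)%N] by split; lia.
  have [l0 l1 l2] : [/\ (l <= L.+2)%N, (l.+1 <= L.+2)%N & (l.+2 <= L.+2)%N] by split; lia.
  move=> s; have h1 := gkW _ _ s r2 l0; have h2 := gkW _ _ s r1 l1; have h3 := gkW _ _ s r0 l2.
  apply: (le_trans (ler_normB _ _)); have := ler_normB (gk r.+2 l x s) (gk r.+1 l.+1 x s).
  by have := ler_normB (gk r.+1 l.+1 x s) (gk r l.+2 x s); lra.
have h1 := bnd b _ T_gt0; have h2 := bnd (b + n%:R * h) _ T_gt0.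
have {}h1 : `|gk r l x b| <= M * C / W / (J%:R * h) ^+ 2.
  by apply: h1; rewrite /b normrN gtr0_norm.
have {}h2 : `|gk r l x (b + n%:R * h)| <= M * C / W / (J%:R * h) ^+ 2.
  apply: h2; rewrite (_ : b + n%:R * h = J%:R * h + h); last first.
    by rewrite /b /n -natr1 natrM; ring.
  by rewrite gtr0_norm ?addr_gt0 // lerDl ltW.
rewrite -(distrC (rsum r.+1 l x)).
set X := rsum r.+1 l x - _ in H *.
have : `|X| <= n%:R * (4 * (M * C / W) * h ^+ 2) + 2 * (M * C / W / (J%:R * h) ^+ 2).
  set Y := gk r l x _ - gk r l x b in H.
  have := ler_normB (gk r l x (b + n%:R * h)) (gk r l x b); rewrite -/Y => hY.
  have := ler_normD (X - Y) Y; rewrite subrK => hX; lra.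
rewrite -(ler_pM2l W0) => /le_trans; apply; rewrite le_eqVlt; apply/orP; left; apply/eqP.
by field; rewrite (gt_eqF h_gt0) (gt_eqF W0) /=; move: T_gt0; rewrite pmulr_lgt0 // => /gt_eqF ->.
Qed.

(* Summation by parts moves the derivatives from the kernel to g. *)
Lemma rsum_shift l x : (l <= L)%N ->
  wt x ^+ k * `|rsum 0 l x - rsum l 0 x| <=
  L%:R * (M * C * (4 * n%:R * h ^+ 2 + 2 / (J%:R * h) ^+ 2)).
Proof.
move=> lL; set E := M * C * _.
have E0 : 0 <= E.
  by rewrite !mulr_ge0 // addr_ge0 ?mulr_ge0 ?invr_ge0 ?exprn_ge0 // ltW.
suff H r : (r <= l)%N -> wt x ^+ k * `|rsum 0 l x - rsum r (l - r) x| <= r%:R * E.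
  have := H l (leqnn l); rewrite subnn => /le_trans; apply.
  by rewrite ler_wpM2r // ler_nat.
elim: r => [_|r IH rl]; first by rewrite subn0 subrr normr0 mulr0 mul0r.
have lr : (l - r = (l - r.+1).+1)%N by rewrite -subSn.
rewrite -(subrKA (rsum r (l - r) x)) -natr1 mulrDl mul1r.
apply: le_trans (ler_wpM2l (ltW (wtX_gt0 _ _)) (ler_normD _ _)) _.
rewrite mulrDr; apply: lerD; first exact: IH (ltnW rl).
rewrite lr; apply: rsum_swap; first by rewrite (leq_trans (ltnW rl)).
by rewrite (leq_trans (leq_subr _ _)).
Qed.

End Sums.
End OneDimension.

Section KernelMass.
Variable R : realType.
Variables (q h C : R) (J : nat).
Hypotheses (q_gt0 : 0 < q) (h_gt0 : 0 < h) (hq : h * q <= 1) (T_gt0 : 0 < J%:R * h).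
Let a := q ^+ 2.
Let n := (2 * J).+1.
Let b := - (J%:R * h).
Let node j : R := b + j%:R * h.
Hypothesis kern_le : forall l, (l <= 2)%N -> forall y, wt y ^+ 2 * `|kern a l y| <= C.

(** A discretized integral of exp (- q^2 y^2). Normalizing by this sum itself requires no exact
    value: an upper bound, a lower bound at 0 and near independence of x are enough. *)
Definition mass x := \sum_(j < n) h * kern a 0 (x - node j).

Let kern0_ge0 y : 0 <= kern a 0 y.
Proof. by rewrite kern0 expR_ge0. Qed.

Let kern0_le y : kern a 0 y <= (1 + (q * y) ^+ 2)^-1.
Proof.
rewrite kern0 expRN /a -exprMn lef_pV2 ?posrE ?expR_gt0 ?expR_ge1Dx //.
by rewrite ltr_pwDl // sqr_ge0.
Qed.

Lemma mass_ge0 x : 0 <= mass x.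
Proof. by apply: sumr_ge0 => j _; rewrite mulr_ge0 // ltW. Qed.

Lemma mass_le x : mass x <= 3 * pi / q.
Proof.
apply: le_trans (sum_atan_le b x n q_gt0 h_gt0 hq); apply: ler_sum => j _.
by rewrite ler_wpM2l // ltW.
Qed.

(** The derivative in x is again a telescoping sum, hence close to a difference of kernel values at
    the ends of the grid, which are at distance at least T / 2 from x. *)
Lemma mass_cst x : `|x| <= J%:R * h / 2 ->
  `|mass x - mass 0| <= J%:R * h / 2 * (C * (n%:R * h ^+ 2 + 8 / (J%:R * h) ^+ 2)).
Proof.
move=> xT; set T := J%:R * h in xT *.
have dmass (y : R) : is_derive y 1 mass (\sum_(j < n) h * kern a 1 (y - node j)).
  rewrite /mass; move: (n : nat) => n'; elim: n' => [|n' IH].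
    by rewrite big_ord0; under eq_fun do rewrite big_ord0; exact: is_derive_cst.
  rewrite big_ord_recr; under eq_fun do rewrite big_ord_recr /=.
  apply: is_deriveD; apply: is_deriveZ_fun.
  rewrite [X in is_derive _ _ _ X](_ : _ = kern a 1 (y - node n') * (1 - 0)); last by rewrite subr0 mulr1.
  by apply: (@is_derive_chain _ _ (fun y : R => y - node n') _ _ _ (kern a 0)); exact: kern_derive.
have C0 : 0 <= C by apply: le_trans (kern_le (leqnSn 1) 0); rewrite mulr_ge0 // wtX_ge0.
have kle l y : (l <= 2)%N -> `|kern a l y| <= C.
  by move=> l2; apply: le_trans (kern_le l2 y); rewrite ler_peMl // wtX_ge1.
have kfar y : T / 2 <= `|y| -> `|kern a 0 y| <= 4 * C / T ^+ 2.
  move=> yT; have T20 : 0 < T ^+ 2 by rewrite exprn_gt0.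
  rewrite ler_pdivlMr //; have h1 := kern_le (leq0n 2) y; have h2 := normr_ge0 (kern a 0 y).
  have h3 : T ^+ 2 <= 4 * wt y ^+ 2.
    have : T <= 2 * wt y by rewrite /wt; lra.
    rewrite -(ler_pXn2r (n := 2)) ?nnegrE ?(ltW T_gt0) ?mulr_ge0 ?(ltW (wt_gt0 y)) //.
    by rewrite exprMn; lra.
  apply: le_trans (_ : `|kern a 0 y| * (4 * wt y ^+ 2) <= _); first by rewrite ler_wpM2l.
  by rewrite mulrCA ler_wpM2l // mulrC.
have bnd y : `|y| <= T / 2 -> `|\sum_(j < n) h * kern a 1 (y - node j)| <= C * (n%:R * h ^+ 2 + 8 / T ^+ 2).
  move=> yT.
  have hp (l : nat) (s : R) : is_derive s 1 (fun s => - kern a l (y - s)) (kern a l.+1 (y - s)).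
    rewrite [X in is_derive _ _ _ X](_ : _ = - (kern a l.+1 (y - s) * (0 - 1))); last by ring.
    apply: is_deriveN.
    by apply: (@is_derive_chain _ _ (fun s : R => y - s) _ _ _ (kern a l)); exact: kern_derive.
  have hp1 (s : R) : is_derive s 1 (fun s => kern a 1 (y - s)) (- kern a 2 (y - s)).
    have := is_deriveN (hp 1%N s); rewrite (_ : - _ = fun s => kern a 1 (y - s)) //.
    by apply/funext => s'; rewrite /= opprK.
  have {hp hp1} := telescope_le h b n (hp 0%N) hp1
    (fun s => le_trans (eq_ind_r (fun z => z <= _) (lexx _) (normrN _)) (kle 2%N (y - s) isT)).
  have bT : b = - T by [].
  have eT : b + n%:R * h = T + h by rewrite bT /T /n -natr1 natrM; ring.
  have y1 := @ler_norm R y; have := @ler_norm R (- y); rewrite normrN => y2.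
  have hg := h_gt0.
  have h1 : `|kern a 0 (y - b)| <= 4 * C / T ^+ 2.
    by apply: kfar; rewrite bT; apply: le_trans (ler_norm _); lra.
  have h2 : `|kern a 0 (y - (b + n%:R * h))| <= 4 * C / T ^+ 2.
    by apply: kfar; rewrite eT -normrN; apply: le_trans (ler_norm _); lra.
  move: h1 h2; rewrite /node; set S := \sum_(j < n) _.
  set u1 := kern a 0 (y - b); set u2 := kern a 0 _ => h1 h2 H.
  rewrite (_ : S = (S - (- u2 - - u1)) + (u1 - u2)); last by ring.
  apply: le_trans (ler_normD _ _) _; have := ler_normB u1 u2.
  rewrite (_ : C * _ = n%:R * (C * h ^+ 2) + 2 * (4 * C / T ^+ 2)); last by ring.
  lra.
have [c] := mean_value dmass 0 x; rewrite subr0 => cx ->; rewrite normrM mulrC.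
apply: ler_pM => //; apply: bnd; apply: le_trans xT.
move: cx; have [x0|x0] := leP 0 x => /andP[c1 c2]; first by rewrite !ger0_norm.
by rewrite ler0_norm // (ltr0_norm x0) lerN2.
Qed.

(** The m nodes in [0, 1 / q] contribute at least h exp (- 1) each. *)
Lemma mass_lb m : (m <= J)%N -> m%:R * h * q = 1 -> expR (- 1) / q <= mass 0.
Proof.
move=> mJ mhq; rewrite /mass.
have -> : \sum_(j < n) h * kern a 0 (0 - node j) =
   \sum_(0 <= j < n) h * kern a 0 (0 - node j) by rewrite big_mkord.
rewrite (big_cat_nat (n := J)) //=; last by rewrite /n; lia.
rewrite (big_cat_nat (n := (J + m)%N) (m := J)) /= ?leq_addr //; last by rewrite /n; lia.
have ge0 i : 0 <= h * kern a 0 (0 - node i) by rewrite mulr_ge0 // ltW.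
apply: le_trans (_ : \sum_(J <= i < J + m) h * kern a 0 (0 - node i) <= _); last first.
  have s0 p p' : 0 <= \sum_(p <= i < p') h * kern a 0 (0 - node i) by exact: sumr_ge0.
  by rewrite addrCA lerDl addr_ge0.
apply: le_trans (_ : \sum_(J <= i < J + m) h * expR (- 1) <= _).
  rewrite sumr_const_nat addKn -mulr_natl.
  by rewrite ler_pdivrMr // mulrA mulrAC mhq mul1r.
apply: ler_sum_nat => i /andP[Ji im]; rewrite ler_wpM2l ?(ltW h_gt0) //.
rewrite kern0 ler_expR lerN2 sub0r sqrrN /a -exprMn.
have -> : node i = (i - J)%:R * h by rewrite /node /b natrB //; ring.
have qh0 : 0 <= q * h by rewrite mulr_ge0 // ltW.
rewrite expr_le1 ?mulr_ge0 ?(ltW q_gt0) ?(ltW h_gt0) //.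
apply: le_trans (_ : m%:R * h * q <= _); last by rewrite mhq.
rewrite mulrCA -mulrA (mulrC h) ler_wpM2r // ler_nat; lia.
Qed.
End KernelMass.

Section BaseEstimate.
Variable R : realType.
Variables (k L J : nat) (q h C C1 M : R) (g : nat -> R -> R).
Let a := q ^+ 2.
Hypothesis kern_le : forall l, (l <= L.+2)%N -> forall y, wt y ^+ k.+2 * `|kern a l y| <= C.
Hypothesis g_derive : forall r (y : R), is_derive y 1 (g r) (g r.+1 y).
Hypothesis g_le : forall r, (r <= L.+2)%N -> forall y, wt y ^+ k.+2 * `|g r y| <= M.
Hypothesis C1_le : forall z : R, wt z ^+ k.+3 * expR (- z ^+ 2) <= C1.
Hypotheses (q_ge1 : 1 <= q) (h_gt0 : 0 < h) (hq : h * q <= 1) (T_gt0 : 0 < J%:R * h).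
Let n := (2 * J).+1.
Let b := - (J%:R * h).
Let node j : R := b + j%:R * h.
Let T := J%:R * h.

Let q_gt0 : 0 < q. Proof. exact: lt_le_trans ltr01 q_ge1. Qed.

Let M_ge0 : 0 <= M.
Proof. by apply: le_trans (g_le (leq0n _) 0); rewrite mulr_ge0 // ltW // wtX_gt0. Qed.

Let increment_le l x s : (l <= L)%N ->
  wt x ^+ k * `|g l s - g l x| <= M * (`|x - s| * wt (x - s) ^+ k).
Proof.
move=> lL; have [c cxs ->] := mean_value (g_derive l) x s.
have xc : `|x - c| <= `|x - s|.
  move: cxs; have [xs|xs] := leP x s => /andP[c1 c2].
    by rewrite !ler0_norm ?subr_le0 //; lra.
  by have xs' := ltW xs; rewrite !ger0_norm ?subr_ge0 //; lra.
rewrite normrM (distrC s) mulrA [leRHS]mulrCA mulrC ler_wpM2l //.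
apply: le_trans (ler_wpM2r (normr_ge0 _) (wt_mul x c k)) _.
rewrite mulrAC; apply: ler_pM; rewrite ?mulr_ge0 ?wtX_ge0 //.
  apply: le_trans (g_le (r := l.+1) _ c); last by rewrite ltnS leqW.
  by rewrite ler_wpM2r // wtXW // -addn2 leq_addr.
by apply: lerXn2r; rewrite ?nnegrE ?(ltW (wt_gt0 _)) // lerD2l.
Qed.

Let kernel_le y : `|y| * wt y ^+ k * kern a 0 y <= C1 / q * (1 + (q * y) ^+ 2)^-1.
Proof.
have p0 : 0 < 1 + (q * y) ^+ 2 by rewrite ltr_pwDl // sqr_ge0.
rewrite ler_pdivlMr // ler_pdivlMr // kern0 /a -exprMn.
apply: le_trans (C1_le (q * y)); set E := expR _; have E0 : 0 <= E by exact: expR_ge0.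
rewrite [leLHS](_ : _ = (`|y| * q * wt y ^+ k * (1 + (q * y) ^+ 2)) * E); last by ring.
rewrite ler_wpM2r // [leRHS](_ : _ = wt (q * y) * wt (q * y) ^+ k * wt (q * y) ^+ 2); last first.
  by rewrite -addn3 exprD; ring.
have -> : `|y| * q = `|q * y| by rewrite normrM (gtr0_norm q_gt0) mulrC.
apply: ler_pM; rewrite ?mulr_ge0 ?wtX_ge0 ?(ltW p0) //; last first.
  have := normr_ge0 (q * y); have := real_normK (num_real (q * y)).
  by rewrite /wt; move: `|_| => z <- z0; nra.
apply: ler_pM; rewrite ?wtX_ge0 // ?/wt ?lerDr //.
apply: lerXn2r; rewrite ?nnegrE ?addr_ge0 // lerD2l normrM (gtr0_norm q_gt0).
by rewrite ler_peMl.
Qed.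

(** The difference splits into increments g(s) - g(x), weighted by a kernel of width 1 / q, and
    (mass x - mass 0) g(x). The latter is small in the middle by [mass_cst], and for |x| > T / 2 by
    two spare powers in the decay of g. *)
Lemma rsum_base l x : (l <= L)%N ->
  wt x ^+ k * `|rsum a g h J l 0 x - mass q h J 0 * g l x| <=
  M * (3 * pi * C1 / q ^+ 2 + T / 2 * (C * (n%:R * h ^+ 2 + 8 / T ^+ 2)) + 12 * pi / (q * T ^+ 2)).
Proof.
move=> lL; have T20 : 0 < T ^+ 2 by rewrite exprn_gt0.
have W0 := wtX_ge0 x k.
have klow l' : (l' <= 2)%N -> forall y, wt y ^+ 2 * `|kern a l' y| <= C.
  move=> l2 y; apply: le_trans (kern_le (leq_trans l2 _) y); last by [].
  by rewrite ler_wpM2r // wtXW.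
pose D1 := \sum_(j < n) h * kern a 0 (x - node j) * (g l (node j) - g l x).
rewrite (_ : _ - _ = D1 + (mass q h J x - mass q h J 0) * g l x); last first.
  rewrite mulrBl addrA; congr (_ - _); rewrite /rsum /mass mulr_suml -big_split /=.
  by apply: eq_bigr => j _; rewrite mulrBr subrK mulrCA mulrC.
have hD1 : wt x ^+ k * `|D1| <= M * (3 * pi * C1 / q ^+ 2).
  apply: le_trans (_ : \sum_(j < n) M * (C1 / q) * (h / (1 + (q * (x - node j)) ^+ 2)) <= _).
    apply: le_trans (ler_wpM2l W0 (ler_norm_sum _ _ _)) _; rewrite mulr_sumr; apply: ler_sum => j _.
    have K0 : 0 <= kern a 0 (x - node j) by rewrite kern0 expR_ge0.
    rewrite normrM (normrM h) (gtr0_norm h_gt0) (ger0_norm K0).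
    have h1 := increment_le x (node j) lL; have h2 := kernel_le (x - node j).
    move: h1 h2 K0; set v := wt (x - _); set gg := `|g l _ - _|; set KK := kern _ _ _; set d := `|x - _|.
    set ii := (1 + _)^-1 => h1 h2 K0.
    rewrite [leLHS](_ : _ = h * KK * (wt x ^+ k * gg)); last by ring.
    apply: le_trans (_ : h * KK * (M * (d * v ^+ k)) <= _).
      by rewrite ler_wpM2l // mulr_ge0 // ltW.
    rewrite [leLHS](_ : _ = h * M * (d * v ^+ k * KK)); last by ring.
    rewrite [leRHS](_ : _ = h * M * (C1 / q * ii)); last by ring.
    by rewrite ler_wpM2l // mulr_ge0 // ltW.
  rewrite -mulr_sumr; apply: le_trans (ler_wpM2l _ (sum_atan_le b x n q_gt0 h_gt0 hq)) _.
    rewrite mulr_ge0 // divr_ge0 // ?(ltW q_gt0) //.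
    by apply: le_trans (C1_le 0); rewrite mulr_ge0 ?wtX_ge0 ?expR_ge0.
  rewrite le_eqVlt; apply/orP; left; apply/eqP; field; exact: lt0r_neq0.
have hD2 : wt x ^+ k * `|(mass q h J x - mass q h J 0) * g l x| <=
    M * (T / 2 * (C * (n%:R * h ^+ 2 + 8 / T ^+ 2)) + 12 * pi / (q * T ^+ 2)).
  have C0 : 0 <= C.
    by apply: le_trans (kern_le (leq0n _) 0); rewrite mulr_ge0 // wtX_ge0.
  have E1 : 0 <= T / 2 * (C * (n%:R * h ^+ 2 + 8 / T ^+ 2)).
    by rewrite !(mulr_ge0, addr_ge0, invr_ge0) ?(ltW T_gt0) ?exprn_ge0 ?(ltW T_gt0) ?(ltW h_gt0).
  have E2 : 0 <= 12 * pi / (q * T ^+ 2).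
    by apply: divr_ge0; apply: mulr_ge0; rewrite ?pi_ge0 ?(ltW q_gt0) ?(ltW T20).
  have gl := g_le (leqW (leqW lL)) x.
  rewrite normrM mulrCA mulrC.
  have [xT|xT] := leP `|x| (T / 2).
    apply: le_trans (_ : M * (T / 2 * (C * (n%:R * h ^+ 2 + 8 / T ^+ 2))) <= _); last first.
      by rewrite ler_wpM2l // lerDl.
    apply: ler_pM; rewrite ?mulr_ge0 //.
      by apply: le_trans gl; rewrite ler_wpM2r // wtXW // -addn2 leq_addr.
    exact: (mass_cst (C := C)).
  apply: le_trans (_ : M * (12 * pi / (q * T ^+ 2)) <= _); last first.
    by rewrite ler_wpM2l // lerDr.
  have dm : `|mass q h J x - mass q h J 0| <= 3 * pi / q.
    have := mass_ge0 q J h_gt0 x; have := mass_ge0 q J h_gt0 0.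
    have := mass_le J q_gt0 h_gt0 hq x; have := mass_le J q_gt0 h_gt0 hq 0.
    by move=> ? ? ? ?; rewrite ler_norml; lra.
  have w2 : T ^+ 2 <= 4 * wt x ^+ 2.
    have : T <= 2 * wt x by rewrite /wt; lra.
    rewrite -(ler_pXn2r (n := 2)) ?nnegrE ?(ltW T_gt0) ?mulr_ge0 ?(ltW (wt_gt0 x)) //.
    by rewrite exprMn; lra.
  have g4 : wt x ^+ k * `|g l x| <= M * (4 / T ^+ 2).
    rewrite mulrA ler_pdivlMr //; apply: le_trans (_ : 4 * (wt x ^+ k.+2 * `|g l x|) <= _).
      rewrite -(addn2 k) exprD; move: (wt x ^+ 2) w2 => w w2.
      rewrite [leRHS](_ : _ = wt x ^+ k * `|g l x| * (4 * w)); last by ring.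
      by rewrite ler_wpM2l // mulr_ge0.
    by lra.
  rewrite [leRHS](_ : _ = M * (4 / T ^+ 2) * (3 * pi / q)); last first.
    by field; rewrite !lt0r_neq0 //.
  by apply: ler_pM; rewrite ?mulr_ge0.
apply: le_trans (ler_wpM2l W0 (ler_normD _ _)) _; rewrite mulrDr -addrA mulrDr; exact: lerD.
Qed.

End BaseEstimate.

Section GaussianSums.
Variable R : realType.

Lemma exists_nat_ge (x : R) : exists2 N : nat, (0 < N)%N & x <= N%:R.
Proof.
exists (Num.bound x).+1 => //; have [x0|x0] := leP 0 x.
  by apply: le_trans (ltW (archi_boundP x0)) _; rewrite ler_nat.
exact: le_trans (ltW x0) _.
Qed.

(* The sums are Riemann sums for the convolution of g with a normalized Gaussian.  The width
   1 / q of the Gaussian is chosen first, then a large N, with mesh 1 / (q N ^ 3) and nodes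
   in [- N, N]. *)
Lemma gaussian_sum1 k L (eta : R) : 0 < eta -> exists2 a : R, 0 < a &
  exists s : seq (R * R), forall (M : R) (g : nat -> R -> R),
  (forall r (y : R), is_derive y 1 (g r) (g r.+1 y)) ->
  (forall r, (r <= L.+2)%N -> forall y, wt y ^+ k.+2 * `|g r y| <= M) ->
  forall l, (l <= L)%N -> forall x,
    wt x ^+ k * `|\sum_(p <- s) p.1 * g 0 p.2 * kern a l (x - p.2) - g l x| <= eta * M.
Proof.
move=> eta0; set e := expR (1 : R); have e0 : 0 < e by exact: expR_gt0.
have [C1 C10 hC1] := gauss_decay k.+3 (@ltr01 R).
(* Makes the increment term of [rsum_base], multiplied by 1 / mass <= e q, at most half of the
   allowed error. *)
have [qn qn0 hq] := exists_nat_ge (6 * e * pi * C1 / eta).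
set q : R := qn%:R in hq; have q0 : 0 < q by rewrite ltr0n.
have q1 : 1 <= q by rewrite ler1n.
have [C C0 hC] := kern_decay_upto L.+2 k.+2 (exprn_gt0 2 q0).
(* K / t will bound e q times all the remaining errors, each of which is O(1 / t) on the grid chosen
   below. *)
pose K := e * (14 * L%:R * q * C + 6 * q * C + 12 * pi).
have [N N0 hN] := exists_nat_ge (2 * K / eta).
set t : R := N%:R in hN; have t0 : 0 < t by rewrite ltr0n.
have t1 : 1 <= t by rewrite ler1n.
(* This gives J h = t, so the nodes fill [- t, t], and a mesh so fine that (2 J + 1) h^2 <= 3 /
   t^2. *)
pose h : R := (q * t ^+ 3)^-1; have [J JE] : exists J, J = (qn * N ^ 4)%N by eexists.
have J0 : (0 < J)%N by rewrite JE muln_gt0 qn0 expn_gt0 N0.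
have qn1 : q != 0 by exact: lt0r_neq0.
have tn1 : t != 0 by exact: lt0r_neq0.
have h0 : 0 < h by rewrite invr_gt0 mulr_gt0 // exprn_gt0.
have T : J%:R * h = t.
  by rewrite JE /h natrM natrX -/q -/t; field; rewrite qn1 tn1.
have mhq : (N ^ 3)%:R * h * q = 1.
  by rewrite /h natrX -/t; field; rewrite qn1 tn1.
have hq1 : h * q <= 1.
  by rewrite -mhq -mulrA ler_peMl ?mulr_ge0 ?(ltW h0) ?(ltW q0) // ler1n expn_gt0 N0.
have T0 : 0 < J%:R * h by rewrite T.
have nh2 : ((2 * J).+1)%:R * h ^+ 2 <= 3 / t ^+ 2.
  have : ((2 * J).+1)%:R <= 3 * J%:R :> R.
    by rewrite -(natrM _ 3 J) ler_nat; clear -J0; lia.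
  move=> /(ler_wpM2r (exprn_ge0 2 (ltW h0))) /le_trans; apply.
  rewrite [leLHS](_ : _ = 3 * (J%:R * h * h)); last by ring.
  rewrite T ler_wpM2l // [leLHS](_ : _ = (t ^+ 2)^-1 * q^-1); last first.
    by rewrite /h; field; rewrite qn1 tn1.
  by rewrite ler_piMr ?invr_ge0 ?exprn_ge0 ?(ltW t0) // invf_le1.
have mN : (N ^ 3 <= J)%N.
  by rewrite JE (expnS N 3) mulnA leq_pmull // muln_gt0 qn0.
have m0 := mass_lb q0 h0 hq1 T0 mN mhq; set ms := mass q h J 0 in m0.
have ms0 : 0 < ms by apply: lt_le_trans m0; rewrite divr_gt0 // expR_gt0.
have ms1 : ms^-1 <= e * q.
  rewrite -(invrK (e * q)) lef_pV2 ?posrE ?invr_gt0 ?mulr_gt0 //.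
  by rewrite invfM -expRN.
exists (q ^+ 2); first exact: exprn_gt0.
(* Up to the values of g, coefficients and nodes are fixed before g and M are given, so that one
   choice will serve for all values of the other variables. *)
exists [seq (h / ms, - (J%:R * h) + j%:R * h) | j <- iota 0 (2 * J).+1] => M g gd gM l lL x.
have M0 : 0 <= M.
  by apply: le_trans (gM 0%N isT 0); rewrite mulr_ge0 // wtX_ge0.
have hC1' z : wt z ^+ k.+3 * expR (- z ^+ 2) <= C1.
  by have := hC1 _ (normr_ge0 z); rewrite mul1r real_normK ?num_real.
have E1 := rsum_shift hC gd gM h0 T0 x lL.
have E2 := rsum_base hC gd gM hC1' q1 h0 hq1 T0 x lL.
rewrite big_map -/(index_iota 0 (2 * J).+1) big_mkord -/ms in E2 *.
rewrite (_ : _ - g l x = ms^-1 * ((rsum (q ^+ 2) g h J 0 l x - rsum (q ^+ 2) g h J l 0 x) +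
    (rsum (q ^+ 2) g h J l 0 x - ms * g l x))); last first.
  rewrite subrKA mulrBr mulKf ?lt0r_neq0 //; congr (_ - _).
  by rewrite /rsum mulr_sumr; apply: eq_bigr => j _ /=; rewrite -!mulrA mulrCA.
rewrite normrM (gtr0_norm (_ : 0 < ms^-1)) ?invr_gt0 // mulrCA.
apply: le_trans (_ : e * q * (M * (eta / (2 * e * q) + (14 * L%:R * C + 6 * C + 12 * pi / q) / t)) <= _); last first.
  rewrite mulrCA [leRHS]mulrC ler_wpM2l // mulrDr.
  rewrite [X in X + _](_ : _ = eta / 2); last by field; rewrite qn1 lt0r_neq0.
  rewrite [X in _ + X](_ : _ = K / t); last by rewrite /K; field; rewrite qn1 tn1.
  suff : K / t <= eta / 2 by lra.
  by rewrite ler_pdivrMr //; move: hN; rewrite ler_pdivrMr //; lra.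
apply: ler_pM; rewrite ?invr_ge0 ?(ltW ms0) ?mulr_ge0 ?wtX_ge0 //.
apply: le_trans (ler_wpM2l (wtX_ge0 _ _) (ler_normD _ _)) _; rewrite mulrDr.
apply: le_trans (lerD E1 E2) _; rewrite T -(mulrA 4).
move: nh2; set X := _ * h ^+ 2 => nh2.
have hB : 3 * pi * C1 / q ^+ 2 <= eta / (2 * e * q).
  rewrite (_ : 3 * pi * C1 / q ^+ 2 = (6 * e * pi * C1 / eta) * (eta / (2 * e * q ^+ 2))).
    rewrite (_ : eta / (2 * e * q) = q * (eta / (2 * e * q ^+ 2))).
      by rewrite ler_wpM2r // divr_ge0 ?ltW // mulr_gt0 ?exprn_gt0 // mulr_gt0.
    by field; rewrite qn1 lt0r_neq0.
  by field; rewrite qn1 !lt0r_neq0.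
pose i := t^-1; have i0 : 0 < i by rewrite invr_gt0.
have i1 : i <= 1 by rewrite invf_le1.
have i2 : i ^+ 2 <= i by rewrite expr2 ler_piMr // ltW.
rewrite -!exprVn -/i in nh2 *.
rewrite [leLHS](_ : _ = M * (L%:R * C * (4 * X + 2 * i ^+ 2) +
   (3 * pi * C1 / q ^+ 2 + t / 2 * (C * (X + 8 * i ^+ 2)) + 12 * pi / q * i ^+ 2))); last first.
  by rewrite /i; field; rewrite qn1 tn1.
apply: ler_wpM2l => //.
have b1 : L%:R * C * (4 * X + 2 * i ^+ 2) <= L%:R * C * (14 * i).
  by rewrite ler_wpM2l ?mulr_ge0 //; lra.
have b2 : t / 2 * (C * (X + 8 * i ^+ 2)) <= 6 * C * i.
  apply: le_trans (_ : t / 2 * (C * (11 * i ^+ 2)) <= _).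
    by rewrite !ler_wpM2l ?divr_ge0 ?(ltW t0) //; lra.
  rewrite [leLHS](_ : _ = 11 / 2 * (C * i)); last by rewrite /i; field.
  by have := mulr_ge0 C0 (ltW i0); lra.
have b3 : 12 * pi / q * i ^+ 2 <= 12 * pi / q * i.
  by rewrite ler_wpM2l // divr_ge0 ?mulr_ge0 ?pi_ge0 // ltW.
by rewrite (_ : (_ + _ + _) / t = 14 * L%:R * C * i + 6 * C * i + 12 * pi / q * i); [lra|rewrite /i; ring].
Qed.

End GaussianSums.

(** * Approximation in one variable at a time *)

Section Freezing.
Variables (R : realType) (m : nat).
Implicit Types (psi : 'rV[R]_m -> R) (x y : 'rV[R]_m) (i j : 'I_m) (s a : R).
Local Notation e_ i := (delta_mx 0 i : 'rV[R]_m).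

Definition upd i s x : 'rV[R]_m := \row_j if j == i then s else x 0 j.

Lemma updE i s x j : upd i s x 0 j = if j == i then s else x 0 j.
Proof. by rewrite mxE. Qed.

Lemma upd_id i x : upd i (x 0 i) x = x.
Proof. by apply/rowP => j; rewrite updE; case: eqP => // ->. Qed.

Lemma upd_line i j s (t : R) x : upd i s (x + t *: e_ j) = upd i s x + ((j != i)%:R * t) *: e_ j.
Proof.
apply/rowP => l; rewrite !mxE eqxx /=; case: (l =P i) => [->|/eqP li].
  by rewrite (eq_sym i); case: eqP; rewrite ?(mulr0, mul0r, addr0).
case: (l =P j) => [<-|_]; first by rewrite li mul1r.
by rewrite !mulr0.
Qed.

Lemma upd_free i s (t : R) x : upd i (s + t) x = upd i s x + t *: e_ i.
Proof.
apply/rowP => l; rewrite !mxE eqxx /=; case: (l =P i) => _; first by rewrite mulr1.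
by rewrite mulr0 addr0.
Qed.

Lemma upd_continuous psi i s : continuous psi -> continuous (fun x => psi (upd i s x)).
Proof.
move=> pc x; apply/(@cvgrPdist_lt _ _ _ (nbhs x) _) => e e0; rewrite near_simpl.
have [d d0 hd] := continuous_near (upd i s x) pc e0; apply/nbhs_normP.
exists d => // y /= xy; rewrite distrC; apply: hd; apply: le_lt_trans xy.
apply: norm_le_coord => // j; rewrite distrC !mxE; case: (j == i); first by rewrite subrr normr0.
by have := coord_le_norm (y - x) j; rewrite !mxE.
Qed.

Lemma upd_is_derive psi i j s x : sm psi ->
  is_derive x (e_ j) (fun x => psi (upd i s x)) ((j != i)%:R * pd j psi (upd i s x)).
Proof.
move=> h; apply/is_derive_line0; under eq_fun do rewrite upd_line.
case: (j != i); last first.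
  by under eq_fun do rewrite mul0r scale0r addr0; rewrite mul0r; exact: is_derive_cst.
by under eq_fun do rewrite mul1r; rewrite mul1r; apply/is_derive_line0; exact: sm_is_derive.
Qed.

(* The i-th variable of psi is frozen at s and replaced by a Gaussian factor. *)
Definition freeze a i s l psi : 'rV[R]_m -> R :=
  fun x => psi (upd i s x) * kern a l (x 0 i - s).

Lemma coord_is_derive i j x : is_derive x (e_ j) (fun x : 'rV[R]_m => x 0 i) ((i == j)%:R).
Proof.
apply/is_derive_line0.
rewrite (_ : (fun s : R => _) = fun s : R => x 0 i + s * (i == j)%:R); last first.
  by apply/funext => s; rewrite !mxE eqxx.
rewrite [X in is_derive _ _ _ X](_ : _ = 0 + (i == j)%:R * 1); last by rewrite add0r mulr1.
apply: is_deriveD; under eq_fun do rewrite mulrC; apply: is_deriveZ_fun.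
Qed.

Lemma freeze_is_derive a i s l psi j x : sm psi ->
  is_derive x (e_ j) (freeze a i s l psi)
   (if j == i then freeze a i s l.+1 psi x else freeze a i s l (pd j psi) x).
Proof.
move=> h.
have hk : is_derive x (e_ j) (fun x => kern a l (x 0 i - s)) (kern a l.+1 (x 0 i - s) * ((i == j)%:R - 0)).
  apply: (@is_derive_chain _ _ (fun x : 'rV[R]_m => x 0 i - s) _ _ _ (kern a l)); last exact: kern_derive.
  by apply: is_deriveB; exact: coord_is_derive.
have := is_deriveM_fun (upd_is_derive i j s x h) hk.
congr is_derive; rewrite /freeze (eq_sym i); case: eqP => _ /=.
  by rewrite !mul0r mulr0 addr0 subr0 mulr1.
by rewrite subr0 !mulr0 add0r mul1r mulrC.
Qed.

Lemma freeze_continuous a i s l psi : continuous psi -> continuous (freeze a i s l psi).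
Proof.
move=> pc; apply: contM; first exact: upd_continuous.
have kc : continuous (kern a l).
  by move=> y; apply/differentiable_continuous/derivable1_diffP; case: (kern_derive a l y).
apply: (cont_comp (f := fun x : 'rV[R]_m => x 0 i - s) _ kc).
apply: (@contD _ _ (fun x : 'rV[R]_m => x 0 i) (fun=> - s)); last exact: cont_cst.
exact: coord_continuous.
Qed.

Lemma sm_freeze a i s l psi : sm psi -> sm (freeze a i s l psi).
Proof.
move=> h; apply: (@sm_class _ _ (fun f => exists l' phi, sm phi /\ f = freeze a i s l' phi) _ _ _).1.
  move=> _ [l' [phi [hphi ->]]]; split; first exact/freeze_continuous/sm_cont.
  move=> j; exists (if j == i then freeze a i s l'.+1 phi else freeze a i s l' (pd j phi)).
    case: eqP => _; first by exists l'.+1, phi.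
    by exists l', (pd j phi); split => //; exact: (sm_pds [:: j]).
  by move=> x; have := freeze_is_derive a i s l' j x hphi; case: (j == i).
by exists l, psi.
Qed.

Lemma pds_freeze a i s l psi t : sm psi -> pds t (freeze a i s l psi) =
  freeze a i s (count_mem i t + l) (pds [seq j <- t | j != i] psi).
Proof.
move=> h; elim: t => //= j t ->; apply: pd_val => x.
have := freeze_is_derive a i s (count_mem i t + l) j x (sm_pds [seq j <- t | j != i] h).
by case: (j == i).
Qed.

Lemma norm_upd i s x : `|x| <= `|upd i s x| + `|x 0 i - s|.
Proof.
apply: norm_le_coord => [|j]; first exact: addr_ge0.
have [->|ji] := eqVneq j i; last first.
  by apply: le_trans (_ : `|upd i s x 0 j| <= _); [rewrite updE (negPf ji)|rewrite (le_trans (coord_le_norm _ _)) // lerDl].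
have := coord_le_norm (upd i s x) i; rewrite updE eqxx => h.
by rewrite -{1}(subrK s (x 0 i)) addrC; apply: le_trans (ler_normD _ _) _; rewrite lerD2r.
Qed.

Lemma freeze_bound a i s l psi k C M :
  (forall y : R, wt y ^+ k * `|kern a l y| <= C) -> bd k [::] psi M ->
  bd k [::] (freeze a i s l psi) (M * C).
Proof.
move=> hC hM x; have hx := hM (upd i s x); have hk := hC (x 0 i - s).
rewrite /= /freeze normrM in hx *; move: hx hk (normr_ge0 (psi (upd i s x))) (normr_ge0 (kern a l (x 0 i - s))).
move: `|psi _| `|kern _ _ _| => F K hx hk F0 K0.
apply: le_trans (_ : ((1 + `|upd i s x|) ^+ k * F) * (wt (x 0 i - s) ^+ k * K) <= _); last first.
  by apply: ler_pM; rewrite ?mulr_ge0 ?wtX_ge0 ?exprn_ge0 ?addr_ge0.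
rewrite mulrACA ler_wpM2r ?mulr_ge0 // -exprMn lerXn2r ?nnegrE ?mulr_ge0 ?addr_ge0 ?(ltW (wt_gt0 _)) //.
have := norm_upd i s x; rewrite /wt; have := mulr_ge0 (normr_ge0 (upd i s x)) (normr_ge0 (x 0 i - s)); lra.
Qed.

Lemma sz_freeze a i s l psi : 0 < a -> sz psi -> sz (freeze a i s l psi).
Proof.
move=> a0 [h H]; split; first exact: sm_freeze.
move=> k t; have [M hM] := H k [seq j <- t | j != i].
have [C C0 hC] := kern_decay (count_mem i t + l) k a0.
exists (M * C) => x; rewrite pds_freeze //.
exact: (freeze_bound (psi := pds [seq j <- t | j != i] psi) i s hC hM).
Qed.

(** The one-variable approximation is applied on each line of direction i to psi and to its
    derivatives in the other variables; decay in those variables is carried by the bound M / V^k. *)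
Lemma freeze_approx i psi k eta : 0 < eta -> sz psi -> exists2 a, 0 < a &
  exists cs : seq (R * R), szball k eta (fun x => psi x - \sum_(p <- cs) p.1 * freeze a i p.2 0 psi x).
Proof.
(* k + 2 derivatives and powers of the weight go to the variable i, and k to the others. *)
move=> eta0 [h H]; pose K := (k + k).+2.
have [M hM] := exists_szball K (conj h H); have M0 := szball_ge0 hM.
have e0 : 0 < eta / (M + 1) by rewrite divr_gt0 // ltr_wpDl.
have [a a0 [cs hcs]] := gaussian_sum1 k k e0.
exists a => //; exists cs => t tk x.
set w := [seq j <- t | j != i]; set l := count_mem i t.
have tp : perm_eq t (nseq l i ++ w).
  have -> : nseq l i = [seq j <- t | j == i].
    by rewrite /l; elim: (t) => //= j t' <-; case: eqP => [->|].
  by rewrite perm_sym; apply/permPl; exact: (perm_filterC (fun j => j == i) t).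
have lk : (l <= k)%N by apply: leq_trans tk; exact: count_size.
have wk : (size w <= k)%N by apply: leq_trans tk; rewrite size_filter count_size.
have hsum := pds_sum cs (fun p => p.1) t (fun p => sm_freeze a i p.2 0 h).
have -> : pds t (fun x => psi x - \sum_(p <- cs) p.1 * freeze a i p.2 0 psi x) =
    fun x => pds t psi x - \sum_(p <- cs) p.1 * freeze a i p.2 l (pds w psi) x.
  rewrite (_ : (fun x => psi x - _) = fun x => -1 * (\sum_(p <- cs) p.1 * freeze a i p.2 0 psi x) + psi x).
    rewrite pds_lin //; last exact: hsum.1.
    apply/funext => y; rewrite hsum.2 mulN1r addrC; congr (_ - _).
    by apply: eq_bigr => p _; rewrite pds_freeze // addn0.
  by apply/funext => y; rewrite mulN1r addrC.
pose g r s := pds (nseq r i ++ w) psi (upd i s x).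
set V := 1 + `|upd i 0 x|; have V1 : 1 <= V by rewrite lerDl.
have V0 : 0 < V ^+ k by rewrite exprn_gt0 // (lt_le_trans ltr01).
have gd r (y : R) : is_derive y 1 (g r) (g r.+1 y).
  have E r' : g r' = fun s => pds (nseq r' i ++ w) psi (upd i 0 x + s *: e_ i).
    by apply/funext => s; rewrite -upd_free add0r.
  rewrite !E; apply: (@is_derive_line _ _ (pds (nseq r i ++ w) psi) (upd i 0 x) (e_ i)).
  exact/sm_is_derive/sm_pds.
have gM r : (r <= k.+2)%N -> forall y : R, wt y ^+ k.+2 * `|g r y| <= M / V ^+ k.
  move=> rk y; rewrite ler_pdivlMr // mulrAC.
  apply: le_trans (hM (nseq r i ++ w) _ (upd i y x)); last first.
    by rewrite size_cat size_nseq; exact: leq_add rk wk.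
  rewrite ler_wpM2r // /K -[(k + k).+2]/(k.+2 + k)%N exprD; apply: ler_pM; rewrite ?wtX_ge0 ?(ltW V0) //.
    apply: lerXn2r; rewrite ?nnegrE ?addr_ge0 // lerD2l.
    by apply: le_trans (coord_le_norm _ i); rewrite updE eqxx.
  apply: lerXn2r; rewrite ?nnegrE ?addr_ge0 // lerD2l; apply: norm_le_coord => // j.
  rewrite updE; case: eqP => [_|/eqP ji]; first by rewrite normr0.
  by apply: le_trans (coord_le_norm _ j); rewrite updE (negPf ji).
have := hcs _ g gd gM l lk (x 0 i).
have -> : g l (x 0 i) = pds t psi x by rewrite /g upd_id; congr (_ x); apply/esym/pds_perm.
rewrite (eq_bigr (fun p => p.1 * freeze a i p.2 l (pds w psi) x)); last first.
  by move=> p _; rewrite /freeze mulrA.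
rewrite distrC; move: (_ - _) => Z.
rewrite mulrA ler_pdivlMr // => hZ.
apply: le_trans (_ : wt (x 0 i) ^+ k * `|Z| * V ^+ k <= _).
  rewrite [leRHS]mulrAC ler_wpM2r // -exprMn.
  apply: lerXn2r; rewrite ?nnegrE ?mulr_ge0 ?addr_ge0 ?(ltW (wt_gt0 _)) //.
  have := norm_upd i 0 x; rewrite subr0 /wt /V.
  by have := mulr_ge0 (normr_ge0 (upd i 0 x)) (normr_ge0 (x 0 i)); lra.
apply: le_trans hZ _; rewrite mulrAC ler_pdivrMr ?ltr_wpDl //.
by rewrite ler_wpM2l ?(ltW eta0) // lerDl.
Qed.

Definition frozen (l : seq ('I_m * R * R)) psi :=
  foldr (fun p f => freeze p.1.2 p.1.1 p.2 0 f) psi l.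

Lemma sz_frozen l psi : all (fun p => 0 < p.1.2) l -> sz psi -> sz (frozen l psi).
Proof. by elim: l => //= p l IH /andP[p0 l0] h; exact: sz_freeze (IH l0 h). Qed.

Lemma frozenE l psi : uniq [seq p.1.1 | p <- l] -> exists U : 'rV[R]_m -> 'rV[R]_m,
  (forall x y, (forall i, i \notin [seq p.1.1 | p <- l] -> x 0 i = y 0 i) -> U x = U y) /\
  forall x, frozen l psi x = psi (U x) * expR (- \sum_(p <- l) p.1.2 * (x 0 p.1.1 - p.2) ^+ 2).
Proof.
elim: l => [_|[[i a] s] l IH /= /andP[il ul]].
  exists id; split=> [x y xy|x]; first by apply/rowP => i; exact: xy.
  by rewrite big_nil oppr0 expR0 mulr1.
have [U [hU IHl]] := IH ul; exists (U \o upd i s); split=> [x y xy|x] /=.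
  apply: hU => j jl; rewrite !updE; case: eqP => // /eqP ji; apply: xy.
  by rewrite inE negb_or ji.
rewrite /freeze IHl big_cons opprD expRD kern0 /= mulrA mulrAC; congr (_ * _ * expR (- _)).
apply: eq_big_seq => p pl; rewrite updE ifN //; apply: contraNneq il => <-.
by apply/mapP; exists p.
Qed.

(** Induction on the number of variables left: a function with some frozen variables is a limit of
    combinations of functions with one more frozen, on which u vanishes. *)
Theorem gaussian_density (u : ('rV[R]_m -> R) -> R) : tempR u ->
  (forall (c : R) (a y : 'I_m -> R), (forall i, 0 < a i) ->
     u (fun x => c * expR (- \sum_i a i * (x 0 i - y i) ^+ 2)) = 0) ->
  forall psi, sz psi -> u psi = 0.
Proof.
move=> hu ug psi hpsi.
have full0 l : uniq [seq p.1.1 | p <- l] -> all (fun p => 0 < p.1.2) l ->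
    [forall i, i \in [seq p.1.1 | p <- l]] -> u (frozen l psi) = 0.
  move=> ul l0 /forallP full; have [U [hU hl]] := frozenE psi ul.
  pose t i := nth (i, 1, 0) l (index i [seq p.1.1 | p <- l]).
  have tl i : t i \in l by rewrite mem_nth // -(size_map (fun p => p.1.1)) index_mem.
  have tE p : p \in l -> t p.1.1 = p.
    move=> pl; rewrite /t -[in index _ _](nth_index (p.1.1, 1, 0) pl).
    rewrite -(nth_map _ p.1.1 (fun p => p.1.1)) ?index_mem // index_uniq ?size_map ?index_mem //.
    exact: nth_index.
  rewrite (_ : frozen l psi = fun x => psi (U 0) *
      expR (- \sum_i (t i).1.2 * (x 0 i - (t i).2) ^+ 2)); last first.
    apply/funext => x; rewrite hl; congr (psi _ * expR (- _)).
      by apply: hU => i; rewrite full.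
    rewrite (perm_big [seq p.1.1 | p <- l]) /= ?big_map; last first.
      by apply: uniq_perm => // [|i]; rewrite ?index_enum_uniq // mem_index_enum full.
    by apply: eq_big_seq => p pl; rewrite tE.
  by apply: ug => i; exact: (allP l0).
suff H k l : (m - size l <= k)%N -> uniq [seq p.1.1 | p <- l] -> all (fun p => 0 < p.1.2) l ->
    u (frozen l psi) = 0 by apply: (H m [::]); rewrite //= subn0.
elim: k l => [|k IH] l lk ul l0.
  have [full|] := boolP [forall i, i \in [seq p.1.1 | p <- l]]; first exact: full0.
  move=> /forallPn[i il]; have /card_uniqP hc : uniq (i :: [seq p.1.1 | p <- l]) by rewrite /= il.
  by have := max_card (mem (i :: [seq p.1.1 | p <- l])); rewrite hc /= size_map card_ord => hm; move: lk; rewrite leqn0 subn_eq0 leqNgt hm.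
have [full|] := boolP [forall i, i \in [seq p.1.1 | p <- l]]; first exact: full0.
move=> /forallPn[i il].
apply: (tempR_eq0 hu); first exact: sz_frozen.
move=> K e e0; have [a a0 [cs hcs]] := freeze_approx i K e0 (sz_frozen l0 hpsi).
have hs (p : R * R) : sz (frozen ((i, a, p.2) :: l) psi) by apply: sz_frozen => //=; rewrite a0.
exists (fun x => \sum_(p <- cs) p.1 * frozen ((i, a, p.2) :: l) psi x); split => //.
  exact: (sz_sum cs _ hs).
rewrite (tempR_sum hu cs _ hs) big1 // => p _; rewrite IH ?mulr0 //= ?il ?a0 //.
by rewrite subnS; case: (m - _)%N lk.
Qed.

End Freezing.

(** * Vanishing of functionals with the symmetries of an odd functional *)

Section Moments.
Variables (R : realType) (L : finType).
Local Notation m := #|L|.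
Local Notation poly := (pexp R ('I_m + bool)).
Local Notation env0 := (env (@par0 R) 0).
Local Notation gauss0 P Q := (gauss (@par0 R) P Q 0).
Variable u : ('rV[R]_m -> R) -> R.
Hypothesis hu : tempR u.
Implicit Types (P Q : poly) (x : 'rV[R]_m) (l : L) (w : seq L).

(** Half the squared Euclidean norm, which the rotations preserve; [|x|] is the sup norm, hence the
    comparison below. *)
Definition quad : poly :=
  PM (PC 2^-1) (psum (enum 'I_m) (fun i => PM (PX (inl i)) (PX (inl i)))).

Lemma ev_quad (r : 'I_m + bool -> R) : ev r quad = 2^-1 * \sum_i r (inl i) ^+ 2.
Proof. by rewrite /= ev_psum big_enum; congr (_ * _); apply: eq_bigr. Qed.

Lemma norm_le_sum_sqr x : `|x| ^+ 2 <= \sum_i x 0 i ^+ 2.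
Proof.
have S0 : 0 <= \sum_i x 0 i ^+ 2 by apply: sumr_ge0 => i _; exact: sqr_ge0.
rewrite -[leRHS](sqr_sqrtr S0); apply: lerXn2r; rewrite ?nnegrE ?sqrtr_ge0 //.
apply: norm_le_coord => [|i]; first exact: sqrtr_ge0.
rewrite -sqrtr_sqr ler_wsqrtr // (bigD1 i) //= lerDl; apply: sumr_ge0 => j _; exact: sqr_ge0.
Qed.

Lemma quad_ge x : 2^-1 * `|x| ^+ 2 - 0 <= ev (env0 x) quad.
Proof. by rewrite subr0 ev_quad ler_wpM2l // norm_le_sum_sqr. Qed.

Lemma coercive_quad : coercive0 quad.
Proof. by exists 2^-1, 0; split => // x; exact: quad_ge. Qed.

Definition moment P : R := u (gauss0 P quad).

Lemma moment_ext P P' : (forall x, ev (env0 x) P = ev (env0 x) P') -> moment P = moment P'.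
Proof. by move=> PP; congr u; exact: gauss0_ext. Qed.

Lemma momentD P P' : moment (PA P P') = moment P + moment P'.
Proof.
rewrite /moment -tempRD //; try exact: (sz_gauss0 _ coercive_quad).
by congr u; apply/funext => x; rewrite /gauss /= mulrDl.
Qed.

Lemma momentZ c P : moment (PM (PC c) P) = c * moment P.
Proof.
rewrite /moment -tempRZ //; last exact: (sz_gauss0 _ coercive_quad).
by congr u; apply/funext => x; rewrite /gauss /= mulrA.
Qed.

Lemma moment0 : moment (PC 0) = 0.
Proof.
have := momentZ 0 (PC 0); rewrite mul0r; apply: etrans.
by apply: moment_ext => x /=; rewrite mul0r.
Qed.

Definition wordp w : poly := foldr (fun l P => PM (PX (inl (enum_rank l))) P) (PC 1) w.
Definition wmoment w : R := moment (wordp w).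

Lemma ev_wordp r w : ev r (wordp w) = \prod_(l <- w) r (inl (enum_rank l)).
Proof. by elim: w => [|l w IH] /=; rewrite ?big_nil ?big_cons ?IH. Qed.

Lemma wmoment_sym w w' : perm_eq w w' -> wmoment w = wmoment w'.
Proof. by move=> ww'; apply: moment_ext => x; rewrite !ev_wordp; exact: perm_big. Qed.

Lemma wmoment_eq0 : (forall w, wmoment w = 0) -> forall P, moment P = 0.
Proof.
move=> h P.
(* Generalized over a cofactor P' and a monomial, so that a product in P is treated by composing the
   two induction hypotheses. *)
suff H P' : (forall w, moment (PM (wordp w) P') = 0) -> forall w, moment (PM (wordp w) (PM P P')) = 0.
  have := H (PC 1) _ [::]; rewrite (@moment_ext _ P); last by move=> x /=; rewrite mul1r mulr1.
  by apply=> w; rewrite -(h w); apply: moment_ext => x /=; rewrite mulr1.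
elim: P P' => [c|[i|b]|p IHp q IHq|p IHp q IHq] P' h' w.
- rewrite -[RHS](mulr0 c) -(h' w) -momentZ; apply: moment_ext => x /=; ring.
- rewrite -(h' (enum_val i :: w)); apply: moment_ext => x /=; rewrite enum_valK; ring.
- rewrite -moment0; apply: moment_ext => x; rewrite /= /par0; ring.
- rewrite -[RHS]addr0 -{1}(IHp P' h' w) -(IHq P' h' w) -momentD; apply: moment_ext => x /=; ring.
- rewrite -(IHp (PM q P') (IHq P' h') w); apply: moment_ext => x /=; ring.
Qed.

Definition shifted (a y : 'I_m -> R) : poly := psum (enum 'I_m) (fun i =>
  PM (PC (a i)) (PM (PA (PX (inl i)) (PC (- y i))) (PA (PX (inl i)) (PC (- y i))))).

Lemma ev_shifted a y x : ev (env0 x) (shifted a y) = \sum_i a i * (x 0 i - y i) ^+ 2.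
Proof. by rewrite ev_psum big_enum; apply: eq_bigr => i _ /=; rewrite expr2. Qed.

Lemma eq0_of_wmoment : (forall w, wmoment w = 0) -> forall psi, sz psi -> u psi = 0.
Proof.
move=> /wmoment_eq0 h; apply: (gaussian_density hu) => c a y a0.
(* b is at most 1/2 and at most every a i, so that b / 2 is a coercivity constant for both quadratic
   functions. C absorbs the shift, by a (x - y)^2 >= a x^2 / 2 - a y^2. *)
pose b := (2 + \sum_i (a i)^-1)^-1; pose C := \sum_i a i * y i ^+ 2.
have sa0 : 0 <= \sum_i (a i)^-1 by apply: sumr_ge0 => i _; rewrite invr_ge0 ltW.
have D0 : 0 < 2 + \sum_i (a i)^-1 by rewrite ltr_pwDl.
have b0 : 0 < b by rewrite invr_gt0.
have b2 : b <= 2^-1 by rewrite lef_pV2 ?posrE // lerDl.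
have ba i : b <= a i.
  rewrite -(invrK (a i)) lef_pV2 ?posrE ?invr_gt0 // (bigD1 i) //= addrCA lerDl.
  by rewrite addr_ge0 // sumr_ge0 // => j _; rewrite invr_ge0 ltW.
have C0 : 0 <= C by apply: sumr_ge0 => i _; rewrite mulr_ge0 ?sqr_ge0 // ltW.
pose B := \sum_i (2^-1 + 2 * a i + 2 * a i * y i ^+ 2).
have hP := @path_kill R m u quad (shifted a y) (b / 2) C B hu _ _ _ _ h.
apply: etrans (hP _ _ _ _ (PC c)).
- by congr u; apply/funext => x; rewrite /gauss ev_shifted.
- by rewrite divr_gt0.
- move=> x; apply: le_trans (quad_ge x); rewrite subr0.
  have := ler_wpM2r (sqr_ge0 `|x|) b2; have := mulr_ge0 (ltW b0) (sqr_ge0 `|x|); lra.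
- move=> x; rewrite ev_shifted; apply: le_trans (_ : b / 2 * (\sum_i x 0 i ^+ 2) - C <= _).
    by rewrite lerD2r ler_wpM2l ?divr_ge0 ?(ltW b0) // norm_le_sum_sqr.
  rewrite mulr_sumr /C -sumrB; apply: ler_sum => i _.
  have h1 : b / 2 * x 0 i ^+ 2 <= a i / 2 * x 0 i ^+ 2.
    by rewrite ler_wpM2r ?sqr_ge0 // ler_wpM2r.
  have h2 : 0 <= a i * (x 0 i - 2 * y i) ^+ 2 by rewrite mulr_ge0 ?sqr_ge0 // ltW.
  nra.
- move=> x; rewrite ev_quad ev_shifted mulr_sumr -sumrB mulr_suml.
  apply: le_trans (ler_norm_sum _ _ _) _; apply: ler_sum => i _ /=.
  have hx : x 0 i ^+ 2 <= `|x| ^+ 2.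
    by rewrite -real_normK ?num_real // lerXn2r ?nnegrE // coord_le_norm.
  have h1 := sqr_ge0 (x 0 i + y i); have h2 := sqr_ge0 (x 0 i - y i).
  have h3 := sqr_ge0 (y i); have h4 := sqr_ge0 (x 0 i); have h5 := a0 i.
  move: (`|x| ^+ 2) hx => X hx.
  have k1 : a i * (x 0 i - y i) ^+ 2 <= a i * (2 * X + 2 * y i ^+ 2).
    rewrite ler_wpM2l ?(ltW h5) //; nra.
  have k2 : 0 <= a i * (x 0 i - y i) ^+ 2 by rewrite mulr_ge0 // ltW.
  have X0 : 0 <= X by lra.
  have k5 : 0 <= a i * y i ^+ 2 by exact: mulr_ge0 (ltW h5) h3.
  have k3 : 0 <= a i * y i ^+ 2 * X by exact: mulr_ge0.
  have k4 : 0 <= a i * X by exact: mulr_ge0 (ltW h5) X0.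
  move: (a i * (x 0 i - y i) ^+ 2) k1 k2 => Z k1 k2; rewrite ler_norml; apply/andP; split; lra.
Qed.

End Moments.

(** * Differentiated invariance in terms of moments *)

Section Flow.
Variables (R : realType) (L : finType).
Local Notation m := #|L|.
Local Notation poly := (pexp R ('I_m + bool)).
Local Notation env0 := (env (@par0 R) 0).
Local Notation gauss0 P Q := (gauss (@par0 R) P Q 0).
Local Notation X l := (PX (inl (enum_rank l)) : poly).
Variable u : ('rV[R]_m -> R) -> R.
Hypothesis hu : tempR u.
Variables (par : bool -> R -> R) (dpar : bool -> poly).
Hypothesis par_derive : forall b (s : R) r, (forall b', r (inr b') = par b' s) ->
  is_derive s 1 (par b) (ev r (dpar b)).
Variable Kpar : R.
Hypothesis par_bound : forall b s, `|s| <= 1 -> `|par b s| <= Kpar.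
Hypothesis dpar_x : forall i b r, ev r (pder (dx i) (dpar b)) = 0.
Variable g : L -> poly.
Implicit Types (P Q : poly) (x : 'rV[R]_m) (l : L) (w : seq L).

Definition flow s x : 'rV[R]_m := \row_i ev (env par s x) (g (enum_val i)).

Hypothesis flow0 : forall x, flow 0 x = x.
Variable Kflow : R.
Hypothesis flow_ge : forall s x, `|s| <= 1 -> `|x| <= Kflow * `|flow s x|.
Hypothesis flow_inv : forall s psi, `|s| <= 1 -> sz psi -> u (fun x => psi (flow s x)) = u psi.

Fixpoint psubst P : poly :=
  match P with
  | PC c => PC c
  | PX (inl i) => g (enum_val i)
  | PX (inr b) => PC 0
  | PA p q => PA (psubst p) (psubst q)
  | PM p q => PM (psubst p) (psubst q)
  end.

Lemma ev_psubst s x P : ev (env par s x) (psubst P) = ev (env0 (flow s x)) P.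
Proof. by elim: P => [c|[i|b]|p IHp q IHq|p IHp q IHq] //=; rewrite ?mxE ?IHp ?IHq. Qed.

Lemma gauss_psubst P Q s : gauss par (psubst P) (psubst Q) s = fun x => gauss0 P Q (flow s x).
Proof. by apply/funext => x; rewrite /gauss !ev_psubst. Qed.

(** By [flow_ge] the flow shrinks norms by a bounded factor at most, so the transported quadratic
    form still dominates |x|^2. *)
Lemma coercive_psubst : coercive par (psubst (quad R L)).
Proof.
have K0 : 0 < 1 + Kflow ^+ 2 by rewrite ltr_pwDl // sqr_ge0.
exists (2^-1 / (1 + Kflow ^+ 2)), 0; split; first by rewrite divr_gt0.
move=> s x hs; rewrite ev_psubst; apply: le_trans (quad_ge (flow s x)).
rewrite !subr0 mulrAC ler_pdivrMr // -mulrA ler_wpM2l //.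
have := flow_ge x hs => /(lerXn2r 2); rewrite !nnegrE normr_ge0 => /(_ isT).
rewrite (le_trans (normr_ge0 _) (flow_ge x hs)) => /(_ isT); rewrite exprMn.
have := sqr_ge0 `|flow s x|; lra.
Qed.

Variable D : L -> seq (R * L).
Hypothesis gD : forall l x, ev (env par 0 x) (pder (ds dpar) (g l)) =
  \sum_(p <- D l) p.1 * x 0 (enum_rank p.2).

Definition field (v : 'I_m + bool) : poly :=
  if v is inl i then psum (D (enum_val i)) (fun p => PM (PC p.1) (X p.2)) else PC 0.

Lemma ev_field x i : ev (env0 x) (field (inl i)) = \sum_(p <- D (enum_val i)) p.1 * x 0 (enum_rank p.2).
Proof. by rewrite ev_psum. Qed.

Lemma ev_pder_psum (I : Type) (s : seq I) (p : I -> poly) d r :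
  ev r (pder d (psum s p)) = \sum_(i <- s) ev r (pder d (p i)).
Proof. by elim: s => [|i s IH] /=; rewrite ?big_nil ?big_cons ?IH. Qed.

Lemma ev_pder_psubst x P :
  ev (env par 0 x) (pder (ds dpar) (psubst P)) = ev (env0 x) (pder field P).
Proof.
elim: P => [c|[i|b]|p IHp q IHq|p IHp q IHq] //.
- by rewrite [LHS]gD -ev_field.
- by rewrite /= IHp IHq.
- by rewrite /= !ev_psubst flow0 IHp IHq.
Qed.

(** The invariance differentiated at s = 0: along the flow, the derivative in s acts on polynomials
    as the vector field [field]. *)
Lemma moment_field P : moment u (pop field (quad R L) P) = 0.
Proof.
rewrite -[RHS](gauss_lie par_derive par_bound dpar_x (P := psubst P) hu coercive_psubst).
  congr u; apply/funext => x; rewrite /gauss ev_psubst flow0 /=.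
  by rewrite !ev_pder_psubst !ev_psubst flow0.
have h s : `|s| <= 1 -> u (gauss par (psubst P) (psubst (quad R L)) s) = moment u P.
  by move=> hs; rewrite gauss_psubst flow_inv //; exact: (sz_gauss0 _ (coercive_quad R L)).
by move=> s hs; rewrite !h // normr0.
Qed.

Lemma der_moment w P0 : der D (fun v => moment u (PM P0 (wordp R v))) w =
  moment u (PM P0 (pder field (wordp R w))).
Proof.
elim: w P0 => [|l w IH] P0 /=.
  have := moment0 hu; move=> e; apply: etrans (esym e) _; apply: moment_ext => x /=; ring.
rewrite -[RHS]/(moment u (PM P0 (PA (PM (X l) (pder field (wordp R w))) (PM (wordp R w) (field (inl (enum_rank l))))))).
rewrite (@moment_ext _ _ u _ (PA (PM (PM P0 (wordp R w)) (field (inl (enum_rank l))))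
  (PM (PM P0 (X l)) (pder field (wordp R w))))); last by move=> x /=; ring.
rewrite (momentD hu) -IH; congr (_ + _); last first.
  by apply: eq_der => v; apply: moment_ext => x /=; ring.
rewrite /= enum_rankK; elim: (D l) => [|p r IHr].
  rewrite big_nil; apply: etrans (esym (moment0 hu)) _; apply: moment_ext => x /=; ring.
rewrite big_cons IHr -(momentZ hu) -(momentD hu); apply: moment_ext => x /=; ring.
Qed.

(** The field differentiates both factors of a monomial times the Gaussian: the monomial yields the
    derivation of words, and the Gaussian yields E, the field applied to the quadratic form. *)
Lemma der_wmoment w E :
  (forall x, ev (env0 x) E = \sum_l x 0 (enum_rank l) * \sum_(p <- D l) p.1 * x 0 (enum_rank p.2)) ->
  der D (wmoment u) w = moment u (PM (wordp R w) E).
Proof.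
move=> hE.
have -> : der D (wmoment u) w = der D (fun v => moment u (PM (PC 1) (wordp R v))) w.
  by apply: eq_der => v; apply: moment_ext => x /=; rewrite mul1r.
apply/eqP; rewrite der_moment -subr_eq0 -mulN1r -(momentZ hu) -(momentD hu); apply/eqP.
rewrite -[RHS](moment_field (wordp R w)); apply: moment_ext => x.
suff qE : ev (env0 x) (pder field (quad R L)) = ev (env0 x) E.
  by rewrite /pop /= in qE *; rewrite qE; ring.
rewrite hE /= ev_pder_psum mulr0 addr0 big_enum mulr_sumr.
rewrite (reindex (fun l => enum_rank l)) /=; last first.
  by exists enum_val => i _; rewrite ?enum_rankK ?enum_valK.
apply: eq_bigr => l _; rewrite ev_psum enum_rankK /=.
by field.
Qed.

End Flow.

Section TwoRows.
Variables (R : realType) (T K : finType).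
Local Notation L := (T * K)%type.
Local Notation m := #|{: L}|.
Local Notation poly := (pexp R ('I_m + bool)).
Local Notation env0 := (env (@par0 R) 0).
Local Notation X l := (PX (inl (enum_rank (l : L))) : poly).

Definition lmap (F : (L -> R) -> L -> R) (x : 'rV[R]_m) : 'rV[R]_m :=
  \row_i F (fun l => x 0 (enum_rank l)) (enum_val i).

(* For [sw = id], rotations ([eb = 1], [ec = -1]) and boosts ([eb = ec = 1]) in the plane of
   the rows b and c; exchanging real and imaginary parts with [sw] gives imaginary angles. *)
Definition two_row (sw : K -> K) (eb ec : K -> R) (b c : T) (C S : R) (z : L -> R) (l : L) : R :=
  if l.1 == b then C * z l + S * (eb l.2 * z (c, sw l.2))
  else if l.1 == c then C * z l + S * (ec l.2 * z (b, sw l.2)) else z l.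

Definition two_rowd (sw : K -> K) (eb ec : K -> R) (b c : T) (l : L) : seq (R * L) :=
  (if l.1 == b then [:: (eb l.2, (c, sw l.2))] else [::]) ++
  (if l.1 == c then [:: (ec l.2, (b, sw l.2))] else [::]).

Lemma sum_row (b : T) (F : L -> R) : \sum_l (l.1 == b)%:R * F l = \sum_k F (b, k).
Proof.
rewrite (eq_bigr (fun l => (l.1 == b)%:R * F (l.1, l.2))); last by case.
rewrite -(pair_bigA _ (fun t k => (t == b)%:R * F (t, k))) /= (bigD1 b) //= [Y in _ + Y]big1 => [|t tb].
  by rewrite addr0; apply: eq_bigr => k _; rewrite eqxx mul1r.
by rewrite big1 // => k _; rewrite (negPf tb) mul0r.
Qed.

Lemma sum_two_rowd sw eb ec b c (l : L) (g : L -> R) : \sum_(p <- two_rowd sw eb ec b c l) p.1 * g p.2 =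
  (l.1 == b)%:R * (eb l.2 * g (c, sw l.2)) + (l.1 == c)%:R * (ec l.2 * g (b, sw l.2)).
Proof.
rewrite /two_rowd big_cat /=.
by case: eqP => _; case: eqP => _; rewrite ?big_seq1 ?big_nil ?mul1r ?mul0r.
Qed.

Variable u : ('rV[R]_m -> R) -> R.
Hypothesis hu : tempR u.
Variables (par : bool -> R -> R) (dpar : bool -> poly).
Hypothesis par_derive : forall b (s : R) r, (forall b', r (inr b') = par b' s) ->
  is_derive s 1 (par b) (ev r (dpar b)).
Variable Kpar : R.
Hypothesis par_bound : forall b s, `|s| <= 1 -> `|par b s| <= Kpar.
Hypothesis dpar_x : forall i b r, ev r (pder (dx i) (dpar b)) = 0.
Variables (pC pS : poly) (C S : R -> R) (eps : R).
Hypothesis pCE : forall s x, ev (env par s x) pC = C s.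
Hypothesis pSE : forall s x, ev (env par s x) pS = S s.
Hypothesis dpC : forall x, ev (env par 0 x) (pder (ds dpar) pC) = 0.
Hypothesis dpS : forall x, ev (env par 0 x) (pder (ds dpar) pS) = 1.
Hypotheses (C0 : C 0 = 1) (S0 : S 0 = 0) (CS : forall s, C s ^+ 2 - eps * S s ^+ 2 = 1).
Hypothesis CS_bound : forall s, `|s| <= 1 -> `|C s| <= Kpar /\ `|S s| <= Kpar.
Variables (sw : K -> K) (eb ec : K -> R).
Hypothesis swK : involutive sw.
Hypothesis ebc : forall k, eb k * ec (sw k) = eps.
Hypotheses (eb1 : forall k, `|eb k| = 1) (ec1 : forall k, `|ec k| = 1).
Variables (b c : T).
Hypothesis bc : b != c.
Hypothesis inv : forall s psi, `|s| <= 1 -> sz psi ->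
  u (fun x => psi (lmap (two_row sw eb ec b c (C s) (S s)) x)) = u psi.

Definition two_rowp (l : L) : poly :=
  if l.1 == b then PA (PM pC (X l)) (PM pS (PM (PC (eb l.2)) (X (c, sw l.2))))
  else if l.1 == c then PA (PM pC (X l)) (PM pS (PM (PC (ec l.2)) (X (b, sw l.2)))) else X l.

Lemma flow_two_row s x : flow par two_rowp s x = lmap (two_row sw eb ec b c (C s) (S s)) x.
Proof.
apply/rowP => i; rewrite !mxE /two_rowp /two_row.
by case: eqP => _; [|case: eqP => _]; rewrite /= ?pCE ?pSE.
Qed.

(** By C^2 - eps S^2 = 1 the inverse is the same map with - S for S, and its coefficients are
    bounded by Kpar. *)
Lemma two_row_ge s x : `|s| <= 1 ->
  `|x| <= 2 * Kpar * `|lmap (two_row sw eb ec b c (C s) (S s)) x|.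
Proof.
move=> hs; set Y := lmap _ x; have [Cs Ss] := CS_bound hs.
have K0 : 0 <= Kpar by apply: le_trans Cs.
pose z (l : L) := x 0 (enum_rank l); pose Z (l : L) := Y 0 (enum_rank l).
have ZE l : Z l = two_row sw eb ec b c (C s) (S s) z l by rewrite /Z mxE enum_rankK.
have Zle l : `|Z l| <= `|Y| by exact: coord_le_norm.
have K1 : 1 <= 2 * Kpar.
  have : `|C 0| <= Kpar by have [] := CS_bound (s := 0) _; rewrite ?normr0.
  by rewrite C0 normr1; lra.
have comb (e : R) l l' : `|e| = 1 -> `|C s * Z l - S s * (e * Z l')| <= 2 * Kpar * `|Y|.
  move=> e1; apply: le_trans (ler_normB _ _) _; rewrite !normrM e1 mul1r -mulrA mulr2n mulrDl mul1r.
  by apply: lerD; apply: ler_pM.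
apply: norm_le_coord => [|i]; first by rewrite mulr_ge0 // mulr_ge0.
rewrite -(enum_valK i) -/(z _); case: (enum_val i) => t k.
have cb : (c == b) = false by rewrite eq_sym (negPf bc).
have [->|tb] := eqVneq t b.
  rewrite (_ : z (b, k) = C s * Z (b, k) - S s * (eb k * Z (c, sw k))); first exact: comb.
  rewrite !ZE /two_row /= !eqxx cb swK; have := CS s; rewrite -(ebc k) => CS'.
  rewrite -[LHS]mul1r -CS'; ring.
have [->|tc] := eqVneq t c.
  rewrite (_ : z (c, k) = C s * Z (c, k) - S s * (ec k * Z (b, sw k))); first exact: comb.
  rewrite !ZE /two_row /= !eqxx cb swK; have := CS s; rewrite -(ebc (sw k)) swK => CS'.
  rewrite -[LHS]mul1r -CS'; ring.
have -> : z (t, k) = Z (t, k) by rewrite ZE /two_row /= (negPf tb) (negPf tc).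
by apply: le_trans (Zle _) _; rewrite ler_peMl.
Qed.

Let two_row_ge' s x : `|s| <= 1 -> `|x| <= 2 * Kpar * `|flow par two_rowp s x|.
Proof. by rewrite flow_two_row; exact: two_row_ge. Qed.

Let inv' s psi : `|s| <= 1 -> sz psi -> u (fun x => psi (flow par two_rowp s x)) = u psi.
Proof. by move=> hs hp; under eq_fun do rewrite flow_two_row; exact: inv. Qed.

Lemma wmoment_sum (I : Type) (r : seq I) (a : I -> R) (v : I -> seq L) w (E : poly) :
  (forall x, ev (env0 x) E = \sum_(i <- r) a i * \prod_(l <- v i) x 0 (enum_rank l)) ->
  moment u (PM (wordp R w) E) = \sum_(i <- r) a i * wmoment u (v i ++ w).
Proof.
move=> hE; rewrite (@moment_ext _ _ u _ (psum r (fun i => PM (PC (a i)) (wordp R (v i ++ w))))).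
  elim: r {hE} => [|i r IH] /=; first by rewrite big_nil moment0.
  by rewrite big_cons (momentD hu) (momentZ hu) IH.
move=> x /=; rewrite hE ev_psum mulr_sumr; apply: eq_bigr => i _ /=.
by rewrite !ev_wordp big_cat /=; ring.
Qed.

(** For rotations the coefficients eb k + ec (sw k) are 0, as the quadratic form is preserved; for
    boosts they are 2 or - 2 and the contraction appears. *)
Lemma two_row_der w : der (two_rowd sw eb ec b c) (wmoment u) w =
  \sum_k (eb k + ec (sw k)) * wmoment u ((b, k) :: (c, sw k) :: w).
Proof.
pose E : poly := psum (enum K) (fun k => PM (PC (eb k + ec (sw k))) (PM (X (b, k)) (X (c, sw k)))).
have flow0 x : flow par two_rowp 0 x = x.
  rewrite flow_two_row C0 S0; apply/rowP => i; rewrite mxE /two_row enum_valK.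
  by case: eqP => _; [|case: eqP => _]; rewrite ?mul1r ?mul0r ?addr0.
have cb : (c == b) = false by rewrite eq_sym (negPf bc).
have gD (l : L) x : ev (env par 0 x) (pder (ds dpar) (two_rowp l)) =
    \sum_(p <- two_rowd sw eb ec b c l) p.1 * x 0 (enum_rank p.2).
  rewrite (sum_two_rowd _ _ _ _ _ _ (fun l => x 0 (enum_rank l))) /two_rowp.
  have [->|tb] := eqVneq l.1 b.
    rewrite /= pCE pSE dpC dpS C0 S0 (eq_sym b) cb. rewrite /=; ring.
  have [_|tc] := eqVneq l.1 c.
    rewrite /= pCE pSE dpC dpS C0 S0. rewrite /=; ring.
  by rewrite /= !mul0r; ring.
have hE x : ev (env0 x) E = \sum_l x 0 (enum_rank l) * \sum_(p <- two_rowd sw eb ec b c l) p.1 * x 0 (enum_rank p.2).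
  pose z (l : L) := x 0 (enum_rank l).
  rewrite (eq_bigr (fun l => (l.1 == b)%:R * (z l * (eb l.2 * z (c, sw l.2)))
     + (l.1 == c)%:R * (z l * (ec l.2 * z (b, sw l.2))))); last first.
    by move=> l _; rewrite (sum_two_rowd _ _ _ _ _ _ z) /z; ring.
  rewrite big_split /= !sum_row /= [Y in _ + Y](reindex_inj (inv_inj swK)) /= -big_split ev_psum big_enum /=.
  by apply: eq_bigr => k _; rewrite swK /z /=; ring.
rewrite (der_wmoment hu par_derive par_bound dpar_x flow0 two_row_ge' inv' gD w hE).
rewrite (wmoment_sum (r := enum K) (a := fun k => eb k + ec (sw k))
    (v := fun k => [:: (b, k); (c, sw k)])) ?big_enum //.
by move=> x; rewrite ev_psum; apply: eq_bigr => k _; rewrite !big_cons big_nil /= mulr1.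
Qed.

End TwoRows.

(** Hyperbolic cosine and sine, polynomial in exp s and exp (- s), which are the two parameters of a
    boost. *)
Definition hcos (R : realType) (s : R) : R := (expR s + expR (- s)) / 2.
Definition hsin (R : realType) (s : R) : R := (expR s - expR (- s)) / 2.

Lemma hcos_hsin (R : realType) (s : R) : hcos s ^+ 2 - hsin s ^+ 2 = 1.
Proof.
have := expRxMexpNx_1 s; rewrite /hcos /hsin; move: (expR s) (expR (- s)) => a b ab; by rewrite -[RHS]ab; field.
Qed.

Section Instances.
Variables (R : realType) (T K : finType).
Local Notation L := (T * K)%type.
Local Notation m := #|{: L}|.
Local Notation poly := (pexp R ('I_m + bool)).
Local Notation env0 := (env (@par0 R) 0).
Variable u : ('rV[R]_m -> R) -> R.
Hypothesis hu : tempR u.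
Variables (sw : K -> K) (eb ec : K -> R).
Hypothesis swK : involutive sw.
Hypotheses (eb1 : forall k, `|eb k| = 1) (ec1 : forall k, `|ec k| = 1).
Variables (b c : T).
Hypothesis bc : b != c.

Lemma rotation_der w : (forall k, eb k * ec (sw k) = -1) ->
  (forall s psi, sz psi -> u (fun x => psi (lmap (two_row sw eb ec b c (cos s) (sin s)) x)) = u psi) ->
  der (two_rowd sw eb ec b c) (wmoment u) w =
  \sum_k (eb k + ec (sw k)) * wmoment u ((b, k) :: (c, sw k) :: w).
Proof.
move=> ebc inv.
pose par (b : bool) (s : R) := if b then cos s else sin s.
pose dpar (b : bool) : poly := if b then PM (PC (-1)) (PX (inr false)) else PX (inr true).
have pd b' (s : R) r : (forall b', r (inr b') = par b' s) -> is_derive s 1 (par b') (ev r (dpar b')).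
  by case: b' => h; rewrite /= h ?mulN1r; [exact: is_derive_cos|exact: is_derive_sin].
have pb b' s : `|s| <= 1 -> `|par b' s| <= 1.
  by case: b' => _; rewrite ler_norml ?cos_geN1 ?cos_le1 ?sin_geN1 ?sin_le1.
have px i b' r : ev r (pder (dx i) (dpar b')) = 0 by case: b' => /=; ring.
apply: (two_row_der hu pd pb px (pC := PX (inr true)) (pS := PX (inr false))
  (C := @cos R) (S := @sin R) (eps := -1)) => //.
- by move=> x /=; rewrite sin0 mulr0.
- by move=> x /=; rewrite cos0.
- exact: cos0.
- exact: sin0.
- by move=> s; rewrite mulN1r opprK cos2Dsin2.
- by move=> s hs; split; [exact: (pb true)|exact: (pb false)].
- by move=> s psi _; exact: inv.
Qed.

Lemma boost_der w : (forall k, eb k * ec (sw k) = 1) ->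
  (forall s psi, sz psi -> u (fun x => psi (lmap (two_row sw eb ec b c (hcos s) (hsin s)) x)) = u psi) ->
  der (two_rowd sw eb ec b c) (wmoment u) w =
  \sum_k (eb k + ec (sw k)) * wmoment u ((b, k) :: (c, sw k) :: w).
Proof.
move=> ebc inv.
pose par (b : bool) (s : R) := if b then expR s else expR (- s).
pose dpar (b : bool) : poly := if b then PX (inr true) else PM (PC (-1)) (PX (inr false)).
have pd b' (s : R) r : (forall b', r (inr b') = par b' s) -> is_derive s 1 (par b') (ev r (dpar b')).
  case: b' => h; rewrite /= h /par; first exact: is_derive_expR.
  rewrite [X in is_derive _ _ _ X](_ : _ = - (1 * expR (- s))); last by ring.
  by apply: exp_is_derive.
have pb b' s : `|s| <= 1 -> `|par b' s| <= expR 1.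
  by rewrite ler_norml => /andP[s1 s2]; case: b'; rewrite ger0_norm ?expR_ge0 // ler_expR //; lra.
have px i b' r : ev r (pder (dx i) (dpar b')) = 0 by case: b' => /=; ring.
apply: (two_row_der hu pd pb px
  (pC := PM (PC 2^-1) (PA (PX (inr true)) (PX (inr false))))
  (pS := PM (PC 2^-1) (PA (PX (inr true)) (PM (PC (-1)) (PX (inr false)))))
  (C := @hcos R) (S := @hsin R) (eps := 1)) => //.
- by move=> s x; rewrite /= /hcos mulrC.
- by move=> s x; rewrite /= /hsin mulN1r mulrC.
- by move=> x /=; rewrite oppr0 expR0; ring.
- by move=> x /=; rewrite oppr0 expR0; field.
- by rewrite /hcos oppr0 expR0; field.
- by rewrite /hsin oppr0 expR0; field.
- by move=> s; rewrite mul1r hcos_hsin.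
- move=> s hs; have := pb true s hs; have := pb false s hs; rewrite /par /hcos /hsin.
  by have := expR_ge0 s; have := expR_ge0 (- s); rewrite !ler_norml; lra.
- by move=> s psi _; exact: inv.
Qed.

Definition flip_row (t : T) (z : L -> R) (l : L) : R := if l.1 == t then - z l else z l.

(** The quadratic form is even, so flipping row t multiplies the weighted monomial by the sign given
    by the number of its letters in that row. *)
Lemma wmoment_odd : (forall t psi, sz psi -> u (fun x => psi (lmap (flip_row t) x)) = - u psi) ->
  wodd (wmoment u).
Proof.
move=> hodd t w cw; have := hodd t _ (sz_gauss0 (wordp R w) (coercive_quad R L)).
rewrite (_ : (fun x => _) = gauss (@par0 R) (wordp R w) (quad R L) 0).
  by rewrite -/(moment u (wordp R w)) -/(wmoment u w); lra.
apply/funext => x; rewrite /gauss !ev_quad !ev_wordp; congr (_ * expR (- (_ * _))).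
  transitivity (\prod_(l <- w) ((-1) ^+ (l.1 == t) * x 0 (enum_rank l))).
    apply: eq_bigr => l _; rewrite /= mxE enum_rankK /flip_row.
    by case: eqP; rewrite ?mulN1r ?mul1r.
  rewrite big_split /= [X in X * _](_ : _ = 1) ?mul1r //.
  transitivity ((-1) ^+ count (fun l => l.1 == t) w : R).
    by elim: (w) => [|l w' IH]; rewrite ?big_nil // big_cons IH -exprD.
  by rewrite -signr_odd (negPf cw).
by apply: eq_bigr => i _; rewrite /= mxE /flip_row enum_valK; case: eqP => // _; rewrite sqrrN.
Qed.

End Instances.

Lemma rotd_same_der (R : realType) (T K : finType) (t : T) (f : seq (T * K) -> R) w :
  der (rotd t t) f w = 0.
Proof.
elim: w f => //= l w IH f; rewrite IH addr0 (sum_rotd _ _ _ (fun p => f (p :: w))).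
by rewrite subrr.
Qed.

Theorem real_vanishing (R : realType) (T0 T1 : finType) n
    (u : ('rV[R]_#|{: (T0 + T1) * 'I_n}| -> R) -> R) : tempR u ->
  (forall b c, b != c -> is_inl b = is_inl c -> forall s psi, sz psi ->
    u (fun x => psi (lmap (two_row id (fun=> 1) (fun=> -1) b c (cos s) (sin s)) x)) = u psi) ->
  (forall a b s psi, sz psi ->
    u (fun x => psi (lmap (two_row id (fun=> 1) (fun=> 1) (inl a) (inr b) (hcos s) (hsin s)) x)) = u psi) ->
  (forall t psi, sz psi -> u (fun x => psi (lmap (flip_row t) x)) = - u psi) ->
  (n < #|T0| + #|T1|)%N -> forall psi, sz psi -> u psi = 0.
Proof.
move=> hu hrot hboost hodd nT; apply: (eq0_of_wmoment hu).
have rot (b c : T0 + T1) w : is_inl b = is_inl c -> der (rotd b c) (wmoment u) w = 0.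
  move=> hbc; have [->|bc] := eqVneq b c; first exact: rotd_same_der.
  (* With these data [two_rowd] is [rotd] up to conversion. *)
  rewrite [LHS](rotation_der hu (sw := id) (eb := fun=> 1) (ec := fun=> -1)) //; last exact: hrot.
  - by rewrite big1 // => k _; rewrite subrr mul0r.
  - by move=> k; rewrite normr1.
  - by move=> k; rewrite normrN1.
  - by move=> k; rewrite mul1r.
apply: real_functional_eq0 nT.
- exact: wmoment_sym.
- exact: wmoment_odd.
- by move=> b c w; exact: rot.
- by move=> b c w; exact: rot.
- move=> a b w; rewrite [LHS](boost_der hu (sw := id) (eb := fun=> 1) (ec := fun=> 1)) //; last exact: hboost.
  + by rewrite mulr_sumr.
  + by move=> k; rewrite normr1.
  + by move=> k; rewrite normr1.
  + by move=> k; rewrite mul1r.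
Qed.

Theorem complex_vanishing (R : realType) (T : finType) n
    (u : ('rV[R]_#|{: T * ('I_n * bool)}| -> R) -> R) : tempR u ->
  (forall b c, b != c -> forall s psi, sz psi ->
    u (fun x => psi (lmap (two_row id (fun=> 1) (fun=> -1) b c (cos s) (sin s)) x)) = u psi) ->
  (forall b c, b != c -> forall s psi, sz psi ->
    u (fun x => psi (lmap (two_row (fun k => (k.1, ~~ k.2)) (fun k => (-1) ^+ (~~ k.2))
      (fun k => (-1) ^+ k.2) b c (hcos s) (hsin s)) x)) = u psi) ->
  (forall t psi, sz psi -> u (fun x => psi (lmap (flip_row t) x)) = - u psi) ->
  (n < #|T|)%N -> forall psi, sz psi -> u psi = 0.
Proof.
move=> hu hrot hboost hodd nT; apply: (eq0_of_wmoment hu).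
apply: complex_functional_eq0 nT.
- exact: wmoment_sym.
- exact: wmoment_odd.
- move=> b c w; have [->|bc] := eqVneq b c; first exact: rotd_same_der.
  rewrite [LHS](rotation_der hu (sw := id) (eb := fun=> 1) (ec := fun=> -1)) //; last exact: hrot.
  + by rewrite big1 // => k _; rewrite subrr mul0r.
  + by move=> k; rewrite normr1.
  + by move=> k; rewrite normrN1.
  + by move=> k; rewrite mul1r.
- move=> a b w ab; rewrite [LHS](boost_der hu (sw := fun k => (k.1, ~~ k.2))
    (eb := fun k => (-1) ^+ (~~ k.2)) (ec := fun k => (-1) ^+ k.2)) //; last exact: hboost.
  + rewrite mulr_sumr (eq_bigr (fun k => ((-1) ^+ (~~ k.2) + (-1) ^+ (~~ k.2)) *
      wmoment u [:: (a, (k.1, k.2)), (b, (k.1, ~~ k.2)) & w])); last by case.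
    rewrite -(pair_bigA _ (fun k f => ((-1) ^+ (~~ f) + (-1) ^+ (~~ f)) *
      wmoment u [:: (a, (k, f)), (b, (k, ~~ f)) & w])) /=.
    by apply: eq_bigr => k _; rewrite big_bool /= expr0 expr1; ring.
  + by move=> [k []].
  + by move=> k; rewrite normr_sign.
  + by move=> k; rewrite normr_sign.
  + by move=> [k []] /=; rewrite ?expr0 ?expr1; ring.
Qed.

(** * Orthogonal groups *)

Import Normc passmx.

Section Determinant.
Variables (k : fieldType) (V : vectType k).
Implicit Types (g h : 'End(V)).
Local Notation vb := (vbasis {:V}).

Let vbP : basis_of {:V} vb. Proof. exact: vbasisP. Qed.

Lemma lfun_det_comp g h : lfun_det (g \o h)%VF = lfun_det h * lfun_det g.
Proof. by rewrite /lfun_det (mxof_comp vb vb vbP) det_mulmx. Qed.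

Lemma lfun_det_basis (e : (\dim {:V}).-tuple V) g : basis_of {:V} e ->
  lfun_det g = \det (mxof e e g).
Proof.
move=> eP; have H : mxof e e g = mxof e vb \1 *m mxof vb vb g *m mxof vb e \1.
  by rewrite -!(mxof_comp _ _ vbP) // comp_lfun1r comp_lfun1l.
rewrite H !det_mulmx mulrC mulrA -det_mulmx -(mxof_comp vb vb eP) comp_lfun1l mxof1.
  by rewrite det1 mul1r.
exact: basis_free vbP.
Qed.

(** Follows from G M G^T = M for the invertible Gram matrix M. The form is an arbitrary function, so
    as to cover also the sum of the copies of B on V^n, or its real part, and thus the determinant
    of the diagonal action. *)
Lemma lfun_det_isometry (beta : V -> V -> k) g :
  (forall y a x x', beta (a *: x + x') y = a * beta x y + beta x' y) ->
  (forall x a y y', beta x (a *: y + y') = a * beta x y + beta x y') ->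
  (forall x, (forall y, beta x y = 0) -> x = 0) ->
  (forall x y, beta (g x) (g y) = beta x y) -> lfun_det g ^+ 2 = 1.
Proof.
move=> bl br nd iso.
have b0l y : beta 0 y = 0.
  by have := bl y (-1) 0 0; rewrite scaler0 addr0 mulN1r addNr.
have b0r x : beta x 0 = 0.
  by have := br x (-1) 0 0; rewrite scaler0 addr0 mulN1r addNr.
have bsl n (a : 'I_n -> k) (x : 'I_n -> V) y : beta (\sum_i a i *: x i) y = \sum_i a i * beta (x i) y.
  elim: n a x => [|n IH] a x; first by rewrite !big_ord0.
  by rewrite !big_ord_recl bl IH.
have bsr n (a : 'I_n -> k) (x : 'I_n -> V) y : beta y (\sum_i a i *: x i) = \sum_i a i * beta y (x i).
  elim: n a x => [|n IH] a x; first by rewrite !big_ord0.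
  by rewrite !big_ord_recl br IH.
pose M : 'M[k]_(\dim {:V}) := \matrix_(i, j) (beta (vb`_i) (vb`_j)).
have GM : mxof vb vb g *m M *m (mxof vb vb g)^T = M.
  have ge (i : 'I_(\dim {:V})) : g vb`_i = \sum_j mxof vb vb g i j *: vb`_j.
    rewrite -(vecof_delta vb i) (hom_vecof vb vbP) -rowE /vecof.
    by apply: eq_bigr => j _; rewrite mxE.
  apply/matrixP => i j; rewrite !mxE -iso !ge bsl.
  rewrite (eq_bigr (fun b => \sum_a mxof vb vb g i a * M a b * mxof vb vb g j b)); last first.
    by move=> b _; rewrite mxE mxE mulr_suml.
  rewrite exchange_big; apply: eq_bigr => a _; rewrite bsr mulr_sumr.
  by apply: eq_bigr => b _; rewrite [M a b]mxE -mulrA [_ * mxof vb vb g j b]mulrC.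
have dM : \det M != 0.
  apply/negP => /det0P[v v0 vM]; case/negP: v0.
  rewrite -(vecof_eq0 vbP); apply/eqP/nd => y.
  rewrite -(rVofK vbP y) /vecof bsl.
  under eq_bigr do rewrite bsr mulr_sumr.
  rewrite exchange_big big1 // => j _.
  have := congr1 (fun A : 'rV_ _ => A 0 j) vM; rewrite !mxE => e.
  apply: etrans (_ : coord vb j y * (\sum_i v 0 i * M i j) = 0); last by rewrite e mulr0.
  by rewrite mulr_sumr; apply: eq_bigr => i _; rewrite !mxE mulrCA.
have := congr1 determinant GM; rewrite !det_mulmx det_tr -/(lfun_det g) => e.
by apply: (mulIf dM); rewrite mul1r -[RHS]e expr2; ring.
Qed.

End Determinant.

Section OrthogonalBasis.
Variables (k : numFieldType) (V : vectType k) (B : {symmetric V}).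
Implicit Types (U : {vspace V}) (x y : V) (s : seq V).

Lemma formC x y : B x y = B y x.
Proof. by rewrite hermC expr0 mul1r. Qed.

Lemma formDl x x' y : B (x + x') y = B x y + B x' y. Proof. exact: linearDl. Qed.
Lemma formDr x y y' : B x (y + y') = B x y + B x y'. Proof. exact: linearDr. Qed.
Lemma formZl a x y : B (a *: x) y = a * B x y. Proof. exact: linearZl_LR. Qed.
Lemma formZr a x y : B x (a *: y) = a * B x y. Proof. exact: linearZr_LR. Qed.

Lemma formNl x y : B (- x) y = - B x y. Proof. exact: linearNl. Qed.
Lemma formNr x y : B x (- y) = - B x y. Proof. exact: linearNr. Qed.

Lemma form_suml (I : Type) (r : seq I) (a : I -> k) (x : I -> V) y :
  B (\sum_(i <- r) a i *: x i) y = \sum_(i <- r) a i * B (x i) y.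
Proof.
elim: r => [|i r IH]; first by rewrite !big_nil linear0l.
by rewrite !big_cons formDl formZl IH.
Qed.

Lemma form_sumr (I : Type) (r : seq I) (a : I -> k) (x : I -> V) y :
  B y (\sum_(i <- r) a i *: x i) = \sum_(i <- r) a i * B y (x i).
Proof. by rewrite formC form_suml; apply: eq_bigr => i _; rewrite formC. Qed.

Definition orth_family s : Prop :=
  forall i j : nat, (i < size s)%N -> (j < size s)%N -> (B s`_i s`_j == 0) = (i != j).

(** Induction on the dimension: polarization provides a nonisotropic vector, and its orthogonal
    complement in U is again nondegenerate. *)
Lemma exists_orth_family U :
  (forall u, u \in U -> (forall v, v \in U -> B u v = 0) -> u = 0) ->
  exists s, [/\ size s = \dim U, {subset s <= U} & orth_family s].
Proof.
have [m] := ubnP (\dim U); elim: m U => // m IH U; rewrite ltnS => dU nd.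
have [U0|U0] := posnP (\dim U); first by exists [::]; rewrite U0.
have [x xU xx] : exists2 x, x \in U & B x x != 0.
  apply: contrapT => hn.
  have h0 x : x \in U -> B x x = 0.
    by move=> xU; apply/eqP/negP => /negP xx; apply: hn; exists x.
  have : vpick U = 0.
    apply: nd (memv_pick U) _ => v vU; have pU := memv_pick U.
    have := h0 _ (rpredD pU vU); rewrite formDl !formDr (h0 _ pU) (h0 _ vU) add0r addr0.
    by rewrite [B v _]formC -mulr2n => /eqP; rewrite mulrn_eq0 /= => /eqP.
  by move/eqP; rewrite vpick0 => /eqP E; rewrite E dimv0 in U0.
pose U' := (U :&: orthov B <[x]>)%VS.
have dU' : (\dim U).-1 = \dim U'.
  by apply: eq_dim_orthov1; apply/mem_orthovPn; exists x.
have mU' v : (v \in U') = (v \in U) && (B v x == 0) by rewrite memv_cap mem_orthov1.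
have [||s [ss sU so]] := IH U'.
- by rewrite -dU'; case: (\dim U) U0 dU.
- move=> v; rewrite mU' => /andP[vU /eqP vx] hv; apply: nd vU _ => w wU.
  have := hv (w - (B w x / B x x) *: x); rewrite mU' rpredB ?rpredZ //=.
  rewrite -scaleNr formDl formZl mulNr divfK // subrr eqxx => /(_ isT).
  by rewrite formDr formZr vx mulr0 addr0.
exists (x :: s); split=> [|y|[|i] [|j]] /=.
- by rewrite ss -dU' prednK.
- by rewrite inE => /orP[/eqP ->//|/sU]; rewrite mU' => /andP[].
- by rewrite (negPf xx).
- move=> _; rewrite ltnS => js; have := sU _ (mem_nth 0 js).
  by rewrite mU' formC => /andP[_ ->].
- rewrite ltnS => iS _; have := sU _ (mem_nth 0 iS).
  by rewrite mU' => /andP[_ ->].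
- by rewrite !ltnS eqSS; exact: so.
Qed.

Hypothesis nd : nondegenerate B.
Local Notation d := (\dim {:V}).

Lemma form_nd x : (forall y, B x y = 0) -> x = 0.
Proof.
move=> h; apply/eqP; rewrite -memv0 -(eqP nd); apply/mem_orthovP => y _; exact: h.
Qed.

Lemma exists_orth_basis : exists e : d.-tuple V, [/\ basis_of {:V} e,
  forall i j, i != j -> B e`_i e`_j = 0 & forall i : 'I_d, B e`_i e`_i != 0].
Proof.
have [u _ hu|s [ss _ so]] := exists_orth_family (U := {:V}).
  by apply: form_nd => y; apply: hu; exact: memvf.
have st : size s == d by rewrite ss.
have so' (i j : 'I_d) : (B s`_i s`_j == 0) = (i != j) by apply: so; rewrite ss.
exists (Tuple st); split=> [|i j ij|i]; last 2 first.
- have [id|id] := ltnP i d; last first.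
    by rewrite (nth_default 0 (s := Tuple st)) ?size_tuple // linear0l.
  have [jd|jd] := ltnP j d; last first.
    by rewrite [X in B _ X](nth_default 0 (s := Tuple st)) ?size_tuple // linear0r.
  by apply/eqP; rewrite (so' (Ordinal id) (Ordinal jd)).
- by rewrite so' eqxx.
rewrite basisEfree size_tuple leqnn andbT subvf andbT.
apply/freeP => c c0 i; have := congr1 (fun v => B v s`_i) c0; rewrite linear0l.
rewrite form_suml (bigD1 i) //= big1 ?addr0 => [|j ji].
  by move/eqP; rewrite mulf_eq0 so' eqxx orbF => /eqP.
by rewrite (eqP (_ : B s`_j s`_i == 0)) ?mulr0 // so'.
Qed.

End OrthogonalBasis.

Definition lin_end (k : fieldType) (V : vectType k) (f : V -> V) (fL : linear f) : 'End(V) :=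
  linfun (HB.pack_for {linear V -> V} f (GRing.isLinear.Build _ _ _ _ f fL)).

Lemma lin_endE (k : fieldType) (V : vectType k) (f : V -> V) (fL : linear f) v : lin_end fL v = f v.
Proof. by rewrite lfunE. Qed.

Section Frames.
Variables (k : numFieldType) (V : vectType k) (B : {symmetric V}).
Hypothesis nd : nondegenerate B.
Implicit Types (x y v : V).
Local Notation d := (\dim {:V}).

Lemma isometry_in_O (g : 'End(V)) : isometry B B g -> in_O B g.
Proof.
move=> iso; split=> //; rewrite -subv0; apply/subvP => x; rewrite memv_ker memv0 => /eqP gx.
by apply/eqP; apply: (form_nd nd) => y; rewrite -iso gx linear0l.
Qed.

Lemma lfun_det_in_O (g : 'End(V)) : in_O B g -> lfun_det g ^+ 2 = 1.
Proof.
move=> [_ iso]; apply: (lfun_det_isometry (beta := B)) => //.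
- by move=> y a x x'; rewrite formDl formZl.
- by move=> x a y y'; rewrite formDr formZr.
- exact: (form_nd nd).
Qed.

Definition refl_fun x v : V := v - (2 * B v x / B x x) *: x.

Lemma refl_linear x : linear (refl_fun x).
Proof.
move=> a v w; rewrite /refl_fun formDl formZl scalerBr scalerA.
rewrite addrACA -opprD -scalerDl; congr (_ - _ *: _); ring.
Qed.

Definition refl x : 'End(V) := lin_end (refl_linear x).

Lemma reflE x v : refl x v = v - (2 * B v x / B x x) *: x.
Proof. exact: lin_endE. Qed.

Lemma refl_isometry x : B x x != 0 -> isometry B B (refl x).
Proof.
move=> x0 v w; rewrite !reflE !(formDl, formDr, formNl, formNr, formZl, formZr) (formC B x w).
by move: x0; move: (B v w) (B v x) (B w x) (B x x) => p q r t t0; field.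
Qed.

Lemma refl_scale (c : k) x : c != 0 -> refl (c *: x) = refl x.
Proof.
move=> c0; apply/lfunP => v; rewrite !reflE !(formZl, formZr) scalerA; congr (_ - _ *: _).
have [x0|x0] := eqVneq (B x x) 0; first by rewrite x0 !mulr0 invr0 !mulr0 mul0r.
by field; rewrite x0 c0.
Qed.

(** An orthogonal basis indexed by any finite type, in particular by a sum of two types. The
    determinant of the reflections is recorded because it is computed once, in a tuple basis, and
    survives rescaling and reindexing. *)
Definition frame (T : finType) (e : T -> V) (eta : T -> k) : Prop :=
  [/\ forall t t', B (e t) (e t') = (t == t')%:R * eta t,
      forall t, eta t != 0,
      forall v, v = \sum_t (B v (e t) / eta t) *: e t &
      forall t, lfun_det (refl (e t)) = -1].

Lemma exists_frame : exists (e : 'I_d -> V) eta, frame e eta.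
Proof.
have [e [eb e0 e1]] := exists_orth_basis nd.
exists (fun i : 'I_d => e`_i), (fun i : 'I_d => B e`_i e`_i); split=> //.
- by move=> i j; have [->|ij] := eqVneq i j; rewrite ?mul1r // mul0r e0.
- move=> v; rewrite {1}(coord_basis eb (memvf v)); apply: eq_bigr => i _.
  rewrite [in RHS](coord_basis eb (memvf v)) form_suml (bigD1 i) //= big1 ?addr0 ?mulfK // => j ji.
  by rewrite e0 // mulr0.
- move=> t; rewrite (lfun_det_basis _ eb).
  pose D : 'rV[k]_d := \row_i (if i == t then -1 else 1).
  have -> : mxof e e (refl e`_t) = diag_mx D.
    apply/row_matrixP => i; rewrite rowE mul_mxof vecof_delta reflE row_diag_mx mxE.
    have [->|it] := eqVneq i t.
      by rewrite mulfK // scaler_nat mulr2n opprD addrA subrr sub0r linearN /= (rVofE eb) scaleN1r.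
    by rewrite (e0 _ _ it) mulr0 mul0r scale0r subr0 (rVofE eb) scale1r.
  rewrite det_diag (bigD1 t) //= mxE eqxx big1 ?mulr1 // => i it.
  by rewrite mxE (negPf it).
Qed.

Lemma frame_scale (T : finType) (e : T -> V) eta (c : T -> k) : frame e eta ->
  (forall t, c t != 0) -> frame (fun t => c t *: e t) (fun t => c t ^+ 2 * eta t).
Proof.
move=> [h1 h2 h3 h4] c0; split=> [t t'|t|v|t].
- rewrite formZl formZr h1; have [->|tt] := eqVneq t t'; last by rewrite !mul0r !mulr0.
  by rewrite !mul1r mulrA.
- by rewrite mulf_neq0 ?expf_neq0.
- rewrite {1}(h3 v); apply: eq_bigr => t _; rewrite formZr scalerA; congr (_ *: _).
  by field; rewrite h2 c0.
- by rewrite refl_scale.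
Qed.

Lemma frame_reindex (T T' : finType) (f : T' -> T) (e : T -> V) eta : bijective f ->
  frame e eta -> frame (e \o f) (eta \o f).
Proof.
move=> [f' fK f'K] [h1 h2 h3 h4]; split=> [t t'|t|v|t] //=.
- by rewrite h1 (inj_eq (can_inj fK)).
- by rewrite {1}(h3 v) (reindex f) //; exists f' => x _.
Qed.

Section FrameElements.
Variables (T : finType) (e : T -> V) (eta : T -> k).
Hypothesis fr : frame e eta.

Definition fcoord v t : k := B v (e t) / eta t.

Lemma fcoord_sum v : v = \sum_t fcoord v t *: e t.
Proof. by case: fr. Qed.

Lemma fcoord_lin a v w t : fcoord (a *: v + w) t = a * fcoord v t + fcoord w t.
Proof. by rewrite /fcoord formDl formZl mulrDl mulrA. Qed.

Lemma fcoord_delta t t' : fcoord (e t) t' = (t == t')%:R.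
Proof.
case: fr => h1 h2 _ _; rewrite /fcoord h1.
by have [->|tt] := eqVneq t t'; rewrite ?mul0r // mul1r divff.
Qed.

Lemma fcoordK (z : T -> k) t : fcoord (\sum_t z t *: e t) t = z t.
Proof.
case: fr => h1 h2 _ _; rewrite /fcoord form_suml (bigD1 t) //= h1 eqxx mul1r.
by rewrite big1 ?addr0 ?mulfK // => t' tt; rewrite h1 (negPf tt) mul0r mulr0.
Qed.

Lemma form_fcoord v w : B v w = \sum_t eta t * (fcoord v t * fcoord w t).
Proof.
case: fr => h1 h2 _ _; rewrite {1}(fcoord_sum w) form_sumr; apply: eq_bigr => t _.
by rewrite /fcoord mulrC [_ * (_ / _)]mulrC mulrA mulrAC; field; rewrite h2.
Qed.

Lemma fcoord_refl t v t' : fcoord (refl (e t) v) t' = if t' == t then - fcoord v t' else fcoord v t'.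
Proof.
case: fr => h1 h2 _ _; rewrite reflE addrC -scaleN1r (scalerA (-1)) fcoord_lin fcoord_delta h1 eqxx mul1r eq_sym.
have [->|_] := eqVneq t' t; last by rewrite mulr0 add0r.
by rewrite /fcoord mulr1; field; rewrite h2.
Qed.

Lemma refl_in_O t : in_O B (refl (e t)).
Proof.
by case: fr => h1 h2 _ _; apply/isometry_in_O/refl_isometry; rewrite h1 eqxx mul1r.
Qed.

(** A matrix with equal diagonal entries p and off-diagonal entries q and r, the common shape of
    rotations, boosts and rotations by an imaginary angle. *)
Definition plane_coord (b c : T) (p q r : k) (z : T -> k) t : k :=
  if t == b then p * z b + q * z c else if t == c then p * z c + r * z b else z t.

Definition plane_fun b c p q r v : V := \sum_t plane_coord b c p q r (fcoord v) t *: e t.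

Lemma plane_linear b c p q r : linear (plane_fun b c p q r).
Proof.
move=> a v w; rewrite /plane_fun scaler_sumr -big_split; apply: eq_bigr => t _ /=.
rewrite scalerA -scalerDl; congr (_ *: _); rewrite /plane_coord.
by case: eqP => _; [|case: eqP => _]; rewrite !fcoord_lin; ring.
Qed.

Definition plane b c p q r : 'End(V) := lin_end (plane_linear b c p q r).

Lemma fcoord_plane b c p q r v t : fcoord (plane b c p q r v) t = plane_coord b c p q r (fcoord v) t.
Proof. by rewrite lin_endE fcoordK. Qed.

Lemma fcoord_inj v w : fcoord v =1 fcoord w -> v = w.
Proof. by move=> vw; rewrite (fcoord_sum v) (fcoord_sum w); apply: eq_bigr => t _; rewrite vw. Qed.

Lemma plane_comp b c p q r p' q' r' v : b != c ->
  plane b c p q r (plane b c p' q' r' v) = \sum_t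
    (if t == b then (p * p' + q * r') * fcoord v b + (p * q' + q * p') * fcoord v c
     else if t == c then (p * p' + r * q') * fcoord v c + (p * r' + r * p') * fcoord v b
     else fcoord v t) *: e t.
Proof.
move=> bc; apply: fcoord_inj => t; rewrite fcoordK !fcoord_plane /plane_coord.
rewrite !fcoord_plane /plane_coord !eqxx (eq_sym c) (negPf bc).
by case: eqP => _; [ring|case: eqP => _; [ring|by []]].
Qed.

Lemma plane_isometry b c p q r : b != c -> p ^+ 2 - q * r = 1 -> eta b * q + eta c * r = 0 ->
  isometry B B (plane b c p q r).
Proof.
move=> bc pq eqr v w; rewrite !form_fcoord (bigD1 b) // (bigD1 c) 1?eq_sym //=.
rewrite [RHS](bigD1 b) // [in RHS](bigD1 c) 1?eq_sym //= !addrA; congr (_ + _).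
  rewrite !fcoord_plane /plane_coord !eqxx (eq_sym c) (negPf bc).
  have E1 : eta b * q = - (eta c * r) by apply/eqP; rewrite -subr_eq0 opprK eqr.
  have E2 : p ^+ 2 = 1 + q * r by rewrite -pq subrK.
  set x := fcoord v b; set y := fcoord v c; set x' := fcoord w b; set y' := fcoord w c.
  rewrite [LHS](_ : _ = eta b * (p ^+ 2 * (x * x')) + eta c * (p ^+ 2 * (y * y'))
     + (eta b * q) * (q * (y * y') + p * (x * y' + y * x'))
     + eta c * r * (r * (x * x') + p * (x * y' + y * x'))); last by ring.
  rewrite E2 !mulrDl !mul1r !mulrDr.
  rewrite (_ : eta b * (q * r * (x * x')) = eta b * q * (r * (x * x'))); last by ring.
  by rewrite E1; ring.
apply: eq_bigr => t /andP[tb tc]; rewrite !fcoord_plane /plane_coord.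
by rewrite (negPf tb) (negPf tc).
Qed.

(* The determinant is 1 because the element is the square of an isometry. *)
Lemma plane_in_SO b c p q r : b != c -> p ^+ 2 - q * r = 1 -> eta b * q + eta c * r = 0 ->
  in_SO B (plane b c (p ^+ 2 + q * r) (2 * p * q) (2 * p * r)).
Proof.
move=> bc pq eqr; have iso := plane_isometry bc pq eqr.
have E : (plane b c p q r \o plane b c p q r)%VF = plane b c (p ^+ 2 + q * r) (2 * p * q) (2 * p * r).
  apply/lfunP => v; rewrite comp_lfunE plane_comp // lin_endE; apply: eq_bigr => t _; congr (_ *: _).
  rewrite /plane_coord; case: eqP => _; first by ring.
  by case: eqP => _; first ring.
split; last by rewrite -E lfun_det_comp -expr2; apply/lfun_det_in_O/isometry_in_O.
by apply: isometry_in_O => v w; rewrite -E !comp_lfunE !iso.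
Qed.

End FrameElements.
End Frames.

Local Open Scope complex_scope.

(** * Complex functionals in real coordinates *)

Section LinearSubstitution.
Variables (R : realType) (a b : nat) (f : 'rV[R]_a -> 'rV[R]_b) (g : 'rV[R]_b -> 'rV[R]_a).
Hypotheses (fL : linear f) (gL : linear g) (fK : cancel f g).

Lemma linear_mulmx (p q : nat) (h : 'rV[R]_p -> 'rV[R]_q) : linear h -> exists A : 'M[R]_(p, q), forall x, h x = x *m A.
Proof.
move=> hL; pose H := HB.pack_for {linear 'rV[R]_p -> 'rV[R]_q} h (GRing.isLinear.Build _ _ _ _ h hL).
by exists (lin1_mx H) => x; rewrite mul_rV_lin1.
Qed.

Lemma sz_linear : (forall psi, sz psi -> sz (psi \o f)) /\
  forall k, exists C, forall psi M, sm psi -> szball k M psi -> szball k (C * M) (psi \o f).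
Proof.
have [A fA] := linear_mulmx fL; have [A' gA] := linear_mulmx gL.
have AK (x : 'rV[R]_a) : `|x| <= (\sum_i \sum_j `|A' i j|) * `|x *m A|.
  by rewrite -{1}(fK x) gA fA; exact: norm_mulmx_le.
have E psi : psi \o f = fun x => psi (x *m A) by apply/funext => x /=; rewrite fA.
split=> [psi|k]; first by rewrite E; exact: sz_sub AK _.
have [C HC] := szball_sub AK k; exists C => psi M h; rewrite E; exact: HC.
Qed.

End LinearSubstitution.

Section SchwartzLink.
Variables (R : realType) (m : nat).
Implicit Types (phi : 'rV[R]_m -> R[i]) (psi : 'rV[R]_m -> R).

Lemma partialsE s phi : partials s phi = fun x => pds s (ReF phi) x +i* pds s (ImF phi) x.
Proof.
elim: s => [|i s IH] /=; first by apply/funext => x; rewrite /ReF /ImF; case: (phi x).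
by rewrite -/(partials s phi) IH.
Qed.

Lemma ReF_partials s phi : ReF (partials s phi) = pds s (ReF phi).
Proof. by rewrite partialsE. Qed.

Lemma ImF_partials s phi : ImF (partials s phi) = pds s (ImF phi).
Proof. by rewrite partialsE. Qed.

Lemma normc_le_ReIm (z : R[i]) : normc z <= `|complex.Re z| + `|complex.Im z|.
Proof.
case: z => x y /=; rewrite -[leRHS]ger0_norm ?addr_ge0 // -sqrtr_sqr ler_wsqrtr //.
rewrite sqrrD !real_normK ?num_real //.
by have := mulr_ge0 (normr_ge0 x) (normr_ge0 y); lra.
Qed.

Lemma normc_ge_Re (z : R[i]) : `|complex.Re z| <= normc z.
Proof. by case: z => x y /=; rewrite -sqrtr_sqr ler_wsqrtr // lerDl sqr_ge0. Qed.

Lemma normc_ge_Im (z : R[i]) : `|complex.Im z| <= normc z.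
Proof. by case: z => x y /=; rewrite -sqrtr_sqr ler_wsqrtr // lerDr sqr_ge0. Qed.

Lemma normc_real (x : R) : normc x%:C = `|x|.
Proof. by rewrite /= expr0n addr0 sqrtr_sqr. Qed.

Lemma rV_schwartzP phi : rV_schwartz phi <-> sz (ReF phi) /\ sz (ImF phi).
Proof.
split=> [[h H]|[[h1 H1] [h2 H2]]].
  split; split.
  - by move=> s; have [c1 c2 c3] := h s; rewrite -ReF_partials; split=> // i x; case: (c3 i x).
  - move=> k s; have [M hM] := H k s; exists M => x; rewrite -ReF_partials.
    by apply: le_trans (hM x); rewrite ler_wpM2l ?exprn_ge0 ?addr_ge0 // normc_ge_Re.
  - by move=> s; have [c1 c2 c3] := h s; rewrite -ImF_partials; split=> // i x; case: (c3 i x).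
  - move=> k s; have [M hM] := H k s; exists M => x; rewrite -ImF_partials.
    by apply: le_trans (hM x); rewrite ler_wpM2l ?exprn_ge0 ?addr_ge0 // normc_ge_Im.
split=> [s|k s].
  have [a1 b1] := h1 s; have [a2 b2] := h2 s.
  by rewrite ReF_partials ImF_partials; split.
have [M1 hM1] := H1 k s; have [M2 hM2] := H2 k s; exists (M1 + M2) => x.
apply: le_trans (lerD (hM1 x) (hM2 x)); rewrite -mulrDr ler_wpM2l ?exprn_ge0 ?addr_ge0 //.
by apply: le_trans (normc_le_ReIm _) _; rewrite partialsE.
Qed.

Lemma sz_ImF_real psi : ImF (fun x => (psi x)%:C) = fun=> 0.
Proof. by []. Qed.

Lemma rV_schwartz_real psi : sz psi -> rV_schwartz (fun x => (psi x)%:C).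
Proof. by move=> h; apply/rV_schwartzP; split=> //; exact: sz0. Qed.

Lemma pds0 (s : seq 'I_m) : pds s (fun=> 0 : R) = fun=> 0.
Proof. by elim: s => //= i s ->; apply: pd_val => x; exact: is_derive_cst. Qed.

Lemma rV_schwartz_ball_real k d psi : szball k d psi -> rV_schwartz_ball k d (fun x => (psi x)%:C).
Proof.
move=> h s sk x; rewrite partialsE sz_ImF_real pds0 -[_ +i* 0]/((_)%:C) normc_real; exact: h.
Qed.

End SchwartzLink.

Section Functionals.
Variables (R : realType) (W : vectType R).
Local Notation e := (vbasis {:W}).
Implicit Types (phi : W -> R[i]) (A : 'End(W)).

Let eP : basis_of {:W} e. Proof. exact: vbasisP. Qed.

Lemma rVof_lin c v w : rVof e (c *: v + w) = c *: rVof e v + rVof e w.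
Proof. exact: linearP. Qed.

Lemma vecof_lin c v w : vecof e (c *: v + w) = c *: vecof e v + vecof e w.
Proof. exact: linearP. Qed.

Lemma schwartz_comp A phi : lker A == 0%VS -> schwartz phi -> schwartz (fun w => phi (A w)).
Proof.
move=> kA /rV_schwartzP[h1 h2].
pose f x := rVof e (A (vecof e x)); pose g x := rVof e ((A^-1)%VF (vecof e x)).
have fL : linear f by move=> c x y; rewrite /f vecof_lin linearP rVof_lin.
have gL : linear g by move=> c x y; rewrite /g vecof_lin linearP rVof_lin.
have fK : cancel f g by move=> x; rewrite /g /f (rVofK eP) lker0_lfunK // (vecofK eP).
have E : (fun w => phi (A w)) \o vecof e = (phi \o vecof e) \o f.
  by apply/funext => x; rewrite /f /= (rVofK eP).
rewrite /schwartz E; apply/rV_schwartzP; have [H _] := sz_linear fL gL fK.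
by split; [exact: H h1|exact: H h2].
Qed.

(** The Jacobian factor is 1, and testing on phi composed with A removes the inverse of A. *)
Lemma pullback_eqP A T : lker A == 0%VS -> `|lfun_det A| = 1 ->
  genfun_eq (pullback A T) T <-> forall phi, schwartz phi -> T (fun w => phi (A w)) = T phi.
Proof.
move=> kA dA.
have pE phi : pullback A T phi = T (fun w => phi ((A^-1)%VF w)).
  by rewrite /pullback dA invr1; under eq_fun do rewrite mul1r.
have kA' : lker (A^-1)%VF == 0%VS.
  rewrite -subv0; apply/subvP => x; rewrite memv_ker memv0 => /eqP h.
  by rewrite -(lker0_lfunVK kA x) h linear0.
split=> h phi hp.
  rewrite -(h _ (schwartz_comp kA hp)) pE; congr T; apply/funext => w.
  by rewrite lker0_lfunVK.
rewrite pE -(h _ (schwartz_comp kA' hp)); congr T; apply/funext => w.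
by rewrite lker0_lfunK.
Qed.

Variable T : (W -> R[i]) -> R[i].
Hypothesis hT : tempered T.
Variables (a : nat) (P : W -> 'rV[R]_a) (Q : 'rV[R]_a -> W).
Hypotheses (PL : linear P) (QL : linear Q) (PK : cancel P Q) (QK : cancel Q P).
Implicit Types psi : 'rV[R]_a -> R.

Let f x := P (vecof e x).
Let g x := rVof e (Q x).
Let fL : linear f. Proof. by move=> c x y; rewrite /f vecof_lin PL. Qed.
Let gL : linear g. Proof. by move=> c x y; rewrite /g QL rVof_lin. Qed.
Let fK : cancel f g. Proof. by move=> x; rewrite /g /f PK (vecofK eP). Qed.
Let gK : cancel g f. Proof. by move=> x; rewrite /g /f (rVofK eP) QK. Qed.

Definition lift psi : W -> R[i] := fun w => (psi (P w))%:C.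

Lemma schwartz_lift psi : sz psi -> schwartz (lift psi).
Proof. by move=> h; apply: (@rV_schwartz_real _ _ (psi \o f)); exact: (sz_linear fL gL fK).1. Qed.

Let lift_lin (c : R) psi psi' :
  lift (fun x => c * psi x + psi' x) = fun w => c%:C * lift psi w + lift psi' w.
Proof. by apply/funext => w; rewrite /lift rmorphD rmorphM. Qed.

Variable part : R[i] -> R.
Hypothesis part_lin : forall (c : R) z z', part (c%:C * z + z') = c * part z + part z'.
Hypothesis part_le : forall z, `|part z| <= normc z.

Definition component psi : R := part (T (lift psi)).

(** Continuity at 0 becomes an estimate by homogeneity: psi is rescaled into a ball on which T is
    less than 1 in modulus. *)
Lemma tempR_component : tempR component.
Proof.
have lin (c : R) psi psi' : sz psi -> sz psi' ->
    T (lift (fun x => c * psi x + psi' x)) = c%:C * T (lift psi) + T (lift psi').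
  by move=> h h'; rewrite lift_lin hT.1 //; exact: schwartz_lift.
split=> [c psi psi' h h'|]; first by rewrite /component lin.
have T0 : T (lift (fun=> 0)) = 0.
  have := lin (-1) _ _ (sz0 _ _) (sz0 _ _); under [X in T (lift X)]eq_fun do rewrite mulr0 addr0.
  by rewrite rmorphN1 mulN1r addNr.
have [k [d d0 hd]] := hT.2 _ (schwartz_lift (sz0 R a)) 1 ltr01.
have [C HC] := (sz_linear fL gL fK).2 k.
exists k, ((1 + `|C|) / d) => psi M h hM.
have M0 := szball_ge0 hM.
apply/ler_addgt0Pr => eps eps0.
(* The summand d eps keeps D positive when M = 0; as eps is arbitrary it does not affect the
   estimate. *)
pose D := (1 + `|C|) * M + d * eps; have D0 : 0 < D.
  by rewrite ltr_wpDl ?mulr_gt0 // mulr_ge0 // addr_ge0.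
pose psi1 := fun x => d / D * psi x.
have h1 : sz psi1 by exact: szZ.
have b1 : szball k d (psi1 \o f).
  move=> s sk x; have := HC _ _ h.1 hM s sk x.
  have -> : psi1 \o f = fun x => d / D * (psi \o f) x + 0 by apply/funext => y; rewrite addr0.
  have hf : sz (psi \o f) by exact: (sz_linear fL gL fK).1.
  rewrite (pds_lin _ _ hf.1 (sz0 _ _).1) pds0 addr0 normrM ger0_norm ?divr_ge0 ?(ltW d0) ?(ltW D0) //.
  move: (`|pds s _ x|) => Y hx.
  rewrite [leLHS](_ : _ = d * ((1 + `|x|) ^+ k * Y / D)); last by ring.
  rewrite ler_piMr ?(ltW d0) // ler_pdivrMr // mul1r; apply: le_trans hx _.
  rewrite /D mulrDl mul1r; have := mulr_gt0 d0 eps0; have := ler_wpM2r M0 (ler_norm C); lra.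
have := hd _ (schwartz_lift h1).
have -> : T (lift psi1) = (d / D)%:C * T (lift psi).
  have := lin (d / D) _ _ h (sz0 _ _); rewrite T0 addr0 => <-; congr T; congr lift.
  by apply/funext => x; rewrite addr0.
have b1' : schwartz_ball k d (fun x => lift psi1 x - lift (fun=> 0) x).
  have -> : (fun x => lift psi1 x - lift (fun=> 0) x) = lift psi1.
    by apply/funext => x; rewrite /lift subr0.
  exact: rV_schwartz_ball_real b1.
move=> /(_ b1'); rewrite T0 subr0 => /(le_lt_trans (part_le _)).
have part0 : part 0 = 0 by have := part_lin (-1) 0 0; rewrite mulr0 addr0 mulN1r addNr.
have := part_lin (d / D) (T (lift psi)) 0; rewrite addr0 part0 addr0 => ->.
rewrite normrM ger0_norm ?divr_ge0 ?(ltW d0) ?(ltW D0) // -/(component psi) => hlt.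
have {}hlt : `|component psi| < D / d.
  by move: hlt; rewrite mulrAC ltr_pdivrMr // mul1r ltr_pdivlMr // mulrC.
apply: le_trans (ltW hlt) _; rewrite /D mulrDl (mulrC d) mulfK ?lt0r_neq0 //.
by rewrite mulrAC.
Qed.

End Functionals.

Section OddPart.
Variables (R : realType) (W : vectType R).
Variable T : (W -> R[i]) -> R[i].
Hypothesis hT : tempered T.
Variables (a : nat) (P : W -> 'rV[R]_a) (Q : 'rV[R]_a -> W).
Hypotheses (PL : linear P) (QL : linear Q) (PK : cancel P Q) (QK : cancel Q P).
Variable A : 'End(W).
Hypothesis kA : lker A == 0%VS.
Implicit Types (psi : 'rV[R]_a -> R) (phi : W -> R[i]).

Let rho x := P (A (Q x)).
Let rho' x := P ((A^-1)%VF (Q x)).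
Let rhoL : linear rho. Proof. by move=> c x y; rewrite /rho QL linearP PL. Qed.
Let rhoL' : linear rho'. Proof. by move=> c x y; rewrite /rho' QL linearP PL. Qed.
Let rhoK : cancel rho rho'. Proof. by move=> x; rewrite /rho /rho' PK lker0_lfunK // QK. Qed.

(** The odd part on real test functions, followed by the real or the imaginary part, so that a real
    linear functional in coordinates results. *)
Definition odd_component (part : R[i] -> R) psi : R :=
  part (T (lift P psi)) - part (T (fun w => lift P psi (A w))).

Definition real_part (part : R[i] -> R) : Prop :=
  (forall (c : R) z z', part (c%:C * z + z') = c * part z + part z') /\
  (forall z, `|part z| <= normc z).

Lemma real_part_Re : real_part (@complex.Re R).
Proof. by split=> [c [x y] [x' y']|z] /=; [rewrite mul0r subr0|exact: normc_ge_Re]. Qed.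

Lemma real_part_Im : real_part (@complex.Im R).
Proof. by split=> [c [x y] [x' y']|z] /=; [rewrite mul0r addr0|exact: normc_ge_Im]. Qed.

Lemma tempR_odd_component part : real_part part -> tempR (odd_component part).
Proof.
move=> [pl pn]; have [l1 [k1 [C1 h1]]] := tempR_component hT PL QL PK pl pn.
have E psi : part (T (fun w => lift P psi (A w))) = component T P part (psi \o rho).
  by rewrite /component; congr (part (T _)); apply/funext => w; rewrite /lift /rho /= PK.
have [szr hr] := sz_linear rhoL rhoL' rhoK; have [C2 h2] := hr k1.
split=> [c psi psi' h h'|].
  have := l1 c _ _ h h'; have := l1 c _ _ (szr _ h) (szr _ h').
  rewrite /odd_component !E /component => e1 e2.
  rewrite e2 (_ : (fun x => c * psi x + psi' x) \o rho = fun x => c * (psi \o rho) x + (psi' \o rho) x) //.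
  by rewrite e1; ring.
exists k1, (C1 + C1 * C2) => psi M h hM.
rewrite /odd_component E -/(component T P part psi).
apply: le_trans (ler_normB _ _) _; rewrite mulrDl -mulrA; apply: lerD; first exact: h1.
by apply: h1 (szr _ h) _; exact: h2 h.1 hM.
Qed.

Lemma odd_component_eq0 :
  (forall part, real_part part -> forall psi, sz psi -> odd_component part psi = 0) ->
  forall phi, schwartz phi -> T (fun w => phi (A w)) = T phi.
Proof.
move=> h phi hphi.
have eP : basis_of {:W} (vbasis {:W}) by exact: vbasisP.
pose f x := P (vecof (vbasis {:W}) x); pose g x := rVof (vbasis {:W}) (Q x).
have fL : linear f by move=> c x y; rewrite /f vecof_lin PL.
have gL : linear g by move=> c x y; rewrite /g QL rVof_lin.
have gK : cancel g f by move=> x; rewrite /g /f (rVofK eP) QK.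
have [h1 h2] := (rV_schwartzP _).1 hphi.
have [szg _] := sz_linear gL fL gK.
pose psi1 := ReF (phi \o vecof (vbasis {:W})) \o g; pose psi2 := ImF (phi \o vecof (vbasis {:W})) \o g.
have s1 : sz psi1 by exact: szg h1.
have s2 : sz psi2 by exact: szg h2.
have E w : phi w = 'i * lift P psi2 w + lift P psi1 w.
  rewrite /lift /psi1 /psi2 /ReF /ImF /g /= PK (rVofK eP) addrC.
  by case: (phi w) => x y /=; simpc.
have L psi : sz psi -> T (fun w => lift P psi (A w)) = T (lift P psi).
  move=> hs; have /eqP := h _ real_part_Re _ hs; have /eqP := h _ real_part_Im _ hs.
  rewrite /odd_component !subr_eq0; case: (T _) => x y; case: (T _) => x' y' /=.
  by move=> /eqP -> /eqP ->.
have sl psi : sz psi -> schwartz (lift P psi) by move=> hs; exact: (schwartz_lift PL QL PK hs).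
have -> : (fun w => phi (A w)) = fun w => 'i * lift P psi2 (A w) + lift P psi1 (A w).
  by apply/funext => w; rewrite E.
have -> : phi = fun w => 'i * lift P psi2 w + lift P psi1 w by exact/funext.
rewrite (hT.1 _ _ _ (schwartz_comp kA (sl _ s2)) (schwartz_comp kA (sl _ s1))) !L //.
by rewrite hT.1 //; exact: sl.
Qed.

End OddPart.

(** * From the odd part to invariance under O(V) *)

Section Group.
Variables (R : realType) (k : numFieldType) (V : vectType k) (B : {symmetric V}).
Hypothesis nd : nondegenerate B.
Variables (W : vectType R) (act : 'End(V) -> 'End(W)).
Hypothesis actM : forall g h w, act (g \o h)%VF w = act g (act h w).
Hypothesis act1 : forall w, act \1%VF w = w.
Hypothesis act_det : forall g, in_O B g -> `|lfun_det (act g)| = 1.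
Variables (T : finType) (e : T -> V) (eta : T -> k).
Hypothesis fr : frame B e eta.
Variable t0 : T.
Variable f : (W -> R[i]) -> R[i].
Hypothesis hf : tempered f.
Hypothesis inv : invariant_under (in_SO B) act f.
Implicit Types (g h : 'End(V)) (phi : W -> R[i]).
Local Notation r0 := (refl B (e t0)).

Lemma in_O_comp g h : in_O B g -> in_O B h -> in_O B (g \o h)%VF.
Proof.
move=> [_ ig] [_ ih]; apply: (isometry_in_O nd) => v w.
by rewrite !comp_lfunE ig ih.
Qed.

Lemma reflK t : (refl B (e t) \o refl B (e t) = \1)%VF.
Proof.
apply/lfunP => v; apply: (fcoord_inj fr) => t'.
rewrite comp_lfunE !(fcoord_refl fr) id_lfunE.
by case: eqP => // _; rewrite opprK.
Qed.

Lemma act_ker g : in_O B g -> lker (act g) == 0%VS.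
Proof.
move=> [kg _]; rewrite -subv0; apply/subvP => x; rewrite memv_ker memv0 => /eqP gx.
rewrite -(act1 x) (_ : \1%VF = (g^-1 \o g)%VF) ?actM ?gx ?linear0 //.
by apply/lfunP => v; rewrite comp_lfunE id_lfunE lker0_lfunK.
Qed.

Lemma act_SO g phi : in_SO B g -> schwartz phi -> f (fun w => phi (act g w)) = f phi.
Proof.
move=> hg; apply: (pullback_eqP _ (act_ker hg.1) (act_det hg.1)).1.
exact: inv.
Qed.

Variables (a : nat) (P : W -> 'rV[R]_a) (Q : 'rV[R]_a -> W).
Hypotheses (PL : linear P) (QL : linear Q) (PK : cancel P Q) (QK : cancel Q P).
Implicit Types psi : 'rV[R]_a -> R.
Local Notation u := (odd_component f P (act r0)).

Let sl psi : sz psi -> schwartz (lift P psi).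
Proof. by move=> hs; exact: (schwartz_lift PL QL PK hs). Qed.

Let A0K w : act r0 (act r0 w) = w.
Proof. by rewrite -actM reflK act1. Qed.

Let r0O : in_O B r0. Proof. exact: (refl_in_O nd fr). Qed.

Let sl0 psi : sz psi -> schwartz (fun w => lift P psi (act r0 w)).
Proof. by move=> hs; exact: (schwartz_comp (act_ker r0O) (sl hs)). Qed.

(** In the second term of the odd part, g is conjugated by the reflection [r0], which leaves it in
    SO(V). *)
Lemma odd_component_SO part F g psi : in_SO B g -> (forall w, P (act g w) = F (P w)) ->
  sz psi -> u part (fun x => psi (F x)) = u part psi.
Proof.
move=> hg gF hs.
have E w : lift P (fun x => psi (F x)) w = lift P psi (act g w) by rewrite /lift gF.
rewrite /odd_component; congr (part _ - part _).
  rewrite -(act_SO hg (sl hs)); congr f; apply/funext => w; exact: E.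
have hc : in_SO B (r0 \o g \o r0)%VF.
  split; first exact: in_O_comp (in_O_comp r0O hg.1) r0O.
  by rewrite !lfun_det_comp hg.2 mul1r -expr2; exact: (lfun_det_in_O nd r0O).
rewrite -[RHS](act_SO hc (sl0 hs)); congr f; apply/funext => w.
by rewrite E !actM A0K.
Qed.

(** Products of two reflections lie in SO(V), so any reflection of the frame exchanges the two terms
    of the odd part. *)
Lemma odd_component_refl part F t psi : (forall w, P (act (refl B (e t)) w) = F (P w)) ->
  sz psi -> u part (fun x => psi (F x)) = - u part psi.
Proof.
move=> gF hs; have tO := refl_in_O nd fr t.
have E w : lift P (fun x => psi (F x)) w = lift P psi (act (refl B (e t)) w) by rewrite /lift gF.
have dr t' : lfun_det (refl B (e t')) = -1 by case: fr.
have SO1 : in_SO B (r0 \o refl B (e t))%VF.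
  by split; [exact: in_O_comp|rewrite lfun_det_comp !dr mulrNN mulr1].
have SO2 : in_SO B (refl B (e t) \o r0)%VF.
  by split; [exact: in_O_comp|rewrite lfun_det_comp !dr mulrNN mulr1].
rewrite /odd_component opprB; congr (part _ - part _).
  rewrite -[RHS](act_SO SO1 (sl0 hs)); congr f; apply/funext => w.
  by rewrite E actM A0K.
rewrite -[RHS](act_SO SO2 (sl hs)); congr f; apply/funext => w.
by rewrite E actM.
Qed.

Lemma O_invariant :
  (forall part, real_part part -> forall psi, sz psi -> u part psi = 0) ->
  invariant_under (in_O B) act f.
Proof.
move=> h0 g hg; apply/(pullback_eqP _ (act_ker hg) (act_det hg)) => phi hphi.
have odd := odd_component_eq0 hf PL QL PK QK (act_ker r0O) h0.
have := lfun_det_in_O nd hg => /eqP; rewrite sqrf_eq1 => /orP[/eqP d1|/eqP dN1].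
  exact: act_SO.
have hgr : in_SO B (g \o r0)%VF.
  split; first exact: in_O_comp.
  by rewrite lfun_det_comp dN1; case: fr => _ _ _ ->; rewrite mulrNN mulr1.
rewrite -(act_SO hgr hphi) -(odd _ (schwartz_comp (act_ker hgr.1) hphi)).
by congr f; apply/funext => w; rewrite actM A0K.
Qed.

End Group.

Section Halving.
Variable R : realType.
Implicit Type s : R.

(** Half angles occur because [plane_in_SO] produces squares of plane isometries. *)
Lemma cos_half s : cos (s / 2) ^+ 2 - sin (s / 2) ^+ 2 = cos s.
Proof. by rewrite [in RHS](splitr s) cosD !expr2. Qed.

Lemma sin_half s : 2 * cos (s / 2) * sin (s / 2) = sin s.
Proof. by rewrite [in RHS](splitr s) sinD; ring. Qed.

Lemma hcos_half s : hcos (s / 2) ^+ 2 + hsin (s / 2) ^+ 2 = hcos s.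
Proof.
rewrite /hcos /hsin [in RHS](splitr s) opprD !expRD.
by move: (expR _) (expR _) => x y; field.
Qed.

Lemma hsin_half s : 2 * hcos (s / 2) * hsin (s / 2) = hsin s.
Proof.
rewrite /hcos /hsin [in RHS](splitr s) opprD !expRD.
by move: (expR _) (expR _) => x y; field.
Qed.

End Halving.

Section RealCase.
Variables (R : realType) (n : nat) (V : vectType R) (B : {symmetric V}).
Hypothesis nd : nondegenerate B.

(** The basis vectors are sorted by the sign of their squares and divided by the square roots of the
    absolute values. *)
Lemma exists_real_frame : exists (T0 T1 : finType) (e : T0 + T1 -> V),
  frame B e (fun t => if t is inl _ then 1 else -1) /\ (#|T0| + #|T1| = \dim {:V})%N.
Proof.
have [e [eta fr]] := exists_frame nd; have [_ eta0 _ _] := fr.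
pose T0 : finType := {i : 'I_(\dim {:V}) | 0 < eta i}.
pose T1 : finType := {i : 'I_(\dim {:V}) | ~~ (0 < eta i)}.
pose h (t : T0 + T1) := match t with inl i => val i | inr i => val i end.
have hb : bijective h.
  apply: inj_card_bij.
    case=> [[i i0]|[i i0]] [[j j0]|[j j0]] /= ij; do ?[congr inl|congr inr]; try exact: val_inj.
      by exfalso; move: j0; rewrite -ij i0.
    by exfalso; move: i0; rewrite ij j0.
  by rewrite card_sum !card_sig cardC.
have c0 i : (Num.sqrt `|eta i|)^-1 != 0 by rewrite invr_eq0 sqrtr_eq0 -ltNge normr_gt0.
have fr' := frame_reindex hb (frame_scale fr c0).
exists T0, T1, ((fun t => (Num.sqrt `|eta t|)^-1 *: e t) \o h); split.
  move: fr'; congr frame; apply/funext => t; rewrite /= exprVn sqr_sqrtr //.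
  case: t => -[i i0] /=; first by rewrite gtr0_norm // mulVf.
  by rewrite ler0_norm ?leNgt // invrN mulNr mulVf.
by rewrite -(card_sum T0 T1) (bij_eq_card hb) card_ord.
Qed.

Lemma diag_lfun_comp (F : fieldType) (U : vectType F) (g h : 'End(U)) w :
  diag_lfun n (g \o h)%VF w = diag_lfun n g (diag_lfun n h w).
Proof. by apply/ffunP => i; rewrite !diag_lfunE comp_lfunE. Qed.

Lemma diag_lfun1 (F : fieldType) (U : vectType F) (w : {ffun 'I_n -> U}) : diag_lfun n \1%VF w = w.
Proof. by apply/ffunP => i; rewrite diag_lfunE id_lfunE. Qed.

(** The diagonal action preserves the nondegenerate form given by the sum of the B (x_i, y_i). *)
Lemma real_diag_det (g : 'End(V)) : in_O B g -> `|lfun_det (diag_lfun n g)| = 1.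
Proof.
move=> [_ iso]; apply/eqP; rewrite -sqr_norm_eq1 ?real_normK ?num_real //.
apply/eqP; apply: (lfun_det_isometry (beta := fun x y : {ffun 'I_n -> V} => \sum_i B (x i) (y i))).
- move=> y a x x'; rewrite mulr_sumr -big_split; apply: eq_bigr => i _.
  by rewrite !ffunE formDl formZl.
- move=> x a y y'; rewrite mulr_sumr -big_split; apply: eq_bigr => i _.
  by rewrite !ffunE formDr formZr.
- move=> x hx; apply/ffunP => i; rewrite ffunE; apply: (form_nd nd) => y.
  have := hx [ffun j => if j == i then y else 0]; rewrite (bigD1 i) //= ffunE eqxx.
  by rewrite big1 ?addr0 // => j ji; rewrite ffunE (negPf ji) linear0r.
- by move=> x y; apply: eq_bigr => i _; rewrite !diag_lfunE iso.
Qed.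

Theorem real_case : (n < \dim {:V})%N -> forall f : ({ffun 'I_n -> V} -> R[i]) -> R[i],
  tempered f -> invariant_under (in_SO B) (diag_lfun n (W := V)) f ->
  invariant_under (in_O B) (diag_lfun n (W := V)) f.
Proof.
move=> nV f hf inv; have [T0 [T1 [e [fr cT]]]] := exists_real_frame.
set eta := (fun t => _) in fr.
have [t0 _] : exists t0 : T0 + T1, true.
  have : (0 < #|{: T0 + T1}|)%N by rewrite card_sum cT (leq_ltn_trans _ nV).
  by case/card_gt0P => t _; exists t.
pose L : finType := ((T0 + T1) * 'I_n)%type.
pose P (w : {ffun 'I_n -> V}) : 'rV[R]_#|L| := \row_i fcoord B e eta (w (enum_val i).2) (enum_val i).1.
pose Q (x : 'rV[R]_#|L|) : {ffun 'I_n -> V} := [ffun j => \sum_t x 0 (enum_rank (t, j)) *: e t].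
have PL : linear P by move=> c w w'; apply/rowP => i; rewrite !mxE !ffunE fcoord_lin.
have QL : linear Q.
  move=> c x y; apply/ffunP => j; rewrite !ffunE scaler_sumr -big_split.
  by apply: eq_bigr => t _; rewrite !mxE scalerDl scalerA.
have PK : cancel P Q.
  move=> w; apply/ffunP => j; rewrite ffunE [RHS](fcoord_sum fr).
  by apply: eq_bigr => t _; rewrite mxE enum_rankK.
have QK : cancel Q P.
  move=> x; apply/rowP => i; rewrite mxE ffunE (fcoordK fr).
  by rewrite -[in RHS](enum_valK i); case: (enum_val i).
have PE w l : P w 0 (enum_rank l) = fcoord B e eta (w l.2) l.1 by rewrite mxE enum_rankK.
have dM (g h : 'End(V)) w := diag_lfun_comp g h w.
apply: (O_invariant nd dM (@diag_lfun1 _ V) real_diag_det fr (t0 := t0) hf inv PL QL PK QK).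
move=> part hpart.
have hu := tempR_odd_component hf PL QL PK QK
  (act_ker dM (@diag_lfun1 _ V) (refl_in_O nd fr t0)) hpart.
have flow b c p q r (F : (L -> R) -> L -> R) w :
    (forall z l, F z l = plane_coord b c p q r (fun t => z (t, l.2)) l.1) ->
    P (diag_lfun n (plane B e eta b c p q r) w) = lmap F (P w).
  move=> hF; apply/rowP => i; rewrite !mxE diag_lfunE (fcoord_plane fr) hF.
  by congr plane_coord; apply/funext => t; rewrite PE.
apply: (real_vanishing hu); last by rewrite cT.
- move=> b c bc side s psi hs.
  have eE : eta b = eta c by move: side; rewrite /eta; case: (b) => ?; case: (c).
  have := plane_in_SO nd fr (b := b) (c := c) (p := cos (s / 2)) (q := sin (s / 2)) (r := - sin (s / 2)) bc.
  rewrite !mulrN opprK -!expr2 cos2Dsin2 eE subrr => /(_ erefl erefl).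
  rewrite cos_half sin_half => SOm.
  apply: (odd_component_SO nd dM (@diag_lfun1 _ V) real_diag_det fr t0 inv PL QL PK _ SOm _ hs).
  move=> w; apply: flow => z l; rewrite /two_row /plane_coord.
  by case: l => t k /=; case: eqP => [->|_]; [|case: eqP => [->|_]]; ring.
- move=> b c s psi hs.
  have := plane_in_SO nd fr (b := inl b) (c := inr c) (p := hcos (s / 2)) (q := hsin (s / 2))
    (r := hsin (s / 2)) isT.
  rewrite -!expr2 hcos_hsin /eta mul1r mulN1r subrr => /(_ erefl erefl).
  rewrite hcos_half hsin_half => SOm.
  apply: (odd_component_SO nd dM (@diag_lfun1 _ V) real_diag_det fr t0 inv PL QL PK _ SOm _ hs).
  move=> w; apply: flow => z l; rewrite /two_row /plane_coord.
  by case: l => t k /=; case: eqP => [->|_]; [|case: eqP => [->|_]]; ring.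
- move=> t psi hs.
  apply: (odd_component_refl nd dM (@diag_lfun1 _ V) real_diag_det fr t0 inv PL QL PK _ (t := t) _ hs).
  move=> w; apply/rowP => i; rewrite !mxE diag_lfunE (fcoord_refl fr) /flip_row PE.
  by case: eqP.
Qed.

End RealCase.

Section ComplexCase.
Variables (R : realType) (n : nat) (V : vectType R[i]) (B : {symmetric V}).
Hypothesis nd : nondegenerate B.
Local Notation W := {ffun 'I_n -> realify V}.
Local Notation act := (fun g : 'End(V) => diag_lfun n (realify_lfun g)).
Local Notation d := (\dim {:V}).

Lemma exists_complex_frame : exists e : 'I_d -> V, frame B e (fun=> 1).
Proof.
have [e [eta fr]] := exists_frame nd; have [_ eta0 _ _] := fr.
have c0 i : (sqrtC (eta i))^-1 != 0 by rewrite invr_eq0 sqrtC_eq0.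
exists (fun i => (sqrtC (eta i))^-1 *: e i).
move: (frame_scale fr c0); congr frame; apply/funext => t.
by rewrite exprVn sqrtCK mulVf.
Qed.

Lemma realify_actE g (w : W) i : act g w i = g (w i) :> V.
Proof. by rewrite diag_lfunE realify_lfunE. Qed.

Lemma realify_actM (g h : 'End(V)) (w : W) : act (g \o h)%VF w = act g (act h w).
Proof. by apply/ffunP => i; rewrite !realify_actE comp_lfunE. Qed.

Lemma realify_act1 (w : W) : act \1%VF w = w.
Proof. by apply/ffunP => i; rewrite realify_actE id_lfunE. Qed.

Lemma realifyE (a : R) (w w' : W) i : (a *: w + w') i = a%:C *: (w i : V) + w' i :> V.
Proof. by rewrite !ffunE. Qed.

Lemma Re_lin (a : R) (z z' : R[i]) : complex.Re (a%:C * z + z') = a * complex.Re z + complex.Re z'.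
Proof. exact: (real_part_Re R).1. Qed.

Lemma Im_lin (a : R) (z z' : R[i]) : complex.Im (a%:C * z + z') = a * complex.Im z + complex.Im z'.
Proof. exact: (real_part_Im R).1. Qed.

(** The real part of the summed form is preserved, and it is nondegenerate since Re B (x, i y) = -
    Im B (x, y). *)
Lemma complex_diag_det (g : 'End(V)) : in_O B g -> `|lfun_det (act g)| = 1.
Proof.
move=> [_ iso]; apply/eqP; rewrite -sqr_norm_eq1 ?real_normK ?num_real //.
apply/eqP; apply: (lfun_det_isometry (beta := fun x y : W => \sum_i complex.Re (B (x i) (y i)))).
- move=> y a x x'; rewrite mulr_sumr -big_split; apply: eq_bigr => i _.
  by rewrite realifyE formDl formZl Re_lin.
- move=> x a y y'; rewrite mulr_sumr -big_split; apply: eq_bigr => i _.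
  by rewrite realifyE formDr formZr Re_lin.
- move=> x hx; apply/ffunP => i; rewrite ffunE; apply: (form_nd nd) => y.
  have Re0 (z : V) : complex.Re (B (x i) z) = 0.
    have := hx [ffun j => if j == i then z else 0]; rewrite (bigD1 i) //= ffunE eqxx.
    by rewrite big1 ?addr0 // => j ji; rewrite ffunE (negPf ji) linear0r.
  have := Re0 y; have := Re0 ('i *: y); rewrite formZr.
  by case: (B _ _) => p q /=; rewrite mul0r mul1r sub0r => /eqP; rewrite oppr_eq0 => /eqP -> ->.
- by move=> x y; apply: eq_bigr => i _; rewrite !realify_actE iso.
Qed.

Lemma boost_sqrB (x y : R) : x%:C ^+ 2 - 'i * y%:C * - ('i * y%:C) = (x ^+ 2 - y ^+ 2)%:C.
Proof. by rewrite mulrN opprK mulrACA -!expr2 sqr_i mulN1r rmorphB !rmorphXn. Qed.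

Lemma boost_sqrD (x y : R) : x%:C ^+ 2 + 'i * y%:C * - ('i * y%:C) = (x ^+ 2 + y ^+ 2)%:C.
Proof. by rewrite mulrN mulrACA -!expr2 sqr_i mulN1r opprK rmorphD !rmorphXn. Qed.

Lemma boost_mul (x y : R) : 2 * x%:C * ('i * y%:C) = 'i * (2 * x * y)%:C.
Proof. by rewrite !rmorphM rmorph_nat; ring. Qed.

Theorem complex_case : (n < \dim {:V})%N -> forall f : (W -> R[i]) -> R[i],
  tempered f -> invariant_under (in_SO B) act f -> invariant_under (in_O B) act f.
Proof.
move=> nV f hf inv; have [e fr] := exists_complex_frame.
set eta := (fun=> 1) in fr; pose t0 : 'I_d := Ordinal (leq_ltn_trans (leq0n n) nV).
pose L : finType := ('I_d * ('I_n * bool))%type.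
pose reim (b : bool) (z : R[i]) : R := if b then complex.Im z else complex.Re z.
have reimL b (a : R) z z' : reim b (a%:C * z + z') = a * reim b z + reim b z'.
  by case: b; [exact: Im_lin|exact: Re_lin].
pose co (w : W) (l : L) : R := reim l.2.2 (fcoord B e eta (w l.2.1) l.1).
pose P (w : W) : 'rV[R]_#|L| := \row_i co w (enum_val i).
pose X (x : 'rV[R]_#|L|) t j : R[i] := x 0 (enum_rank ((t, (j, false)) : L)) +i* x 0 (enum_rank ((t, (j, true)) : L)).
pose Q (x : 'rV[R]_#|L|) : W := [ffun j => \sum_t X x t j *: e t].
have PL : linear P.
  by move=> c w w'; apply/rowP => i; rewrite !mxE /co realifyE fcoord_lin reimL.
have QL : linear Q.
  move=> c x y; apply/ffunP => j; rewrite realifyE !ffunE scaler_sumr -big_split.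
  apply: eq_bigr => t _ /=; rewrite scalerA -scalerDl; apply: (congr1 (fun z : R[i] => z *: e t)).
  by rewrite /X !mxE; simpc.
have PE w l : P w 0 (enum_rank l) = co w l by rewrite mxE enum_rankK.
have PK : cancel P Q.
  move=> w; apply/ffunP => j; rewrite ffunE [RHS](fcoord_sum fr).
  apply: eq_bigr => t _; apply: (congr1 (fun z : R[i] => z *: e t)); rewrite /X !PE /co /=.
  by case: (fcoord _ _ _ _ _).
have QK : cancel Q P.
  move=> x; apply/rowP => i; rewrite mxE /co ffunE (fcoordK fr).
  by rewrite -[in RHS](enum_valK i); case: (enum_val i) => t [j []].
apply: (O_invariant nd realify_actM realify_act1 complex_diag_det fr (t0 := t0) hf inv PL QL PK QK).
move=> part hpart.
have hu := tempR_odd_component hf PL QL PK QK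
  (act_ker realify_actM realify_act1 (refl_in_O nd fr t0)) hpart.
have flow b c p q r (F : (L -> R) -> L -> R) w :
    (forall z l, F (fun l => reim l.2.2 (z l.2.1 l.1)) l = reim l.2.2 (plane_coord b c p q r (z l.2.1) l.1)) ->
    P (act (plane B e eta b c p q r) w) = lmap F (P w).
  move=> hF; apply/rowP => i; rewrite !mxE /co realify_actE (fcoord_plane fr) -(hF (fun j => fcoord B e eta (w j))).
  by congr F; apply/funext => l; rewrite PE.
apply: (complex_vanishing hu); last by rewrite card_ord.
- move=> b c bc s psi hs.
  have := plane_in_SO nd fr (b := b) (c := c) (p := (cos (s / 2))%:C) (q := (sin (s / 2))%:C) (r := - (sin (s / 2))%:C) bc.
  rewrite !mulrN opprK -!expr2 -!rmorphXn -rmorphD cos2Dsin2 subrr -rmorphB cos_half.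
  rewrite -(rmorphMn _ 2 1) -!rmorphM sin_half => /(_ erefl erefl) SOm.
  apply: (odd_component_SO nd realify_actM realify_act1 complex_diag_det fr t0 inv PL QL PK _ SOm _ hs).
  move=> w; apply: flow => z l; rewrite /two_row /plane_coord.
  case: l => t [j f'] /=; case: eqP => [->|_]; [|case: eqP => [->|_]] => //.
    by rewrite /reim; case: f'; case: (z j b) (z j c) => x y [x' y'] /=; ring.
  by rewrite /reim; case: f'; case: (z j b) (z j c) => x y [x' y'] /=; ring.
- move=> b c bc s psi hs.
  (* The rotation by the angle i s / 2: cos (i s) is the hyperbolic cosine of s, and sin (i s) is i
     times its hyperbolic sine. *)
  have := plane_in_SO nd fr (b := b) (c := c) (p := (hcos (s / 2))%:C)
    (q := 'i * (hsin (s / 2))%:C) (r := - ('i * (hsin (s / 2))%:C)) bc.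
  rewrite boost_sqrB hcos_hsin !mul1r subrr => /(_ erefl erefl).
  rewrite boost_sqrD hcos_half mulrN boost_mul hsin_half => SOm.
  apply: (odd_component_SO nd realify_actM realify_act1 complex_diag_det fr t0 inv PL QL PK _ SOm _ hs).
  move=> w; apply: flow => z l; rewrite /two_row /plane_coord.
  case: l => t [j f'] /=; case: eqP => [->|_]; [|case: eqP => [->|_]] => //.
    by rewrite /reim; case: f'; case: (z j b) (z j c) => x y [x' y'] /=; ring.
  by rewrite /reim; case: f'; case: (z j b) (z j c) => x y [x' y'] /=; ring.
- move=> t psi hs.
  apply: (odd_component_refl nd realify_actM realify_act1 complex_diag_det fr t0 inv PL QL PK _ (t := t) _ hs).
  move=> w; apply/rowP => i; rewrite !mxE /co realify_actE (fcoord_refl fr) /flip_row PE.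
  case: eqP => // _; rewrite /co; move: (fcoord _ _ _ _ _) => z.
  by rewrite /reim; case: (_.2.2); case: z.
Qed.

End ComplexCase.

Theorem corollary3p2 (R : realType) (n : nat) (n_gt0 : (0 < n)%N) :
  (forall (V : vectType R) (B : {symmetric V}),
     nondegenerate B -> (n < \dim {:V})%N ->
     forall f : ({ffun 'I_n -> V} -> R[i]) -> R[i],
       tempered f ->
       invariant_under (in_SO B) (diag_lfun n (W := V)) f ->
       invariant_under (in_O B) (diag_lfun n (W := V)) f)
  /\
  (forall (V : vectType R[i]) (B : {symmetric V}),
     nondegenerate B -> (n < \dim {:V})%N ->
     forall f : ({ffun 'I_n -> realify V} -> R[i]) -> R[i],
       tempered f ->
       invariant_under (in_SO B) (fun g => diag_lfun n (realify_lfun g)) f ->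
       invariant_under (in_O B) (fun g => diag_lfun n (realify_lfun g)) f).
Proof.
by split=> V B nd nV f hf inv; [exact: real_case|exact: complex_case].
Qed.
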